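(* Let $\$(\nu)=O(e^{\sigma\nu})$ for some $\sigma\in(0,\infty)$. Let $\gamma$ be finite-intersection weights with $\mathrm{decay}_\gamma>1$. If the quadrature assumption (Q) of the context is satisfied with exponent $\tau$ and if $\gamma_u\ge\gamma_v$ for all $u,v\in\mathcal U$ with $u\subseteq v$, then for all $\delta>0$ $$e(N,B(K))^2=O\left(N^{-\min\{\tau,\ \mathrm{decay}_\gamma-1\}+\delta}\right),$$ or, equivalently, $$p^{\rm res}\le\max\left\{\frac2\tau,\ \frac{2}{\mathrm{decay}_\gamma-1}\right\}.$$ Assume additionally that $e(N,B(K))=\Omega(N^{-\alpha/2})$ for $\alpha=\tau$ and that $\$(\nu)=\Omega(\nu)$. Then $$p^{\rm res}=\max\left\{\frac2\alpha,\ \frac{2}{\mathrm{decay}_\gamma-1}\right\}.$$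
   Context: Notation: $\mathbb N=\{1,2,\dots\}$, $\mathcal U$ is the set of all finite subsets of $\mathbb N$. $f=\Omega(g)$ means $g=O(f)$. For a reproducing kernel $L$, $H(L)$ is the reproducing kernel Hilbert space with norm $\|\cdot\|_L$, and $B(L)$ its norm unit ball. Setting: $D\subseteq\mathbb R$, $\rho$ is a probability measure on $D$, $\mu=\otimes_{n\in\mathbb N}\rho$ on $D^{\mathbb N}$. $k\ne0$ is a measurable reproducing kernel on $D\times D$ such that $H(k)$ contains no nonzero constant function, $M:=\int_D k(x,x)\,\rho(dx)<\infty$, $\int_D k(x,y)\,\rho(dx)=0$ for all $y\in D$, and $k(a,a)>0$ for all $a\in D$. The weights $\gamma=(\gamma_u)_{u\in\mathcal U}$ are non-negative with $\gamma_\emptyset=1$, $\sum_{u}\gamma_uM^{|u|}<\infty$, and $\gamma_v>0$ implies $\gamma_u>0$ for all $u\subseteq v$. Put $k_u(x,y)=\prod_{j\in u}k(x_j,y_j)$ ($k_\emptyset=1$), $H_u=H(k_u)$ (functions depending only on $x_u=(x_j)_{j\in u}$, identified with functions on $D^u$), $\mathfrak X=\{x\in D^{\mathbb N}:\sum_{u\in\mathcal U}\gamma_uk_u(x,x)<\infty\}$ (one has $\mu(\mathfrak X)=1$), $K(x,y)=\sum_{u\in\mathcal U}\gamma_uk_u(x,y)$ for $x,y\in\mathfrak X$, and $I(f)=\int_{\mathfrak X}f\,d\mu$ for $f\in H(K)$. Finite-intersection weights: there is $\beta\in\mathbb N$ with $\gamma_u=0$ whenever $|u|>\beta$ (finite-order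 weights), and there is $\varrho\in\mathbb N$ with $|\{v\in\mathcal U:\gamma_v>0,\ u\cap v\ne\emptyset\}|\le1+\varrho$ for all $u\in\mathcal U$ with $\gamma_u>0$. Anchor: $a=(a,a,\dots)$ where $a\in D$ satisfies $\sum_{u\in\mathcal U}\gamma_uk(a,a)^{|u|}<\infty$. Cost and algorithms: $\$:\mathbb N_0\to[1,\infty]$ is monotone increasing. For $v\in\mathcal U$ let $\mathfrak X_{v,a}=\{x\in D^{\mathbb N}: x_j=a\ \forall j\notin v\}$. Evaluating $f$ at $x$ costs $c_a(x)=\inf\{\$(|u|): x\in\mathfrak X_{u,a},\,u\in\mathcal U\}$. A randomized algorithm $Q$ yields for each $f\in H(K)$ a square-integrable random variable $Q(f)$, computed from (possibly adaptively and randomly chosen) function values of $f$; its cost $\mathrm{cost}_{c_a}(Q,f)$ is the sum of the costs of all function evaluations. $\mathcal A^{\rm res}$ is the class of all randomized algorithms for which there exist $n\in\mathbb N_0$ and $v_1,\dots,v_n\in\mathcal U$ such that for every $f\in H(K)$ exactly $n$ function evaluations are performed, the $i$th sample point is taken from $\mathfrak X_{v_i,a}$, and $\mathbb E(\mathrm{cost}_{c_a}(Q,f))=\sum_{i=1}^n\$(|v_i|)$. For $F\subseteq H(K)$: $\mathrm{cost}(Q,F)=\sup_{f\in F}\mathbb E(\mathrm{cost}_{c_a}(Q,f))$, $e(Q,F)=(\sup_{f\in F}\mathbb E((I(f)-Q(f))^2))^{1/2}$, $e(N,F)=\inf\{e(Q,F): Q\in\mathcal A^{\rm res},\ \mathrm{cost}(Q,F)\le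 N\}$. Further, $\mathrm{comp}(\varepsilon,B(K))=\inf\{\mathrm{cost}(Q,B(K)): Q\in\mathcal A^{\rm res},\ e(Q,B(K))\le\varepsilon\}$, and $p^{\rm res}$ is the infimum of all $p\ge0$ for which there is $C\ge0$ with $\mathrm{comp}(\varepsilon,B(K))\le C\varepsilon^{-p}$ for all $\varepsilon>0$. Decay: with $\widehat\gamma_u=\gamma_uk_u(a,a)$, $\mathrm{decay}_\gamma=\sup\{p\in\mathbb R:\sum_{u\in\mathcal U}\widehat\gamma_u^{1/p}<\infty\}$. Quadrature assumption (Q): there are $c,C,\tau>0$, $\alpha_1\ge0$, $\alpha_2\in[0,1]$ such that for every nonempty $u\in\mathcal U$ with $\gamma_u>0$ and every $n\in\mathbb N$ there is an unbiased randomized quadrature $Q_{u,n}(\omega,f)=\sum_{i=1}^nt_if(x^{(i)}(\omega))$, $f\in L^2(D^u,\rho^u)$, with deterministic real $t_i$ satisfying $\sum_it_i=1$, with $\omega=(\omega_j)_{j\in u}$ in a product probability space $(\Omega^u,\mathbb P^u)$, and random points $x^{(i)}=(x^{(i)}_j)_{j\in u}\in D^u$ such that $x^{(i)}_j$ depends on $\omega$ only through $\omega_j$ and has distribution $\rho$, and such that for all $w\subseteq u$ with $\gamma_w>0$ and all $f_w\in H_w$ $$\mathrm{Var}(Q_{u,n}(f_w))\le c\,C^{|u|}(n+1)^{-\tau}F_w(n)\|f_w\|_{k_w}^2,$$ where $F_w(n)=1$ if $|w|\le1$ and $F_w(n)=\left(1+\frac{\ln(n+1)}{(|w|-1)^{\alpha_2}}\right)^{\alpha_1(|w|-1)^{\alpha_2}}$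 if $|w|\ge2$. *)

(* Defs.v *)
From HB Require Import structures.
From mathcomp Require Import all_boot all_order all_algebra finmap.
From mathcomp Require Import all_classical all_reals all_analysis.
From mathcomp Require Import measurable_realfun.

Set Implicit Arguments.
Unset Strict Implicit.
Unset Printing Implicit Defensive.
Import Order.TTheory GRing.Theory Num.Theory.
Import numFieldNormedType.Exports.

Local Open Scope classical_set_scope.
Local Open Scope ring_scope.
Local Open Scope ereal_scope.

(* A subset [D] of the reals as a measurable space, with the trace of the Borel
   sigma-algebra. Measurable types are pointed: [a] only serves as the
   distinguished point. *)
Definition pointed_set (R : realType) (D : set R) (a : D) : Type := set_type D.

HB.instance Definition _ (R : realType) (D : set R) (a : D) :=
  Choice.on (pointed_set a).
HB.instance Definition _ (R : realType) (D : set R) (a : D) :=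
  isPointed.Build (pointed_set a) a.

Definition trace (R : realType) (D : set R) (a : D) :=
  g_sigma_algebra_preimageType (fun x : pointed_set a => val x : R).

Definition cylinders (I : Type) d (T : measurableType d) : set (set (I -> T)) :=
  \bigcup_(i in [set: I]) preimage_set_system setT (fun x : I -> T => x i)
                            measurable.

Definition power (I : Type) d (T : measurableType d) :=
  g_sigma_algebraType (@cylinders I d T).

Definition is_product (I : choiceType) d (T : measurableType d) (R : realType)
    (P : probability T R) (PI : probability (power I T) R) : Prop :=
  forall (J : {fset I}) (A : I -> set T), (forall i, measurable (A i)) ->
  PI [set x | forall i, i \in J -> A i (x i)] = \prod_(i <- J) P (A i).

Definition reproducing_kernel (R : realType) (Y : Type) (L : Y -> Y -> R) :=
  (forall x y, L x y = L y x) /\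
  (forall n (x : 'I_n -> Y) (c : 'I_n -> R),
     (0 <= \sum_i \sum_j c i * c j * L (x i) (x j))%R).

(* A Hilbert space of functions on [Y] with reproducing kernel [L]. The carrier
   and the inner product on it are uniquely determined by [L]; the values of
   [rkhs_ip] outside of the carrier are irrelevant. *)
Record rkhs (R : realType) (Y : Type) (L : Y -> Y -> R) := Rkhs {
  rkhs_set :> (Y -> R) -> Prop ;
  rkhs_ip : (Y -> R) -> (Y -> R) -> R ;
  rkhs0 : rkhs_set (fun=> 0%R) ;
  rkhs_lin : forall (c : R) f g, rkhs_set f -> rkhs_set g ->
    rkhs_set (fun x => (c * f x + g x)%R) ;
  rkhs_ipC : forall f g, rkhs_set f -> rkhs_set g -> rkhs_ip f g = rkhs_ip g f ;
  rkhs_ipl : forall (c : R) f g h,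
    rkhs_set f -> rkhs_set g -> rkhs_set h ->
    rkhs_ip (fun x => (c * f x + g x)%R) h =
      (c * rkhs_ip f h + rkhs_ip g h)%R ;
  rkhs_ip_ge0 : forall f, rkhs_set f -> (0 <= rkhs_ip f f)%R ;
  rkhs_ip_eq0 : forall f, rkhs_set f -> rkhs_ip f f = 0%R -> f = fun=> 0%R ;
  rkhs_complete : forall f_ : nat -> Y -> R, (forall n, rkhs_set (f_ n)) ->
    (forall e : R, (0 < e)%R -> exists N, forall m n, (N <= m)%N -> (N <= n)%N ->
       (rkhs_ip (f_ m \- f_ n)%R (f_ m \- f_ n)%R < e)%R) ->
    exists2 g, rkhs_set g &
      rkhs_ip (f_ n \- g)%R (f_ n \- g)%R @[n --> \oo] --> (0 : R)%R ;
  rkhs_section : forall y, rkhs_set (fun x => L x y) ;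
  rkhs_reproducing : forall f y, rkhs_set f -> rkhs_ip f (fun x => L x y) = f y
}.

Definition rkhs_norm (R : realType) (Y : Type) (L : Y -> Y -> R) (H : rkhs L)
  (f : Y -> R) : R := Num.sqrt (rkhs_ip H f f).

Definition unit_ball (R : realType) (Y : Type) (L : Y -> Y -> R)
    (H : rkhs L) : set (Y -> R) :=
  [set f | H f /\ (rkhs_norm H f <= 1)%R].

Definition restr d (T : measurableType d) (u : {fset nat})
    (x : power nat T) : power u T := fun j => x (val j).
Arguments restr {d T} u x _.

Definition restr2 d (T : measurableType d) (w u : {fset nat})
    (wu : (w `<=` u)%fset) (x : power u T) : power w T :=
  fun j => x (fincl wu j).
Arguments restr2 {d T w u} wu x _.

Definition kprod d (T : measurableType d) (R : realType) (k : T -> T -> R)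
    (u : {fset nat}) (x y : power u T) : R :=
  (\prod_(j : u) k (x j) (y j))%R.
Arguments kprod {d T R} k u x y.

Section kernels.
Context d (T : measurableType d) (R : realType).
Variables (k : T -> T -> R) (gamma : {fset nat} -> R).

Definition Xset : set (power nat T) :=
  [set x | \esum_(u in [set: {fset nat}])
             (gamma u * kprod k u (restr u x) (restr u x))%:E < +oo].

(* Only meaningful for absolutely summable families. *)
Definition abs_sum (f : {fset nat} -> R) : R :=
  fine (\esum_(u in [set: {fset nat}]) (EFin \o f)^\+ u
        - \esum_(u in [set: {fset nat}]) (EFin \o f)^\- u).

Definition Kker (x y : Xset) : R :=
  abs_sum (fun u => (gamma u * kprod k u (restr u (val x)) (restr u (val y)))%R).

(* Functions on [Xset] are extended by 0 to be integrated over [Xset]. *)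
Definition Iop (mu : probability (power nat T) R) (f : Xset -> R) : R :=
  (\int[mu]_(x in Xset) ('valL_ 0 f) x)%R.

(* The degenerate values p <= 0 have no influence as soon as decay > 0; for
   p = 0 the convention 0^-1 = 0 makes every summand equal to 1. *)
Definition decay (a : T) : \bar R :=
  ereal_sup [set p%:E | p in [set p : R |
    \esum_(u in [set: {fset nat}])
      ((gamma u * k a a ^+ #|` u|) `^ p^-1)%:E < +oo]].

End kernels.
Arguments Kker {d T R} k gamma x y.
Arguments Iop {d T R} k gamma mu f.

Definition finite_intersection (R : realType) (gamma : {fset nat} -> R) :=
  (exists2 beta, (0 < beta)%N &
     forall u : {fset nat}, (beta < #|` u|)%N -> gamma u = 0%R) /\
  (exists2 r, (0 < r)%N & forall u : {fset nat}, (0 < gamma u)%R ->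
     ([set v : {fset nat} | (0 < gamma v)%R /\ (u `&` v)%fset != fset0]
        #<= `I_(1 + r)%N)%card).

Definition anchored d (T : measurableType d) (a : T) (v : {fset nat}) :
    set (power nat T) :=
  [set x | forall j : nat, j \notin v -> x j = a].

Definition eval_cost d (T : measurableType d) (R : realType)
    (dollar : nat -> \bar R) (a : T) (x : power nat T) : \bar R :=
  ereal_inf [set dollar #|` u| | u in [set u | anchored a u x]].

(* A randomized algorithm for functions on [Y] from the class [H]. Given the
   random element [w] and the function values observed so far, [ra_next]
   returns the next sample point, or [None] to stop and output [ra_out].
   [ra_pts f w] is the resulting list of sample points: since
   [onth s i = Some s_i] for [i < size s] and [onth s (size s) = None], it is
   determined by [ra_ptsE]. Outputs are required to be square-integrable random
   variables, and costs to be random variables (so that both have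
   expectations). *)
Record rand_alg (R : realType) (Y : Type) (cost : Y -> \bar R)
    (H : set (Y -> R)) := RandAlg {
  ra_disp : measure_display ;
  ra_space : measurableType ra_disp ;
  ra_P : probability ra_space R ;
  ra_next : ra_space -> seq R -> option Y ;
  ra_out : ra_space -> seq R -> R ;
  ra_pts : (Y -> R) -> ra_space -> seq Y ;
  ra_ptsE : forall f w, H f -> forall i, (i <= size (ra_pts f w))%N ->
    ra_next w [seq f x | x <- take i (ra_pts f w)] = onth (ra_pts f w) i ;
  ra_val := fun (f : Y -> R) (w : ra_space) =>
    (ra_out w [seq f x | x <- ra_pts f w] : R) ;
  ra_cost := fun (f : Y -> R) (w : ra_space) =>
    (\sum_(x <- ra_pts f w) cost x : \bar R) ;
  ra_val_L2 : forall f, H f -> ra_val f \in Lfun ra_P 2%:E ;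
  ra_cost_meas : forall f, H f -> measurable_fun setT (ra_cost f)
}.

Arguments ra_pts {R Y cost H} r f w.
Arguments ra_val {R Y cost H} r f w.
Arguments ra_cost {R Y cost H} r f w.

Section complexity.
Context d (T : measurableType d) (R : realType).
Variables (dollar : nat -> \bar R) (a : T) (X : set (power nat T)).
Variable H : set (X -> R).

Let alg := rand_alg (fun x : X => eval_cost dollar a (val x)) H.

Definition mean_cost (Q : alg) (f : X -> R) : \bar R :=
  \int[ra_P Q]_w ra_cost Q f w.

(* [vs] lists the sets v_1, ..., v_n. *)
Definition Ares (Q : alg) : Prop :=
  exists vs : seq {fset nat},
    (forall f, H f -> forall w, size (ra_pts Q f w) = size vs /\
       all2 (fun x v => `[< anchored a v (val x) >]) (ra_pts Q f w) vs) /\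
    (forall f, H f -> mean_cost Q f = \sum_(v <- vs) dollar #|` v|).

Definition wc_cost (Q : alg) (F : set (X -> R)) : \bar R :=
  ereal_sup [set mean_cost Q f | f in F].

Variable I : (X -> R) -> R.

Definition wc_error (Q : alg) (F : set (X -> R)) : \bar R :=
  (ereal_sup [set 'E_(ra_P Q)[fun w => ((I f - ra_val Q f w) ^+ 2)%R]
             | f in F]) `^ 2^-1.

Definition min_error (N : nat) (F : set (X -> R)) : \bar R :=
  ereal_inf [set e | exists Q : alg,
    [/\ Ares Q, wc_cost Q F <= N%:R%:E & e = wc_error Q F]].

Definition eps_comp (eps : R) (F : set (X -> R)) : \bar R :=
  ereal_inf [set c | exists Q : alg,
    [/\ Ares Q, wc_error Q F <= eps%:E & c = wc_cost Q F]].

Definition pres (F : set (X -> R)) : \bar R :=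
  ereal_inf [set p%:E | p in [set p : R | (0 <= p)%R /\
    exists2 C : R, (0 <= C)%R &
      forall eps : R, (0 < eps)%R -> eps_comp eps F <= (C * eps `^ (- p))%:E]].

End complexity.
Arguments min_error {d T R} dollar a {X} H I N F.
Arguments eps_comp {d T R} dollar a {X} H I eps F.
Arguments pres {d T R} dollar a {X} H I F.

(* The [j]-th coordinate of the [i]-th point is [qd_pt i j (omega j)]. *)
Record quadrature d (T : measurableType d) (R : realType)
    (rho : probability T R) (u : {fset nat}) (n : nat) := Quadrature {
  qd_disp : measure_display ;
  qd_space : measurableType qd_disp ;
  qd_P : probability qd_space R ;
  qd_Pu : probability (power u qd_space) R ;
  qd_product : is_product qd_P qd_Pu ;
  qd_t : 'I_n -> R ;
  qd_sum_t : (\sum_i qd_t i = 1)%R ;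
  qd_pt : 'I_n -> u -> {mfun qd_space >-> T} ;
  qd_distr : forall i j (A : set T), measurable A ->
    distribution qd_P (qd_pt i j) A = rho A
}.

Arguments qd_pt {d T R rho u n} q i j.

Definition qd_val d (T : measurableType d) (R : realType)
    (rho : probability T R) (u : {fset nat}) (n : nat)
    (Q : quadrature rho u n) (f : power u T -> R)
    (omega : power u (qd_space Q)) : R :=
  (\sum_i qd_t Q i * f (fun j => qd_pt Q i j (omega j)))%R.

Arguments qd_val {d T R rho u n} Q f omega.

Definition Ffactor (R : realType) (alpha1 alpha2 : R) (m n : nat) : R :=
  if (m <= 1)%N then 1%R
  else ((1 + ln n.+1%:R / m.-1%:R `^ alpha2)
          `^ (alpha1 * m.-1%:R `^ alpha2))%R.

Definition quadrature_assumption d (T : measurableType d) (R : realType)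
    (rho : probability T R)
    (rhou : forall u : {fset nat}, probability (power u T) R)
    (k : T -> T -> R) (gamma : {fset nat} -> R)
    (Hu : forall u : {fset nat}, rkhs (kprod k u)) (tau : R) : Prop :=
  (0 < tau)%R /\
  exists c C alpha1 alpha2 : R,
    [/\ (0 < c)%R, (0 < C)%R, (0 <= alpha1)%R & (0 <= alpha2 <= 1)%R] /\
    forall u : {fset nat}, u != fset0 -> (0 < gamma u)%R ->
    forall n : nat, (0 < n)%N ->
    exists Q : quadrature rho u n,
      (forall f : power u T -> R, f \in Lfun (rhou u) 2%:E ->
         'E_(qd_Pu Q)[qd_val Q f] = 'E_(rhou u)[f]) /\
      (forall (w : {fset nat}) (wu : (w `<=` u)%fset), (0 < gamma w)%R ->
       forall f : power w T -> R, Hu w f ->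
         'V_(qd_Pu Q)[qd_val Q (fun x => f (restr2 wu x))]
           <= (c * C ^+ #|` u| * n.+1%:R `^ (- tau)
                 * Ffactor alpha1 alpha2 #|` w| n
                 * rkhs_norm (Hu w) f ^+ 2)%:E).

Definition ebigO (R : realType) (f : nat -> \bar R) (g : nat -> R) : Prop :=
  exists C : R, \forall n \near \oo, f n <= (C * g n)%:E.

Definition ebigOmega (R : realType) (f : nat -> \bar R) (g : nat -> R) : Prop :=
  exists C : R, \forall n \near \oo, (g n)%:E <= C%:E * f n.

(* Main.v *)
Require Import Defs.
From HB Require Import structures.
From mathcomp Require Import all_boot all_order all_algebra finmap.
From mathcomp Require Import all_classical all_reals all_analysis.
From mathcomp Require Import measurable_realfun ring lra zify.

Set Implicit Arguments.
Unset Strict Implicit.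
Unset Printing Implicit Defensive.
Import Order.TTheory GRing.Theory Num.Theory.
Import numFieldNormedType.Exports.

(* Upper bound. For q < tau with 1 + q < decay and a parameter m, let A be the
   finite set of those u with gamma_u >= m^-(1+q), and use about
   n_u = gamma_u^(1/q) m nodes for the quadrature of the anchored component
   f_u,a = sum over v <= u of (-1)^|u\v| f(x_v, a), u in A. All sets u in A have
   bounded size, so the cost is O(sum of n_u) = O(m). For f in the span of the
   kernel sections, f splits into orthogonal components f_w, and the
   intersection property lets every f_w contribute to boundedly many f_u,a; since
   n_u^-q gamma_u <= m^-q, the variances sum up to O(m^-q), and so does the
   squared bias, which is controlled by the sum of gamma_u over u not in A.
   Density and Fatou's lemma extend the estimate to the whole space.

   Lower bound. Let an algorithm use the sets v_1, ..., v_n, with union V. The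
   representer of the integral is the constant function 1; let g be its
   projection onto the closed span of the kernel sections at the admissible
   points. Then f = 1 - g vanishes at all sample points, I(f) = |f|^2 >= S/(1+S),
   where S is the sum of the gamma_u k(a,a)^|u| over the nonempty u disjoint from
   V, and the algorithm cannot tell f from -f. Only O(|V|) sets with positive
   weight meet V, and |V| is at most linear in the cost, so that a bound on the
   complexity bounds the tails of the series defining the decay. *)

Local Open Scope classical_set_scope.
Local Open Scope ring_scope.

(** * Reproducing kernel Hilbert spaces *)

Section rkhs_theory.
Context (R : realType) (Y : Type) (L : Y -> Y -> R) (H : rkhs L).
Local Notation ip := (rkhs_ip H).
Implicit Types (f g h : Y -> R) (c : R).

(** H(K) is never decomposed as a Hilbert space. Estimates are made on finite combinations of kernel
    sections, where the component of w is an explicit finite sum carrying the factor gamma_w, the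
    squared norm is the sum of the energies over w, and alternating sums over subsets act termwise.
    The exponent 2 / (decay - 1) arises on both sides from one balance. Above, g_u =
    gamma_u^(1/(1+q)) is summable, so O(m) sets have g_u >= 1/m, while gamma_u = g_u^q g_u < m^-q
    g_u for positive weights off these sets: a cost of order m buys a squared error of order m^-q.
    Here q < decay - 1 gives summability, and the gap between q and tau absorbs the logarithms in
    the quadrature assumption. Monotone weights make A closed under subsets, which lets the
    alternating sums in the bias cancel. Below, a complexity of order eps^-p leaves tails of order
    eps^2 outside about eps^-p sets; a series with such tails stays summable after raising its terms
    to any power s with p / (2 + p) < s < 1, which forces decay >= (2 + p) / p = 1 + 2 / p. *)

Lemma rkhsD f g : H f -> H g -> H (fun x => f x + g x).
Proof.
move=> Hf Hg; have := rkhs_lin 1 Hf Hg.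
by under eq_fun do rewrite mul1r.
Qed.

Lemma rkhsZ c f : H f -> H (fun x => c * f x).
Proof.
move=> Hf; have := rkhs_lin c Hf (rkhs0 H).
by under eq_fun do rewrite addr0.
Qed.

Lemma rkhsB f g : H f -> H g -> H (fun x => f x - g x).
Proof.
move=> Hf Hg; have := rkhs_lin (-1) Hg Hf.
by under eq_fun do rewrite mulN1r addrC.
Qed.

Lemma rkhs_sum (I : Type) (s : seq I) (F : I -> Y -> R) :
  (forall i, H (F i)) -> H (fun x => \sum_(i <- s) F i x).
Proof.
move=> HF; elim: s => [|i s ih].
  by under eq_fun do rewrite big_nil; exact: rkhs0.
by under eq_fun do rewrite big_cons; exact: rkhsD.
Qed.

Lemma rkhs_ip0l h : H h -> ip (fun=> 0) h = 0.
Proof.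
move=> Hh; have := rkhs_ipl 1 (rkhs0 H) (rkhs0 H) Hh.
under eq_fun do rewrite mulr0 addr0.
by rewrite mul1r; lra.
Qed.

Lemma rkhs_ipDl f g h : H f -> H g -> H h ->
  ip (fun x => f x + g x) h = ip f h + ip g h.
Proof.
move=> Hf Hg Hh; have := rkhs_ipl 1 Hf Hg Hh.
by under eq_fun do rewrite mul1r; rewrite mul1r.
Qed.

Lemma rkhs_ipZl c f h : H f -> H h -> ip (fun x => c * f x) h = c * ip f h.
Proof.
move=> Hf Hh; have := rkhs_ipl c Hf (rkhs0 H) Hh.
by under eq_fun do rewrite addr0; rewrite rkhs_ip0l// addr0.
Qed.

Lemma rkhs_ipBl f g h : H f -> H g -> H h ->
  ip (fun x => f x - g x) h = ip f h - ip g h.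
Proof.
move=> Hf Hg Hh; have := rkhs_ipl (-1) Hg Hf Hh.
by under eq_fun do rewrite mulN1r addrC; rewrite mulN1r addrC.
Qed.

Lemma rkhs_ip_suml (I : Type) (s : seq I) (F : I -> Y -> R) h :
  (forall i, H (F i)) -> H h ->
  ip (fun x => \sum_(i <- s) F i x) h = \sum_(i <- s) ip (F i) h.
Proof.
move=> HF Hh; elim: s => [|i s ih].
  under eq_fun do rewrite big_nil.
  by rewrite big_nil rkhs_ip0l.
under eq_fun do rewrite big_cons.
rewrite big_cons rkhs_ipDl ?ih//; exact: rkhs_sum.
Qed.

Lemma rkhs_ip_lin_sq c f g : H f -> H g ->
  ip (fun x => c * f x + g x) (fun x => c * f x + g x) =
  c ^+ 2 * ip f f + 2 * c * ip f g + ip g g.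
Proof.
move=> Hf Hg; have Hs := rkhs_lin c Hf Hg.
rewrite rkhs_ipl// (rkhs_ipC Hf Hs) (rkhs_ipC Hg Hs) !rkhs_ipl//.
by rewrite (rkhs_ipC Hg Hf); ring.
Qed.

Lemma rkhs_ip_sub_sq f g : H f -> H g ->
  ip (fun x => f x - g x) (fun x => f x - g x) = ip f f - 2 * ip f g + ip g g.
Proof.
move=> Hf Hg; have := rkhs_ip_lin_sq (-1) Hg Hf.
under eq_fun do rewrite mulN1r addrC.
by move=> ->; rewrite (rkhs_ipC Hg Hf); ring.
Qed.

Lemma rkhs_cauchy_schwarz f g : H f -> H g -> ip f g ^+ 2 <= ip f f * ip g g.
Proof.
move=> Hf Hg.
have f0 := rkhs_ip_ge0 Hf; have g0 := rkhs_ip_ge0 Hg.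
have [ff0|ffN0] := eqVneq (ip f f) 0.
  have -> := rkhs_ip_eq0 Hf ff0.
  by rewrite !rkhs_ip0l// ?expr0n ?mul0r//; exact: rkhs0.
have ffp : 0 < ip f f by rewrite lt_neqAle eq_sym ffN0.
have := rkhs_ip_ge0 (rkhs_lin (- ip f g / ip f f) Hf Hg).
rewrite rkhs_ip_lin_sq//.
have -> : (- ip f g / ip f f) ^+ 2 * ip f f + 2 * (- ip f g / ip f f) * ip f g
   + ip g g = (ip f f * ip g g - ip f g ^+ 2) / ip f f by field.
by rewrite pmulr_lge0 ?invr_gt0// subr_ge0.
Qed.

Lemma rkhs_triangle_sq f g h : H f -> H g -> H h ->
  ip (fun x => f x - h x) (fun x => f x - h x) <=
  2 * ip (fun x => f x - g x) (fun x => f x - g x) +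
  2 * ip (fun x => g x - h x) (fun x => g x - h x).
Proof.
move=> Hf Hg Hh.
(* The difference of the two sides is |f - 2 g + h|^2. *)
have := rkhs_ip_ge0 (rkhs_lin (-2) Hg (rkhsD Hf Hh)).
rewrite !rkhs_ip_sub_sq// rkhs_ip_lin_sq//; last exact: rkhsD.
have Hfh := rkhsD Hf Hh.
rewrite (rkhs_ipC Hg Hfh) rkhs_ipDl// (rkhs_ipDl Hf Hh Hfh).
rewrite (rkhs_ipC Hf Hfh) (rkhs_ipC Hh Hfh) !rkhs_ipDl//.
rewrite (rkhs_ipC Hh Hg) (rkhs_ipC Hh Hf); lra.
Qed.

Lemma rkhs_eval_sq f y : H f -> f y ^+ 2 <= ip f f * L y y.
Proof.
move=> Hf; have Hy := rkhs_section H y.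
rewrite -(rkhs_reproducing y Hf) -[X in _ * X](rkhs_reproducing y Hy).
exact: rkhs_cauchy_schwarz.
Qed.

Definition rkhs_cvg (f_ : nat -> Y -> R) f :=
  forall e : R, 0 < e -> exists N, forall n, (N <= n)%N ->
    ip (fun x => f_ n x - f x) (fun x => f_ n x - f x) < e.

Lemma le0_of_sqr_lt (x B : R) : (forall e : R, 0 < e -> x ^+ 2 <= B * e) -> x = 0.
Proof.
move=> xB; apply/eqP; rewrite -sqrf_eq0 eq_le sqr_ge0 andbT.
rewrite leNgt; apply/negP => x0.
have B0 : 0 < B by have := xB _ ltr01; rewrite mulr1; exact: lt_le_trans.
have /xB : 0 < x ^+ 2 / (2 * B) by rewrite divr_gt0// mulr_gt0.
have -> : B * (x ^+ 2 / (2 * B)) = x ^+ 2 / 2 by field; rewrite gt_eqF.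
by move: x0; set y := x ^+ 2; lra.
Qed.

(* Minimising |f|^2 - 2 l f over G: minimising sequences are Cauchy by the
   parallelogram identity. *)
Lemma rkhs_riesz (G : (Y -> R) -> Prop) (l : (Y -> R) -> R) (B : R) :
  0 <= B ->
  (forall f, G f -> H f) -> G (fun=> 0) ->
  (forall c f g, G f -> G g -> G (fun x => c * f x + g x)) ->
  (forall (f_ : nat -> Y -> R) f, (forall n, G (f_ n)) -> H f ->
     rkhs_cvg f_ f -> G f) ->
  (forall c f g, G f -> G g -> l (fun x => c * f x + g x) = c * l f + l g) ->
  (forall f, G f -> l f ^+ 2 <= B * ip f f) ->
  exists2 g, G g & forall f, G f -> ip g f = l f.
Proof.
move=> B0 GH G0 Glin Gcl llin lB.
pose J f := ip f f - 2 * l f.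
have Jlb f : G f -> - B <= J f.
  move=> Gf; have := lB _ Gf; rewrite /J; have := rkhs_ip_ge0 (GH _ Gf).
  set a := ip f f; set b := l f => a0 b2.
  suff : b <= (a + B) / 2 by lra.
  rewrite (le_trans (ler_norm _))// -ler_sqr ?nnegrE//; last by lra.
  rewrite real_normK ?num_real//.
  have := sqr_ge0 (a - B); nra.
pose V := [set J f | f in [set f | G f]].
have infV : has_inf V.
  split; first by exists (J (fun=> 0)), (fun=> 0).
  by exists (- B) => _ [f Gf <-]; exact: Jlb.
pose d := inf V.
have Jd f : G f -> d <= J f.
  by move=> Gf; apply: (ge_inf infV.2); exists f.
have [f_ f_P] : {f_ : nat -> Y -> R & forall n, G (f_ n) /\ J (f_ n) < d + n.+1%:R^-1}.
  apply: (@choice _ _ (fun n f => G f /\ J f < d + n.+1%:R^-1)) => n.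
  have n0 : 0 < n.+1%:R^-1 :> R by rewrite invr_gt0.
  have [_ [f Gf <-] fd] := inf_adherent n0 infV.
  by exists f.
have Gf_ n := (f_P n).1; have Hf_ n := GH _ (Gf_ n).
have Jlin c f g : G f -> G g -> J (fun x => c * f x + g x) =
    c ^+ 2 * ip f f + 2 * c * (ip f g - l f) + J g.
  move=> Gf Gg; rewrite /J rkhs_ip_lin_sq ?llin//; [ring|exact: GH|exact: GH].
(* Moving [f_ n] along h by the optimal coefficient lowers J by (ip h (f_ n) - l h)^2 / ip h h, and
   this cannot exceed the gap 1/(n+1) to the infimum. *)
have quad n h : G h -> (ip (f_ n) h - l h) ^+ 2 <= ip h h * n.+1%:R^-1.
  move=> Gh; have Hh := GH _ Gh; have [_ Jn] := f_P n.
  have h0 := rkhs_ip_ge0 Hh.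
  have [hh0|hhN0] := eqVneq (ip h h) 0.
    have h_0 := rkhs_ip_eq0 Hh hh0.
    have : l h ^+ 2 <= 0 by have := lB _ Gh; rewrite hh0 mulr0.
    rewrite hh0 mul0r h_0 (rkhs_ipC (Hf_ n) (rkhs0 H)) rkhs_ip0l// sub0r sqrrN.
    by rewrite -h_0.
  have hp : 0 < ip h h by rewrite lt_neqAle eq_sym hhN0.
  have := Jd _ (Glin (- (ip h (f_ n) - l h) / ip h h) _ _ Gh (Gf_ n)).
  rewrite Jlin// (rkhs_ipC (Hf_ n) Hh).
  set x := ip h (f_ n) - l h => dle.
  have : x ^+ 2 / ip h h <= n.+1%:R^-1.
    have -> : x ^+ 2 / ip h h = - ((- x / ip h h) ^+ 2 * ip h h + 2 * (- x / ip h h) * x).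
      by field.
    by move: dle Jn; set z := n.+1%:R^-1; set w := _ * ip h h; lra.
  by rewrite ler_pdivrMr// mulrC.
have pos_n (e : R) : 0 < e -> exists N, forall n, (N <= n)%N -> n.+1%:R^-1 < e.
  move=> e0; have /= [N _ NP] := near_infty_natSinv_lt (PosNum e0).
  by exists N => n Nn; exact: NP.
have [|g Hg gcvg] := @rkhs_complete _ _ _ H f_ Hf_.
  move=> e e0; have [|N NP] := pos_n (e / 4); first by rewrite divr_gt0.
  exists N => m n Nm Nn.
  (* The midpoint of [f_ m] and [f_ n], written so as to fit closure under c f + g. *)
  have := Jd _ (Glin (1/2) _ _ (Gf_ m) (Glin (- (1 / 2)) _ _ (Gf_ n) (Gf_ n))).
  have -> : (fun x => 1 / 2 * f_ m x + (- (1 / 2) * f_ n x + f_ n x)) =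
            (fun x => 1 / 2 * f_ m x + 1 / 2 * f_ n x).
    by apply/funext => x; lra.
  have e2 : (fun x => 1 / 2 * f_ m x + 1 / 2 * f_ n x) =
            (fun x => 1 / 2 * (1 * f_ m x + f_ n x) + 0).
    by apply/funext => x; lra.
  have Gs := Glin 1 _ _ (Gf_ m) (Gf_ n).
  rewrite e2 Jlin// rkhs_ip_lin_sq//.
  rewrite (rkhs_ipC (GH _ Gs) (rkhs0 H)) rkhs_ip0l; last exact: GH.
  rewrite llin// /J rkhs_ip0l; last exact: rkhs0.
  have l0 : l (fun=> 0) = 0.
    have := llin 1 _ _ G0 G0; under eq_fun do rewrite mulr0 addr0.
    by rewrite mul1r; lra.
  rewrite l0.
  have -> : (f_ m \- f_ n) = (fun x => f_ m x - f_ n x) by [].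
  rewrite rkhs_ip_sub_sq//.
  have := (f_P m).2; have := (f_P n).2; rewrite /J.
  have := NP _ Nm; have := NP _ Nn.
  by set u := n.+1%:R^-1; set v := m.+1%:R^-1; lra.
have cvg : rkhs_cvg f_ g.
  move=> e e0; move/cvgrPdist_lt : gcvg => /(_ _ e0)[N _ NP].
  exists N => n Nn; have := NP n Nn; rewrite /= sub0r normrN ger0_norm//.
  by apply: rkhs_ip_ge0; exact: rkhsB.
exists g; first exact: Gcl cvg.
move=> h Gh; have Hh := GH _ Gh.
apply/eqP; rewrite -subr_eq0; apply/eqP.
(* The 4 comes from (x + y)^2 <= 2 x^2 + 2 y^2: the distances of ip (f_ n) h to l h and to ip g h
   both have squares at most ip h h * e. *)
apply: (@le0_of_sqr_lt _ (4 * ip h h)) => e e0.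
have [N1 P1] := pos_n _ e0; have [N2 P2] := cvg _ e0.
pose n := maxn N1 N2.
have a1 := quad n h Gh.
have := rkhs_cauchy_schwarz (rkhsB (Hf_ n) Hg) Hh.
rewrite rkhs_ipBl//.
have := P1 n (leq_maxl _ _); have := P2 n (leq_maxr _ _).
move: a1; set u := ip (f_ n) h; set v := ip g h; set w := ip h h.
set z := n.+1%:R^-1; set t := ip _ _ => a1 te ze a2.
have w0 : 0 <= w by exact: rkhs_ip_ge0.
have : w * z <= w * e by rewrite ler_wpM2l// ltW.
have : t * w <= e * w by rewrite ler_wpM2r// ltW.
have := sqr_ge0 ((v - u) - (u - l h)); lra.
Qed.

Definition combo (s : seq (R * Y)) (x : Y) : R := \sum_(p <- s) p.1 * L x p.2.

Lemma rkhs_combo s : H (combo s).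
Proof.
apply: (rkhs_sum _ (F := fun p x => p.1 * L x p.2)) => i.
by apply: rkhsZ; exact: rkhs_section.
Qed.

Lemma rkhs_ip_combol s h : H h -> ip (combo s) h = \sum_(p <- s) p.1 * h p.2.
Proof.
move=> Hh; have HL (p : R * Y) : H (fun x => p.1 * L x p.2).
  by apply: rkhsZ; exact: rkhs_section.
rewrite (rkhs_ip_suml _ HL)//; apply: eq_bigr => i _.
rewrite rkhs_ipZl//; last exact: rkhs_section.
by rewrite (rkhs_ipC (rkhs_section H _) Hh) rkhs_reproducing.
Qed.

Lemma rkhs_ip_combo s : ip (combo s) (combo s) =
  \sum_(p <- s) \sum_(q <- s) p.1 * q.1 * L p.2 q.2.
Proof.
rewrite rkhs_ip_combol//; last exact: rkhs_combo.
by apply: eq_bigr => i _; rewrite mulr_sumr; apply: eq_bigr => j _; rewrite mulrA.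
Qed.

Definition closed_span (Z : set Y) (f : Y -> R) := H f /\
  forall e : R, 0 < e -> exists2 s : seq (R * Y), all (fun p => `[< Z p.2 >]) s &
    ip (fun x => f x - combo s x) (fun x => f x - combo s x) < e.

Lemma closed_span_lin Z c f g : closed_span Z f -> closed_span Z g ->
  closed_span Z (fun x => c * f x + g x).
Proof.
move=> [Hf cf] [Hg cg]; split; first exact: rkhs_lin.
move=> e e0.
(* The + 1 keeps the denominator positive for c = 0. *)
have [|s1 Z1 d1] := cf (e / (4 * (c ^+ 2 + 1))).
  by rewrite divr_gt0// mulr_gt0// ltr_wpDl// sqr_ge0.
have [|s2 Z2 d2] := cg (e / 4); first by rewrite divr_gt0.
exists ([seq (c * p.1, p.2) | p <- s1] ++ s2).
  by rewrite all_cat all_map; apply/andP; split.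
have -> : (fun x => c * f x + g x -
      combo ([seq (c * p.1, p.2) | p <- s1] ++ s2) x) =
   (fun x => c * (f x - combo s1 x) - (combo s2 x - g x)).
  apply/funext => x; rewrite /combo big_cat big_map/=.
  have -> : \sum_(j <- s1) c * j.1 * L x j.2 = c * \sum_(j <- s1) j.1 * L x j.2.
    by rewrite mulr_sumr; apply: eq_bigr => j _; rewrite mulrA.
  ring.
have H1 := rkhsB Hf (rkhs_combo s1); have H2 := rkhsB Hg (rkhs_combo s2).
have H1c := rkhsZ c H1.
apply: le_lt_trans (rkhs_triangle_sq H1c (rkhs0 H) (rkhsB (rkhs_combo s2) Hg)) _.
have -> : (fun x => c * (f x - combo s1 x) - 0) =
          (fun x => c * (f x - combo s1 x)) by apply/funext => x; rewrite subr0.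
have -> : (fun x => 0 - (combo s2 x - g x)) = (fun x => g x - combo s2 x).
  by apply/funext => x; ring.
rewrite rkhs_ipZl// (rkhs_ipC H1 H1c) rkhs_ipZl//.
move: d1 d2; set u := ip _ _; set v := ip _ _ => d1 d2.
have u0 : 0 <= u by exact: rkhs_ip_ge0.
have : (c ^+ 2 + 1) * u < e / 4.
  move: d1; rewrite ltr_pdivlMr; last by rewrite mulr_gt0// ltr_wpDl// sqr_ge0.
  by lra.
by rewrite expr2; lra.
Qed.

Lemma closed_span_closed Z (f_ : nat -> Y -> R) f :
  (forall n, closed_span Z (f_ n)) -> H f -> rkhs_cvg f_ f -> closed_span Z f.
Proof.
move=> cf Hf ff; split=> // e e0.
have [|N NP] := ff (e / 4); first by rewrite divr_gt0.
have [HN] := cf N; case/(_ (e / 4)); first by rewrite divr_gt0.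
move=> s Zs ds; exists s => //.
apply: le_lt_trans (rkhs_triangle_sq Hf HN (rkhs_combo s)) _.
have := NP N (leqnn N); move: ds.
rewrite !rkhs_ip_sub_sq//; last exact: rkhs_combo.
by rewrite (rkhs_ipC HN Hf); lra.
Qed.

Lemma closed_span0 Z : closed_span Z (fun=> 0).
Proof.
split=> [|e e0]; first exact: rkhs0.
exists [::] => //; have -> : (fun x => 0 - combo [::] x) = (fun=> 0).
  by apply/funext => x; rewrite /combo big_nil subr0.
by rewrite rkhs_ip0l//; exact: rkhs0.
Qed.

Lemma closed_span_section Z z : Z z -> closed_span Z (fun x => L x z).
Proof.
move=> Zz; split=> [|e e0]; first exact: rkhs_section.
exists [:: (1, z)]; first by rewrite /= andbT; apply/asboolP.
have -> : (fun x => L x z - combo [:: (1, z)] x) = (fun=> 0).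
  by apply/funext => x; rewrite /combo big_seq1 mul1r subrr.
by rewrite rkhs_ip0l//; exact: rkhs0.
Qed.

(** Riesz on the closed span, applied to the functional ip h: testing the representer with the
    section at z gives interpolation at z, and testing it with itself gives the identity that makes
    h - g orthogonal to g. *)
Lemma rkhs_projection Z h : H h -> exists2 g, closed_span Z g &
  (forall z, Z z -> g z = h z) /\ ip g g = ip h g.
Proof.
move=> Hh; have [|f []|||||f []|g Gg gP] :=
  @rkhs_riesz (closed_span Z) (fun f => ip h f) (ip h h).
- exact: rkhs_ip_ge0.
- by [].
- exact: closed_span0.
- exact: closed_span_lin.
- exact: closed_span_closed.
- move=> c f g [Hf _] [Hg _]; rewrite !(rkhs_ipC Hh)//; last exact: rkhs_lin.
  exact: rkhs_ipl.
- by move=> Hf _; exact: rkhs_cauchy_schwarz.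
exists g => //; split=> [z Zz|]; last exact: gP.
rewrite -(rkhs_reproducing z Gg.1) -(rkhs_reproducing z Hh).
by apply: gP; exact: closed_span_section.
Qed.

(** The projection on the closed span of all sections agrees with h at every point. *)
Lemma rkhs_dense h : H h -> closed_span setT h.
Proof.
move=> Hh; have [g Gg [gh _]] := rkhs_projection setT Hh.
by have -> : h = g by apply/funext => z; rewrite gh.
Qed.

End rkhs_theory.

Local Open Scope ereal_scope.

(** * Product measures *)

Section product.
Context (I : choiceType) d (T : measurableType d) (R : realType).
Variable P : probability T R.

Lemma measurable_coord (i : I) :
  measurable_fun setT (fun x : power I T => x i).
Proof.
move=> _ A mA; apply: sub_sigma_algebra.
by exists i => //; exists A => //; rewrite setTI.
Qed.

Lemma measurable_power d' (S : measurableType d') (h : S -> power I T) :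
  (forall i, measurable_fun setT (fun s => h s i)) -> measurable_fun setT h.
Proof.
move=> mh; apply: (@measurability _ _ S (power I T) setT h (@cylinders I d T)) => //.
move=> _ [_ [i _ [A mA <-]] <-].
by have := mh i measurableT A mA; rewrite !setTI.
Qed.

Definition box (J : {fset I}) (A : I -> set T) : set (power I T) :=
  [set x | forall i, i \in J -> A i (x i)].

Lemma measurable_box J A : (forall i, measurable (A i)) ->
  measurable (box J A).
Proof.
move=> mA.
have -> : box J A = \bigcap_(i in [set` J]) ((fun x : power I T => x i) @^-1` A i).
  by apply/seteqP; split => x /= Jx i /=; exact: Jx.
apply: fin_bigcap_measurable; first exact: finite_fset.
move=> i _; rewrite -[X in measurable X]setTI.
exact: measurable_coord.
Qed.

Let boxes : set (set (power I T)) :=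
  [set E | exists J A, (forall i, measurable (A i)) /\ E = box J A].

(** Boxes over finite index sets form an intersection-stable generator of the product
    sigma-algebra. *)
Lemma power_measure_unique (m1 m2 : probability (power I T) R) :
  (forall J A, (forall i, measurable (A i)) -> m1 (box J A) = m2 (box J A)) ->
  forall E, measurable E -> m1 E = m2 E.
Proof.
move=> m12; apply: (measure_unique boxes (fun=> setT)).
- apply/seteqP; split.
    apply: smallest_sub; first exact: smallest_sigma_algebra.
    move=> _ [i _ [A mA <-]]; apply: sub_sigma_algebra.
    exists [fset i]%fset, (fun=> A); split => //.
    rewrite setTI; apply/seteqP; split => x /=.
      by move=> Ax j; rewrite inE => /eqP ->.
    by apply; rewrite inE.
  apply: smallest_sub; first exact: sigma_algebra_measurable.
  by move=> _ [J [A [mA ->]]]; exact: measurable_box.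
- move=> _ _ [J [A [mA ->]]] [K [B [mB ->]]].
  (* Filling up with [setT] brings both boxes to the common index set before they are
     intersected. *)
  exists (J `|` K)%fset,
    (fun i => (if i \in J then A i else setT) `&` (if i \in K then B i else setT)).
  split=> [i|]; first by apply: measurableI; case: ifP.
  apply/seteqP; split => x /=.
    by move=> [Ax Bx] i _; split; case: ifP => // iJ; [exact: Ax|exact: Bx].
  by move=> ABx; split => i iJ; have := ABx i; rewrite inE iJ ?orbT => /(_ isT)[].
- move=> _; exists fset0, (fun=> setT); split => //.
  by apply/seteqP; split.
- by rewrite bigcup_const//; exists 0%N.
- by move=> _ [J [A [mA ->]]]; exact: m12.
- by move=> _; rewrite -ge0_fin_numE// fin_num_measure.
Qed.

Definition update (i0 : I) (z : T * power I T) : power I T :=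
  fun i => if i == i0 then z.1 else z.2 i.

Lemma measurable_update i0 : measurable_fun setT (update i0).
Proof.
apply: measurable_power => i; rewrite /update.
have [_|_] := eqVneq i i0; first exact: measurable_fst.
exact: (measurableT_comp (measurable_coord i) measurable_snd).
Qed.

HB.instance Definition _ i0 := isMeasurableFun.Build _ _ _ _ (update i0)
  (measurable_update i0).

Variable PI : probability (power I T) R.
Hypothesis PI_product : is_product P PI.

(** Resampling one coordinate leaves the product law unchanged. This serves as the Fubini theorem
    here: a coordinate is integrated out while the space stays the same, so that [power I T] never
    has to be split into factors. *)
Lemma update_law i0 E : measurable E ->
  pushforward (P \x PI) (update i0) E = PI E.
Proof.
apply: (power_measure_unique (m1 := distribution (P \x PI) (update i0))).
move=> J A mA; rewrite /distribution /pushforward.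
(* Being trivial outside J, [A'] allows i0 to be added to the index set without changing the box. *)
pose A' i := if i \in J then A i else setT.
have mA' i : measurable (A' i) by rewrite /A'; case: ifP.
have -> : box J A = box (i0 |` J)%fset A'.
  apply/seteqP; split => x /= xA i.
    by rewrite /A' => _; case: ifPn => //; exact: xA.
  by move=> iJ; have := xA i; rewrite inE iJ orbT /A' iJ; exact.
rewrite /=; have -> : update i0 @^-1` box (i0 |` J)%fset A' =
    A' i0 `*` box ((i0 |` J) `\ i0)%fset A'.
  apply/seteqP; split => -[t x]; rewrite /update /=.
    move=> xA; split; first by have := xA i0; rewrite eqxx; apply; rewrite !inE eqxx.
    move=> i; rewrite inE => /andP[]; rewrite inE => ii0 iJ.
    by have := xA i iJ; rewrite (negbTE ii0).
  move=> [At Ax] i iJ; have [->//|ii0] := eqVneq i i0.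
  by apply: Ax; rewrite inE inE ii0.
rewrite product_measure1E//; last exact: measurable_box.
transitivity (\prod_(i <- (i0 |` J)%fset) P (A' i)); last exact/esym/PI_product.
rewrite (big_fsetD1 i0) ?fset1U1//=; congr (_ * _); exact: PI_product.
Qed.

Lemma ge0_integral_update i0 (F : power I T -> \bar R) :
  measurable_fun setT F -> (forall x, 0 <= F x) ->
  \int[PI]_x F x = \int[PI]_x \int[P]_t F (update i0 (t, x)).
Proof.
move=> mF F0.
transitivity (\int[pushforward (P \x PI) (update i0)]_x F x).
  by apply: eq_measure_integral => A mA _; exact/esym/update_law.
rewrite ge0_integral_pushforward//.
rewrite preimage_setT fubini_tonelli2//.
- exact: measurableT_comp (measurable_update i0).
- by move=> z; exact: F0.
Qed.

Lemma integral_update i0 (F : power I T -> \bar R) :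
  PI.-integrable setT F ->
  \int[PI]_x F x = \int[PI]_x \int[P]_t F (update i0 (t, x)).
Proof.
move=> iF; have mF := measurable_int _ iF.
have iFu : (P \x PI).-integrable setT (F \o update i0).
  apply/integrableP; split; first exact: measurableT_comp (measurable_update i0).
  have /integrableP[_] := iF; apply: le_lt_trans.
  rewrite (ge0_integral_update i0)//; last exact: measurableT_comp.
  rewrite fubini_tonelli2//.
  by apply: measurableT_comp => //; exact: measurableT_comp (measurable_update i0).
transitivity (\int[pushforward (P \x PI) (update i0)]_x F x).
  by apply: eq_measure_integral => A mA _; exact/esym/update_law.
rewrite integral_pushforward//.
by rewrite preimage_setT -integral21_prod_meas1.
Qed.

Lemma measurable_prod_coord (K : eqType) (phi : K -> I) (g : K -> T -> R)
    (s : seq K) :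
  (forall j, measurable_fun setT (g j)) ->
  measurable_fun setT (fun x : power I T => (\prod_(j <- s) g j (x (phi j)))%R).
Proof.
move=> mg; apply: measurable_prod => j _.
exact: measurableT_comp (measurable_coord _).
Qed.

(** Coordinates are integrated out one at a time; injectivity of [phi] keeps the remaining factors
    untouched by the resampling. *)
Lemma ge0_integral_prod_coord (K : eqType) (phi : K -> I) (g : K -> T -> R)
    (m : K -> R) (s : seq K) : injective phi -> uniq s ->
  (forall j, measurable_fun setT (g j)) -> (forall j t, 0 <= g j t)%R ->
  (forall j, \int[P]_t (g j t)%:E = (m j)%:E) ->
  \int[PI]_x (\prod_(j <- s) g j (x (phi j)))%:E = (\prod_(j <- s) m j)%:E.
Proof.
move=> phi_inj us mg g0 gm; elim: s us => [_|j s ih /= /andP[js us]].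
  under eq_integral do rewrite big_nil.
  by rewrite integral_cst// big_nil mul1e; exact: probability_setT.
rewrite (ge0_integral_update (phi j)); last 2 first.
- by apply/measurable_EFinP; exact: measurable_prod_coord.
- by move=> x; rewrite lee_fin; apply: prodr_ge0.
have E x : \int[P]_t (\prod_(i <- j :: s) g i (update (phi j) (t, x) (phi i)))%:E
    = (m j)%:E * (\prod_(i <- s) g i (x (phi i)))%:E.
  rewrite -gm -ge0_integralZr//; last 3 first.
  - exact/measurable_EFinP.
  - by move=> t _; rewrite lee_fin.
  - by rewrite lee_fin prodr_ge0.
  apply: eq_integral => t _; rewrite big_cons {1}/update eqxx EFinM.
  congr (_ * (_)%:E); apply: eq_big_seq => i si; rewrite /update (inj_eq phi_inj).
  by have /negPf -> : i != j by apply: contraNneq js => <-.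
under eq_integral do rewrite E.
rewrite ge0_integralZl//; last 3 first.
- by apply/measurable_EFinP; exact: measurable_prod_coord.
- by move=> x _; rewrite lee_fin prodr_ge0.
- by rewrite -gm integral_ge0// => t _; rewrite lee_fin.
by rewrite (ih us) big_cons EFinM.
Qed.

Lemma integral_update0 i0 (F : power I T -> \bar R) :
  PI.-integrable setT F -> (forall x, \int[P]_t F (update i0 (t, x)) = 0) ->
  \int[PI]_x F x = 0.
Proof.
move=> iF F0; rewrite (integral_update i0 iF).
by under eq_integral do rewrite F0; rewrite integral0.
Qed.

End product.

(** * Absolutely summable families *)

Section summation.
Context (R : realType).
Local Notation U := {fset nat}.
Implicit Types (f g : U -> R).

Lemma fset_nat_enum_ex : exists e : nat -> U, set_bij [set: nat] [set: U] e.
Proof.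
have inf : infinite_set [set: U].
  apply/infiniteP/pcard_leTP/injPex; exists (fun n => [fset n]%fset) => // m n _ _.
  by move/fset1_inj.
have : ([set: nat] #= [set: U])%card.
  by rewrite card_eq_sym; apply: eq_card_nat => //; exact: countableP.
by move=> /pcard_eqP/bijPex[e eb]; exists e.
Qed.

Definition fset_nat_enum : nat -> U := sval (cid fset_nat_enum_ex).

Lemma fset_nat_enum_bij : set_bij [set: nat] [set: U] fset_nat_enum.
Proof. exact: svalP (cid fset_nat_enum_ex). Qed.

(** Partial sums along a fixed enumeration of the finite sets. [abs_sum] is their limit for
    absolutely summable families, so linearity and monotonicity follow from limits instead of a case
    analysis on positive and negative parts. *)
Definition psum f : nat -> R := series (f \o fset_nat_enum).

Definition abs_summable f := \esum_(u in [set: U]) `|f u|%:E < +oo.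

Lemma fsum_le_esum f (s : {fset U}) : (forall u, 0 <= f u)%R ->
  (\sum_(u <- s) f u)%:E <= \esum_(u in [set: U]) (f u)%:E.
Proof.
move=> f0; apply: esum_ge; exists [set` s]; first by split => //; exact: finite_fset.
by rewrite -fsbig_seq// sumEFin.
Qed.

Lemma esum_le_fsum f (B : R) :
  (forall s : {fset U}, \sum_(u <- s) f u <= B)%R ->
  \esum_(u in [set: U]) (f u)%:E <= B%:E.
Proof.
move=> fB; apply: ge_ereal_sup => _ [A [finA _] <-].
by rewrite fsbig_finite// sumEFin lee_fin.
Qed.

Lemma abs_summableP f : abs_summable f <->
  exists B : R, forall s : {fset U}, (\sum_(u <- s) `|f u| <= B)%R.
Proof.
split=> [sf|[B fB]]; last by apply: le_lt_trans (esum_le_fsum fB) _; rewrite ltry.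
exists (fine (\esum_(u in [set: U]) `|f u|%:E)) => s.
rewrite -lee_fin fineK; first exact: (fsum_le_esum s (fun u => normr_ge0 (f u))).
by rewrite ge0_fin_numE// esum_ge0.
Qed.

Lemma abs_summable_ge0 f : (forall u, 0 <= f u)%R ->
  \esum_(u in [set: U]) (f u)%:E < +oo -> abs_summable f.
Proof.
move=> f0; rewrite /abs_summable.
by under [X in _ -> X < _]eq_esum do rewrite ger0_norm//.
Qed.

Lemma abs_summable_lty f : (forall u, 0 <= f u)%R -> abs_summable f ->
  \esum_(u in [set: U]) (f u)%:E < +oo.
Proof.
by move=> f0; rewrite /abs_summable; under eq_esum do rewrite ger0_norm//.
Qed.

Lemma psum_esum f : (forall u, 0 <= f u)%R ->
  \esum_(u in [set: U]) (f u)%:E < +oo ->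
  psum f @ \oo --> fine (\esum_(u in [set: U]) (f u)%:E).
Proof.
move=> f0 foo.
have E : \esum_(u in [set: U]) (f u)%:E =
    \esum_(i in [set: nat]) (f (fset_nat_enum i))%:E.
  exact: (@reindex_esum _ _ _ _ _ _ (fun u => (f u)%:E) fset_nat_enum_bij).
have s : summable (predT : pred nat) (fun i => (f (fset_nat_enum i))%:E).
  rewrite /summable (_ : (fun x => _) = [set: nat]); last by apply/seteqP; split.
  under eq_esum do rewrite gee0_abs ?lee_fin//.
  by rewrite -E.
have c := summable_cvg (fun i _ => f0 _ : 0 <= (f (fset_nat_enum i))%:E) s.
rewrite E -nneseries_esumT; last by move=> i; rewrite lee_fin.
by rewrite (summable_nneseries_lim (fun i _ => f0 _ : 0 <= (f (fset_nat_enum i))%:E) s).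
Qed.

Lemma psum_abs_sum f : abs_summable f -> psum f @ \oo --> abs_sum f.
Proof.
move=> sf.
have sp : \esum_(u in [set: U]) (f^\+ u)%:E < +oo.
  apply: le_lt_trans sf; apply: le_esum => u _.
  by rewrite lee_fin /funrpos ge_max ler_norm normr_ge0.
have sn : \esum_(u in [set: U]) (f^\- u)%:E < +oo.
  apply: le_lt_trans sf; apply: le_esum => u _.
  by rewrite lee_fin /funrneg ge_max normr_ge0 andbT -normrN ler_norm.
rewrite /abs_sum funerpos funerneg /comp  fineB; last 2 first.
- by rewrite ge0_fin_numE// esum_ge0// => u _; rewrite lee_fin funrpos_ge0.
- by rewrite ge0_fin_numE// esum_ge0// => u _; rewrite lee_fin funrneg_ge0.
have -> : psum f = (psum f^\+ \- psum f^\-)%R.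
  apply/funext => n; rewrite /psum /series /= -sumrB; apply: eq_bigr => i _.
  by rewrite /= -[f in LHS]funrposBneg.
by apply: cvgB; apply: psum_esum.
Qed.

Lemma abs_sum_unique f r : abs_summable f -> psum f @ \oo --> r -> abs_sum f = r.
Proof. by move=> /psum_abs_sum fs fr; exact: (cvg_unique _ fs fr). Qed.

Lemma abs_summable_le f g : (forall u, `|f u| <= g u)%R ->
  \esum_(u in [set: U]) (g u)%:E < +oo -> abs_summable f.
Proof. by move=> fg; apply: le_lt_trans; apply: le_esum => u _; rewrite lee_fin. Qed.

Lemma abs_summable_lin (c : R) f g : abs_summable f -> abs_summable g ->
  abs_summable (fun u => c * f u + g u)%R.
Proof.
move=> /abs_summableP[A fA] /abs_summableP[B gB].
apply/abs_summableP; exists (`|c| * A + B)%R => s.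
apply: (@le_trans _ _ (\sum_(u <- s) (`|c| * `|f u| + `|g u|))%R).
  by apply: ler_sum => u _; rewrite -normrM ler_normD.
by rewrite big_split -mulr_sumr lerD// ler_wpM2l.
Qed.

Lemma abs_sum_lin (c : R) f g : abs_summable f -> abs_summable g ->
  (abs_sum (fun u => c * f u + g u) = c * abs_sum f + abs_sum g)%R.
Proof.
move=> sf sg; apply: abs_sum_unique; first exact: abs_summable_lin.
have -> : psum (fun u => c * f u + g u)%R = (fun n => c * psum f n + psum g n)%R.
  apply/funext => n; rewrite /psum /series /= mulr_sumr -big_split.
  exact: eq_bigr.
by apply: cvgD; [apply: cvgMr|]; exact: psum_abs_sum.
Qed.

Lemma abs_sum0 : abs_sum (fun=> 0 : R)%R = 0%R /\ abs_summable (fun=> 0 : R)%R.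
Proof.
have s0 : abs_summable (fun=> 0 : R)%R.
  by rewrite /abs_summable esum1// => u _; rewrite normr0.
split=> //; apply: abs_sum_unique => //.
rewrite (_ : psum _ = cst 0%R); first exact: cvg_cst.
by apply/funext => n; rewrite /psum /series /= big1.
Qed.

Lemma abs_sum_sum (I : Type) (s : seq I) (c : I -> R) (F : I -> U -> R) :
  (forall i, abs_summable (F i)) ->
  abs_summable (fun u => \sum_(i <- s) c i * F i u)%R /\
  (abs_sum (fun u => \sum_(i <- s) c i * F i u) = \sum_(i <- s) c i * abs_sum (F i))%R.
Proof.
move=> sF; have [a0 s0] := abs_sum0; elim: s => [|i s [ih1 ih2]].
  by under eq_fun do rewrite big_nil; rewrite big_nil.
under eq_fun do rewrite big_cons.
split; first exact: abs_summable_lin.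
by rewrite abs_sum_lin// big_cons ih2.
Qed.

Lemma ler_abs_sum f g : abs_summable f -> abs_summable g ->
  (forall u, f u <= g u)%R -> (abs_sum f <= abs_sum g)%R.
Proof.
move=> /psum_abs_sum sf /psum_abs_sum sg fg; apply: ler_cvg_to sf sg _.
by apply: nearW => n; apply: ler_sum => i _; exact: fg.
Qed.

Lemma fine_esum_abs_sum f : (forall u, 0 <= f u)%R ->
  \esum_(u in [set: U]) (f u)%:E < +oo ->
  \esum_(u in [set: U]) (f u)%:E = (abs_sum f)%:E.
Proof.
move=> f0 foo; have := psum_esum f0 foo.
move=> /(abs_sum_unique (abs_summable_ge0 f0 foo)) ->.
by rewrite fineK// ge0_fin_numE// esum_ge0// => u _; rewrite lee_fin.
Qed.

Lemma fsum_le_abs_sum f (s : {fset U}) : (forall u, 0 <= f u)%R ->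
  abs_summable f -> (\sum_(u <- s) f u <= abs_sum f)%R.
Proof.
move=> f0 sf; rewrite -lee_fin -fine_esum_abs_sum//; first exact: fsum_le_esum.
exact: abs_summable_lty.
Qed.

Lemma abs_sum_fin f (s : {fset U}) : (forall u, u \notin s -> f u = 0)%R ->
  abs_summable f /\ abs_sum f = (\sum_(u <- s) f u)%R.
Proof.
move=> f0; pose dl (v u : U) : R := (u == v)%:R.
have Edl v : \esum_(u in [set: U]) (dl v u)%:E = 1.
  have dvv : 0 <= (dl v v)%:E by rewrite lee_fin ler0n.
  transitivity (\esum_(u in [set v]) (dl v u)%:E); last first.
    by rewrite (@esum_set1 _ _ v (fun u => (dl v u)%:E) dvv) /dl eqxx.
  rewrite [RHS]esum_mkcond; apply: eq_esum => u _.
  by case: ifPn => //; rewrite notin_setE /= /dl; case: eqP.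
have sdl v : abs_summable (dl v).
  by apply: abs_summable_ge0 => [u|]; rewrite ?Edl ?ltry// /dl; case: eqP.
have sumdl v : abs_sum (dl v) = 1%R.
  by have := @fine_esum_abs_sum (dl v) (fun u => ler0n _ _); rewrite Edl ltry => /(_ isT)[].
(* A finitely supported family is a combination of indicators, so linearity reduces the claim to a
   single indicator. *)
have -> : f = (fun u => \sum_(v <- s) f v * dl v u)%R.
  apply/funext => u; have [us|us] := boolP (u \in s).
    rewrite (big_fsetD1 u)//= /dl eqxx mulr1 big1_fset ?addr0// => v.
    by rewrite !inE => /andP[vu _] _; rewrite eq_sym (negbTE vu) mulr0.
  rewrite f0// big1_fset// => v vs _.
  by rewrite /dl; case: eqP us => [->|_ _]; rewrite ?vs// mulr0.
have [h1 h2] := abs_sum_sum s f sdl; split => //; rewrite h2.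
apply: eq_big_seq => v vs; rewrite sumdl mulr1 (big_fsetD1 v)//= /dl eqxx mulr1.
rewrite big1_fset ?addr0// => w; rewrite !inE => /andP[wv _] _.
by rewrite eq_sym (negbTE wv) mulr0.
Qed.

End summation.

(** * Integration on the domain of the kernel *)

Lemma kernel_cauchy_schwarz (R : realType) (Y : Type) (L : Y -> Y -> R)
  (H : rkhs L) x y : (L x y ^+ 2 <= L x x * L y y)%R.
Proof.
have := rkhs_eval_sq x (rkhs_section H y).
by rewrite (rkhs_reproducing y (rkhs_section H y)) mulrC.
Qed.

Lemma kernel_diag_ge0 (R : realType) (Y : Type) (L : Y -> Y -> R)
  (H : rkhs L) x : (0 <= L x x)%R.
Proof.
rewrite -(rkhs_reproducing x (rkhs_section H x)).
exact/rkhs_ip_ge0/rkhs_section.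
Qed.

Lemma kernel_quad_ge0 (R : realType) (Y : Type) (L : Y -> Y -> R)
  (H : rkhs L) (s : seq (R * Y)) :
  (0 <= \sum_(p <- s) \sum_(q <- s) p.1 * q.1 * L p.2 q.2)%R.
Proof. by rewrite -(rkhs_ip_combo H); exact/rkhs_ip_ge0/rkhs_combo. Qed.

(** Norm approximation is also pointwise, since |f y|^2 <= |f|^2 L y y. Both modes are needed to
    carry statements about combinations over to the whole space. *)
Lemma rkhs_approx (R : realType) (Y : Type) (L : Y -> Y -> R) (H : rkhs L)
  (f : Y -> R) : H f -> exists s : nat -> seq (R * Y),
   (forall n, (rkhs_ip H (fun x => f x - combo L (s n) x)
               (fun x => f x - combo L (s n) x) <= n.+1%:R^-1)%R) /\
   forall y, combo L (s n) y @[n --> \oo] --> f y.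
Proof.
move=> Hf; have [_ fd] := rkhs_dense Hf.
have [s sP] : {s : nat -> seq (R * Y) & forall n,
    (rkhs_ip H (fun x => f x - combo L (s n) x)
               (fun x => f x - combo L (s n) x) < n.+1%:R^-1)%R}.
  apply: (@choice _ _ (fun n s => (rkhs_ip H (fun x => f x - combo L s x)
               (fun x => f x - combo L s x) < n.+1%:R^-1)%R)) => n.
  by have [|s _ sP] := fd n.+1%:R^-1%R; [by rewrite invr_gt0|exists s].
exists s; split => [n|y]; first exact: ltW.
apply/cvgrPdist_lt => e e0.
have K0 := kernel_diag_ge0 H y.
(* The + 1 covers the case L y y = 0. *)
have e2 : (0 < e ^+ 2 / (L y y + 1))%R by rewrite divr_gt0 ?exprn_gt0// ltr_wpDl.
have /= [N _ NP] := near_infty_natSinv_lt (PosNum e2).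
exists N => // n Nn /=.
have := rkhs_eval_sq y (rkhsB Hf (rkhs_combo H (s n))).
move=> le1; rewrite -ltr_sqr ?nnegrE// ?ltW// real_normK ?num_real//.
apply: le_lt_trans le1 _.
have := lt_trans (sP n) (NP n Nn); rewrite /= ltr_pdivlMr; last by rewrite ltr_wpDl.
have := rkhs_ip_ge0 (rkhsB Hf (rkhs_combo H (s n))).
by set b := rkhs_ip _ _ _; lra.
Qed.

Lemma amgm (R : realFieldType) (x a b : R) : (0 <= a -> 0 <= b ->
  x ^+ 2 <= a * b -> `|x| <= (a + b) / 2)%R.
Proof.
move=> a0 b0 xab; rewrite -ler_sqr ?nnegrE//; last first.
  by rewrite divr_ge0// addr_ge0.
by rewrite real_normK ?num_real//; have := sqr_ge0 (a - b)%R; nra.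
Qed.

Lemma Lfun2_integrable d (T : measurableType d) (R : realType)
    (P : probability T R) (f : T -> R) : measurable_fun setT f ->
  P.-integrable setT (fun x => (f x ^+ 2)%:E) -> f \in Lfun P 2%:E.
Proof.
move=> mf /integrableP[_ foo]; rewrite inE; apply/andP; split; first by rewrite inE.
rewrite inE /= /finite_norm unlock /=.
apply: poweR_lty; apply: le_lt_trans foo; apply: ge0_le_integral => //.
- apply/measurable_EFinP.
  apply/(@measurableT_comp _ _ _ _ _ _ (fun x : R => x `^ 2)%R) => //.
  exact/measurableT_comp.
- apply: measurableT_comp => //; apply/measurable_EFinP; exact: measurable_funX.
- by move=> x _; rewrite /= lee_fin normrX powR_mulrn.
Qed.

(** * Moments of products of the kernel *)

Section kernel_integrals.
Context d (T : measurableType d) (R : realType) (rho : probability T R).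
Variable k : T -> T -> R.
Hypothesis Hk : rkhs k.
Variable Hu : forall u : {fset nat}, rkhs (kprod k u).
Hypothesis k_meas : measurable_fun setT (fun z : T * T => k z.1 z.2).
Hypothesis M_fin : \int[rho]_x (k x x)%:E < +oo.
Hypothesis k_int0 : forall y, \int[rho]_x (k x y)%:E = 0.

Definition Mk : R := fine (\int[rho]_x (k x x)%:E).

Lemma Mk_ge0 : (0 <= Mk)%R.
Proof.
by apply/fine_ge0/integral_ge0 => x _; rewrite lee_fin (kernel_diag_ge0 Hk).
Qed.

Lemma MkE : \int[rho]_x (k x x)%:E = Mk%:E.
Proof.
rewrite /Mk fineK// ge0_fin_numE//.
by apply: integral_ge0 => x _; rewrite lee_fin (kernel_diag_ge0 Hk).
Qed.

Lemma measurable_kdiag : measurable_fun setT (fun x => k x x).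
Proof.
apply: (measurableT_comp k_meas (f := fun z => k z.1 z.2) (g := fun x => (x, x))).
exact: measurable_fun_pair.
Qed.

Lemma measurable_ksection y : measurable_fun setT (fun x => k x y).
Proof. exact: measurable_fun_pair1 k_meas. Qed.

Section prod_kernel.
Context (I : choiceType) (P : probability (power I T) R).
Hypothesis P_product : is_product rho P.
Context (w : {fset nat}) (phi : w -> I).
Hypothesis phi_inj : injective phi.

(** The index set I stays arbitrary so that this covers both [restr], from sequences, and [restr2],
    from a larger finite set. *)
Definition pullback (x : power I T) : power w T := fun j => x (phi j).

Lemma measurable_pullback : measurable_fun setT pullback.
Proof. by apply: measurable_power => j; exact: measurable_coord. Qed.

Lemma measurable_kprod_diag :
  measurable_fun setT (fun x => kprod k w (pullback x) (pullback x)).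
Proof.
apply: (@measurable_prod_coord _ _ _ _ _ phi (fun _ t => k t t)) => _.
exact: measurable_kdiag.
Qed.

Lemma measurable_kprod_section y :
  measurable_fun setT (fun x => kprod k w (pullback x) y).
Proof.
apply: (@measurable_prod_coord _ _ _ _ _ phi (fun j t => k t (y j))) => j.
exact: measurable_ksection.
Qed.

Lemma integral_kprod_diag :
  \int[P]_x (kprod k w (pullback x) (pullback x))%:E = (Mk ^+ #|` w|)%:E.
Proof.
have := ge0_integral_prod_coord P_product (g := fun _ t => k t t) (m := fun=> Mk)
  phi_inj (index_enum_uniq w) (fun=> measurable_kdiag)
  (fun _ t => kernel_diag_ge0 Hk t) (fun=> MkE).
by rewrite prodr_const cardfE.
Qed.

Lemma kprod_le_diag (x y : power w T) :
  (`|kprod k w x y| <= (kprod k w x x + kprod k w y y) / 2)%R.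
Proof.
apply: amgm; [exact: (kernel_diag_ge0 (Hu w))|exact: (kernel_diag_ge0 (Hu w))|].
exact: (kernel_cauchy_schwarz (Hu w)).
Qed.

Lemma integrable_kprod_diag : P.-integrable setT
  (fun x => (kprod k w (pullback x) (pullback x))%:E).
Proof.
apply/integrableP; split; first by apply/measurable_EFinP; exact: measurable_kprod_diag.
under eq_integral do rewrite gee0_abs ?lee_fin ?(kernel_diag_ge0 (Hu w))//.
by rewrite integral_kprod_diag ltry.
Qed.

Lemma integrable_kprod_section y : P.-integrable setT
  (fun x => (kprod k w (pullback x) y)%:E).
Proof.
apply: (@le_integrable _ _ _ P _ _ _
  (fun x => ((kprod k w (pullback x) (pullback x))%:E + (kprod k w y y)%:E))) => //.
- by apply/measurable_EFinP; exact: measurable_kprod_section.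
- move=> x _; rewrite /= lee_fin; apply: le_trans (kprod_le_diag _ _) _.
  have := kernel_diag_ge0 (Hu w) y; have := kernel_diag_ge0 (Hu w) (pullback x).
  move=> h1 h2; rewrite ger0_norm ?addr_ge0//; lra.
- apply: integrableD => //; first exact: integrable_kprod_diag.
  by apply: finite_measure_integrable_cst.
Qed.

Lemma integrable_ksection (y : T) : rho.-integrable setT (fun t => (k t y)%:E).
Proof.
apply: (@le_integrable _ _ _ rho _ _ _ (fun t => ((k t t)%:E + (k y y)%:E))) => //.
- exact/measurable_EFinP/measurable_ksection.
- move=> x _; rewrite /= lee_fin.
  have h1 := kernel_diag_ge0 Hk y; have h2 := kernel_diag_ge0 Hk x.
  apply: le_trans (amgm h2 h1 (kernel_cauchy_schwarz Hk _ _)) _.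
  rewrite ger0_norm ?addr_ge0//; lra.
- apply: integrableD => //; last by apply: finite_measure_integrable_cst.
  apply/integrableP; split; first exact/measurable_EFinP/measurable_kdiag.
  by under eq_integral do rewrite gee0_abs ?lee_fin ?(kernel_diag_ge0 Hk)//.
Qed.

(** Any j in w can be integrated out first, and the mean of k(., y_j) is zero; the empty product is
    constant 1. *)
Lemma integral_kprod_section y :
  \int[P]_x (kprod k w (pullback x) y)%:E = (w == fset0)%:R%:E.
Proof.
have [w0|/fset0Pn[j jw]] := eqVneq w fset0.
  rewrite (_ : (fun x => _) = cst 1); last first.
    apply/funext => x; rewrite /kprod big1// => -[j jw] _; exfalso.
    by move: jw; rewrite {1}w0 inE.
  by rewrite integral_cst// mul1e; exact: probability_setT.
pose j0 : w := [` jw]%fset.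
apply: (integral_update0 P_product (i0 := phi j0)).
  exact: integrable_kprod_section.
move=> x; rewrite /kprod.
pose c := (\prod_(j | j != j0) k (x (phi j)) (y j))%R.
rewrite (_ : (fun t => _) = (fun t => (k t (y j0))%:E * c%:E)).
  by rewrite integralZr//; [rewrite k_int0 mul0e|exact: integrable_ksection].
apply/funext => t; rewrite (bigD1 j0)//= EFinM {1}/pullback {1}/update eqxx.
congr (_ * (_)%:E); apply: eq_bigr => i ij.
by rewrite /pullback /update (inj_eq phi_inj) (negbTE ij).
Qed.

Lemma measurable_kcombo s :
  measurable_fun setT (fun x => combo (kprod k w) s (pullback x)).
Proof.
rewrite /combo; apply: measurable_sum => p.
by apply: measurable_funM => //; exact: measurable_kprod_section.
Qed.

Lemma integral_kcombo s :
  \int[P]_x (combo (kprod k w) s (pullback x))%:E =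
  ((\sum_(p <- s) p.1) *+ (w == fset0))%:E.
Proof.
rewrite /combo; under eq_integral do rewrite -sumEFin.
rewrite integral_sum//; last first.
  move=> p; rewrite (_ : (fun x => _) =
    (fun x => p.1%:E * (kprod k w (pullback x) p.2)%:E)) ?funeqE//.
  by apply: integrableZl => //; exact: integrable_kprod_section.
rewrite -mulr_natr mulr_suml -sumEFin; apply: eq_bigr => p _.
under eq_integral do rewrite EFinM.
rewrite integralZl//; last exact: integrable_kprod_section.
by rewrite integral_kprod_section.
Qed.

(** The square is dominated by the squared norm times the diagonal of the kernel, which is
    integrable. *)
Lemma Lfun2_kcombo s :
  (fun x => combo (kprod k w) s (pullback x)) \in Lfun P 2%:E.
Proof.
apply: Lfun2_integrable; first exact: measurable_kcombo.
apply: (@le_integrable _ _ _ P _ _ _ (fun x =>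
  (rkhs_ip (Hu w) (combo (kprod k w) s) (combo (kprod k w) s))%:E *
  (kprod k w (pullback x) (pullback x))%:E)) => //.
- by apply/measurable_EFinP; apply: measurable_funX; exact: measurable_kcombo.
- move=> x _; rewrite /= lee_fin ger0_norm ?sqr_ge0//.
  by rewrite (le_trans _ (ler_norm _))//; exact/rkhs_eval_sq/rkhs_combo.
- by apply: integrableZl => //; exact: integrable_kprod_diag.
Qed.
End prod_kernel.

(** * The summed kernel and the integration functional *)

Section sum_kernel.
Context (mu : probability (power nat T) R) (mu_product : is_product rho mu).
Variable gamma : {fset nat} -> R.
Hypothesis gamma_ge0 : forall u, (0 <= gamma u)%R.
Hypothesis gamma_0 : gamma fset0 = 1%R.
Hypothesis gamma_sum : \esum_(u in [set: {fset nat}])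
  (gamma u * Mk ^+ #|` u|)%:E < +oo.

Local Notation X := (Xset k gamma).
Local Notation K := (Kker k gamma).

Definition kk (u : {fset nat}) (x y : power nat T) : R :=
  kprod k u (restr u x) (restr u y).

Lemma kk_diag_ge0 u x : (0 <= gamma u * kk u x x)%R.
Proof. by rewrite mulr_ge0//; exact: (kernel_diag_ge0 (Hu u)). Qed.

Lemma XsetP x : X x = abs_summable (fun u => gamma u * kk u x x)%R.
Proof.
rewrite /Xset /abs_summable; congr (is_true (_ < _)).
by apply: eq_esum => u _; rewrite ger0_norm// kk_diag_ge0.
Qed.

Lemma kk_le_diag u x y :
  (`|gamma u * kk u x y| <= 2^-1 * (gamma u * kk u x x) + 2^-1 * (gamma u * kk u y y))%R.
Proof.
rewrite normrM ger0_norm//.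
have -> : (2^-1 * (gamma u * kk u x x) + 2^-1 * (gamma u * kk u y y) =
   gamma u * ((kk u x x + kk u y y) / 2))%R by ring.
by rewrite ler_wpM2l//; apply: kprod_le_diag.
Qed.

Lemma abs_summable_kk x y : X x -> X y ->
  abs_summable (fun u => gamma u * kk u x y)%R.
Proof.
rewrite !XsetP => sx sy.
have s2 := abs_summable_lin 2^-1 sx (abs_summable_lin 2^-1 sy (abs_sum0 R).2).
apply: (abs_summable_le (g := fun u => 2^-1 * (gamma u * kk u x x) +
                                 (2^-1 * (gamma u * kk u y y) + 0))%R).
  by move=> u; rewrite addr0 kk_le_diag.
apply: abs_summable_lty s2 => u.
by rewrite addr0 addr_ge0// mulr_ge0// kk_diag_ge0.
Qed.

Lemma psum_Kker (x y : X) :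
  psum (fun u => gamma u * kk u (val x) (val y))%R @ \oo --> K x y.
Proof.
by apply: psum_abs_sum; apply: abs_summable_kk; exact: set_mem (valP _).
Qed.

Definition Kdiag (x : power nat T) : R := abs_sum (fun u => gamma u * kk u x x)%R.

Lemma Kdiag_ge0 x : X x -> (0 <= Kdiag x)%R.
Proof.
rewrite XsetP => sx; rewrite -[leLHS](abs_sum0 R).1.
by apply: ler_abs_sum => //; [exact: (abs_sum0 R).2|move=> u; exact: kk_diag_ge0].
Qed.

(** The diagonal sum as a series over the naturals, the form that admits measurability and termwise
    integration. *)
Let nser x := \sum_(i <oo) (gamma (fset_nat_enum i) *
   kk (fset_nat_enum i) x x)%:E.

Let esum_nser x : \esum_(u in [set: {fset nat}]) (gamma u * kk u x x)%:E = nser x.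
Proof.
rewrite (@reindex_esum _ _ _ _ _ _ (fun u => (gamma u * kk u x x)%:E)
  fset_nat_enum_bij) -nneseries_esumT//.
by move=> n; rewrite lee_fin kk_diag_ge0.
Qed.

Lemma measurable_kk_diag u : measurable_fun setT (fun x => kk u x x).
Proof. by apply: measurable_kprod_diag. Qed.

Lemma measurable_kk_section u y : measurable_fun setT (fun x => kk u x y).
Proof. by apply: measurable_kprod_section. Qed.

Let measurable_nser : measurable_fun setT nser.
Proof.
apply: ge0_emeasurable_sum => [i x _ _|i _]; first by rewrite lee_fin kk_diag_ge0.
by apply/measurable_EFinP; apply: measurable_funM => //; exact: measurable_kk_diag.
Qed.

Let nser_ge0 x : 0 <= nser x.
Proof. by apply: nneseries_ge0 => i _ _; rewrite lee_fin kk_diag_ge0. Qed.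

Let integrable_nser : mu.-integrable setT nser.
Proof.
apply/integrableP; split => //.
under eq_integral do rewrite gee0_abs//.
rewrite integral_nneseries//; last 2 first.
- move=> n; apply/measurable_EFinP; apply: measurable_funM => //.
  exact: measurable_kk_diag.
- by move=> n x _; rewrite lee_fin kk_diag_ge0.
apply: le_lt_trans gamma_sum.
rewrite (@reindex_esum _ _ _ _ _ _ (fun u => (gamma u * Mk ^+ #|` u|)%:E)
  fset_nat_enum_bij) -nneseries_esumT//; last first.
  by move=> n; rewrite lee_fin mulr_ge0// exprn_ge0// Mk_ge0.
apply: lee_nneseries => [i _ _|i _].
  by apply: integral_ge0 => x _; rewrite lee_fin kk_diag_ge0.
under eq_integral do rewrite EFinM.
rewrite ge0_integralZl//.
- by rewrite EFinM; rewrite (integral_kprod_diag mu_product)//; exact: val_inj.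
- by apply/measurable_EFinP; exact: measurable_kk_diag.
- by move=> x _; rewrite lee_fin; exact: (kernel_diag_ge0 (Hu _)).
- by rewrite lee_fin.
Qed.

Lemma measurable_Xset : measurable (X : set (power nat T)).
Proof.
have -> : X = [set x | nser x < +oo] by apply/seteqP; split => x; rewrite /Xset /= -esum_nser.
rewrite -[X in measurable X]setTI; exact: emeasurable_fun_infty_o.
Qed.

(** The diagonal sum has integral at most the sum of gamma_u M^|u|, so it is finite almost
    everywhere. *)
Lemma mu_setC_Xset : mu (~` X) = 0.
Proof.
have [N [mN N0 sub]] := integrable_ae measurableT integrable_nser.
apply/eqP; rewrite eq_le measure_ge0 andbT -N0; apply: le_measure.
- by rewrite inE; apply: measurableC; exact: measurable_Xset.
- by rewrite inE.
move=> x /= nXx; apply: sub => /= /(_ I) fx; apply: nXx.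
by rewrite /Xset /= esum_nser ltey_eq fx.
Qed.

Lemma mu_Xset : mu X = 1.
Proof.
rewrite -[X]setCK probability_setC; last first.
  by apply: measurableC; exact: measurable_Xset.
by rewrite mu_setC_Xset sube0.
Qed.

Lemma integrable_Kdiag : mu.-integrable X (EFin \o Kdiag).
Proof.
apply: (eq_integrable _ nser) => //.
- exact: measurable_Xset.
- move=> x /set_mem Xx; rewrite /= -esum_nser fine_esum_abs_sum// => u.
  exact: kk_diag_ge0.
- by apply: integrableS integrable_nser => //; exact: measurable_Xset.
Qed.

Lemma valL_val (f : X -> R) (x : X) : 'valL_ 0%R f (val x) = f x.
Proof. by have := valLK 0%R f => /(congr1 (fun g => g x)). Qed.

Lemma XsetE (x : power nat T) : X x -> exists z : X, val z = x.
Proof. by move=> Xx; exists (exist _ x (mem_set Xx)). Qed.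

Lemma KkerE (x : X) : K x x = Kdiag (val x).
Proof. by []. Qed.

Lemma measurable_Kker (y : X) : measurable_fun X ('valL_ 0%R (fun x => K x y)).
Proof.
apply: (measurable_fun_cvg (h := fun n x =>
  psum (fun u => gamma u * kk u x (val y))%R n)).
- move=> n; apply: measurable_sum => i; apply: measurable_funM => //.
  by apply: measurable_funTS; exact: measurable_kk_section.
- by move=> x Xx; have [z <-] := XsetE Xx; rewrite valL_val; exact: psum_Kker.
Qed.

Variable HK : rkhs K.

Lemma measurable_rkhs (f : X -> R) : HK f -> measurable_fun X ('valL_ 0%R f).
Proof.
move=> Hf; have [s [_ sc]] := rkhs_approx Hf.
apply: (measurable_fun_cvg (h := fun n => 'valL_ 0%R (combo K (s n)))).
  move=> n; apply: (eq_measurable_fun (fun x =>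
    \sum_(p <- s n) p.1 * 'valL_ 0 (fun x => K x p.2) x)%R).
    move=> x /set_mem Xx; have [z <-] := XsetE Xx.
    by rewrite valL_val /combo; apply: eq_bigr => p _; rewrite valL_val.
  apply: measurable_sum => p; apply: measurable_funM => //.
  exact: measurable_Kker.
move=> x Xx; have [z <-] := XsetE Xx; rewrite valL_val.
by under eq_fun do rewrite valL_val; exact: sc.
Qed.

Lemma integrable_rkhs (f : X -> R) : HK f ->
  mu.-integrable X (EFin \o 'valL_ 0%R f).
Proof.
move=> Hf; apply: (@le_integrable _ _ _ mu _ _ _
  (fun x => (rkhs_ip HK f f)%:E + (Kdiag x)%:E)) => //.
- exact: measurable_Xset.
- by apply/measurable_EFinP; exact: measurable_rkhs.
- move=> x Xx; have [z <-] := XsetE Xx; rewrite compE valL_val lee_fin.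
  have n0 := rkhs_ip_ge0 Hf; have K0 := kernel_diag_ge0 HK z.
  apply: le_trans (amgm n0 K0 (rkhs_eval_sq _ Hf)) _.
  by rewrite KkerE ger0_norm ?addr_ge0//; rewrite -KkerE; lra.
- apply: integrableD => //; [exact: measurable_Xset| |exact: integrable_Kdiag].
  by apply: finite_measure_integrable_cst; exact: measurable_Xset.
Qed.

Lemma Iop_lin c f g : HK f -> HK g ->
  (Iop k gamma mu (fun x => c * f x + g x) =
   c * Iop k gamma mu f + Iop k gamma mu g)%R.
Proof.
move=> Hf Hg; rewrite /Iop.
have mX := measurable_Xset; have i_f := integrable_rkhs Hf.
have i_g := integrable_rkhs Hg.
rewrite -RintegralZl// -RintegralD//; last by apply: integrableZl i_f.
apply: eq_Rintegral => x /set_mem Xx; have [z <-] := XsetE Xx.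
by rewrite !valL_val.
Qed.

(** With c = I(f), integrate 2 c f(x) <= c^2 + f(x)^2 <= c^2 + |f|^2 K(x,x) over a set of measure 1.
    The constant B is the integral of the diagonal. *)
Lemma Iop_bound : exists2 B : R, (0 <= B)%R &
  forall f, HK f -> (Iop k gamma mu f ^+ 2 <= B * rkhs_ip HK f f)%R.
Proof.
have mX := measurable_Xset; have iK := integrable_Kdiag.
exists (\int[mu]_(x in X) Kdiag x)%R.
  by apply: Rintegral_ge0 => x Xx; exact: Kdiag_ge0.
move=> f Hf; set c := Iop k gamma mu f; set n := rkhs_ip HK f f.
have icst r : mu.-integrable X (EFin \o (fun=> r)).
  exact: finite_measure_integrable_cst.
have inK : mu.-integrable X (EFin \o (fun x => n * Kdiag x)%R).
  exact: integrableZl iK.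
have : (\int[mu]_(x in X) (2 * c * 'valL_ 0 f x) <=
        \int[mu]_(x in X) (c ^+ 2 + n * Kdiag x))%R.
  apply: le_Rintegral => //.
  - exact: integrableZl (integrable_rkhs Hf).
  - exact: integrableD (icst _) inK.
  - move=> x Xx; have [z <-] := XsetE Xx; rewrite valL_val -KkerE.
    by have := rkhs_eval_sq z Hf; rewrite -/n; have := sqr_ge0 (c - f z)%R; lra.
rewrite RintegralZl//; last exact: integrable_rkhs.
have -> : (\int[mu]_(x in X) (c ^+ 2 + n * Kdiag x) =
           c ^+ 2 + n * \int[mu]_(x in X) Kdiag x)%R.
  rewrite (RintegralD mX (icst _) inK) RintegralZl//; congr (_ + _)%R.
  transitivity (c ^+ 2 * fine (mu X))%R; first exact: Rintegral_cst.
  by rewrite mu_Xset mulr1.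
by rewrite -/(Iop k gamma mu f) -/c; lra.
Qed.

(** Only the empty set has a section of nonzero mean, and gamma of the empty set is 1. Partial sums
    are dominated by K(x,x) + K(y,y). By the reproducing property, this value is that of the
    representer of the integral at y. *)
Lemma Iop_section (y : X) : Iop k gamma mu (fun x => K x y) = 1%R.
Proof.
have mX := measurable_Xset.
pose F n (x : power nat T) := (psum (fun u => gamma u * kk u x (val y))%R n)%:E.
have mF n : measurable_fun setT (F n).
  apply/measurable_EFinP; apply: measurable_sum => i; apply: measurable_funM => //.
  exact: measurable_kk_section.
have iF n u : mu.-integrable setT (fun x => (gamma u * kk u x (val y))%:E).
  rewrite (_ : (fun x => _) = (fun x => (gamma u)%:E * (kk u x (val y))%:E)) ?funeqE//.
  by apply: integrableZl => //; apply: (integrable_kprod_section mu_product); exact: val_inj.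
have EF n : \int[mu]_(x in X) F n x =
    (psum (fun u => gamma u * (u == fset0)%:R)%R n)%:E.
  (* The domain has full measure, so the partial sums may be integrated over the whole product
     space, where coordinates can be resampled. *)
  have -> : X = setT `\` ~` X by rewrite setTD setCK.
  have FE : F n = (fun x => \sum_(i <- index_iota 0 n)
     (gamma (fset_nat_enum i) * kk (fset_nat_enum i) x (val y))%:E).
    by apply/funext => x; rewrite /F sumEFin.
  have iFn : mu.-integrable setT (F n).
    by rewrite FE; apply: integrable_sum => // u _; exact: iF.
  rewrite -negligible_integral//; [|exact: measurableC|exact: mu_setC_Xset].
  rewrite FE integral_sum//; last by move=> i; exact: iF.
  rewrite /psum /series /= -sumEFin; apply: eq_bigr => i _.
  under eq_integral do rewrite EFinM.
  rewrite integralZl//; last first.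
    by apply: (integrable_kprod_section mu_product); exact: val_inj.
  by rewrite EFinM (integral_kprod_section mu_product)//; exact: val_inj.
have [|||||_ _] := @dominated_convergence _ _ _ mu X mX F
  (EFin \o 'valL_ 0%R (fun x => K x y))
  (fun x => (Kdiag x)%:E + (Kdiag (val y))%:E).
- by move=> n; exact: measurable_funTS.
- by apply/measurable_EFinP; exact: measurable_Kker.
- apply: aeW => x Xx; have [z <-] := XsetE Xx; rewrite compE valL_val.
  by apply: cvg_EFin; [exact: nearW|exact: psum_Kker].
- apply: integrableD => //; first exact: integrable_Kdiag.
  exact: finite_measure_integrable_cst.
- apply: aeW => x n Xx; rewrite /F /= lee_fin.
  have sx : abs_summable (fun u => gamma u * kk u x x)%R by rewrite -XsetP.
  have sy : abs_summable (fun u => gamma u * kk u (val y) (val y))%R.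
    by rewrite -XsetP; exact: set_mem (valP y).
  apply: (@le_trans _ _ (psum (fun u => gamma u * kk u x x) n +
             psum (fun u => gamma u * kk u (val y) (val y)) n)%R).
    rewrite /psum /series /= -big_split /=; apply: le_trans (ler_norm_sum _ _ _) _.
    apply: ler_sum => i _; apply: le_trans (kk_le_diag _ _ _) _.
    have := kk_diag_ge0 (fset_nat_enum i) x.
    have := kk_diag_ge0 (fset_nat_enum i) (val y); lra.
  have psum_le f : (forall u, 0 <= f u)%R -> abs_summable f -> (psum f n <= abs_sum f)%R.
    move=> f0 sf; have := psum_abs_sum sf => cf.
    rewrite -(cvg_lim (@Rhausdorff _) cf).
    apply: nondecreasing_cvgn_le; last by apply/cvg_ex; eexists; exact: cf.
    by apply: nondecreasing_series => i _ _; exact: f0.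
  by rewrite lerD// psum_le// => u; exact: kk_diag_ge0.
under eq_fun do rewrite EF.
have [s1 e1] := @abs_sum_fin R (fun u => gamma u * (u == fset0)%:R)%R [fset fset0]%fset
  ltac:(by move=> u; rewrite inE => /negbTE ->; rewrite mulr0).
rewrite big_seq_fset1 eqxx mulr1 gamma_0 in e1.
move=> cv; rewrite /Iop /Rintegral.
have cv1 : [sequence (psum (fun u : {fset nat} => gamma u * (u == fset0)%:R)%R n)%:E]_n
    @ \oo --> (1%R)%:E.
  have := psum_abs_sum s1; rewrite e1 => c1.
  by apply: cvg_EFin; [exact: nearW|exact: c1].
have -> : \int[mu]_(x in X) ('valL_0 (K^~ y) x)%:E = 1%:E by exact: cvg_unique cv cv1.
by [].
Qed.

End sum_kernel.

End kernel_integrals.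

(** * Anchored decomposition and quadrature error *)

Lemma sum_sqr_le (R : realFieldType) (I : Type) (s : seq I) (x p q : I -> R) :
  (forall i, 0 <= p i)%R -> (forall i, 0 <= q i)%R ->
  (forall i, x i ^+ 2 <= p i * q i)%R ->
  ((\sum_(i <- s) x i) ^+ 2 <= (\sum_(i <- s) p i) * (\sum_(i <- s) q i))%R.
Proof.
move=> p0 q0 xpq; elim: s => [|i s]; first by rewrite !big_nil expr0n mul0r.
rewrite !big_cons; have := xpq i; have := p0 i; have := q0 i.
have : (0 <= \sum_(i <- s) p i)%R by exact: sumr_ge0.
have : (0 <= \sum_(i <- s) q i)%R by exact: sumr_ge0.
move: (x i) (p i) (q i) (\sum_(i <- s) x i)%R (\sum_(i <- s) p i)%R (\sum_(i <- s) q i)%R.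
move=> y a b X A B B0 A0 b0 a0 yab XAB.
(* Only the cross term remains; it follows from y^2 X^2 <= (a B)(A b) and the inequality of the
   arithmetic and geometric means. *)
suff : (2 * y * X <= a * B + A * b)%R by lra.
rewrite (le_trans (ler_norm _))// -ler_sqr ?nnegrE ?addr_ge0 ?mulr_ge0//.
rewrite real_normK ?num_real//.
have -> : ((2 * y * X) ^+ 2 = 4 * (y ^+ 2 * X ^+ 2))%R by ring.
have le1 : (y ^+ 2 * X ^+ 2 <= (a * b) * (A * B))%R by rewrite ler_pM ?sqr_ge0.
have := sqr_ge0 (a * B - A * b)%R.
by set t := (y ^+ 2 * X ^+ 2)%R in le1 *; lra.
Qed.

Lemma sqr_sum_le_size (R : realFieldType) (I : Type) (s : seq I) (x : I -> R) :
  ((\sum_(i <- s) x i) ^+ 2 <= (size s)%:R * (\sum_(i <- s) x i ^+ 2))%R.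
Proof.
have -> : ((size s)%:R = \sum_(i <- s) 1 :> R)%R by rewrite big_const_seq count_predT iter_addr_0.
by apply: sum_sqr_le => i; rewrite ?mul1r ?sqr_ge0.
Qed.

(** * Second moments and sums of independent centered variables *)

Section centered.
Context d (T : measurableType d) (R : realType) (P : probability T R).
Implicit Types X : T -> R.

(** Unbiasedness is given as an equation between expectations. A finite expectation already implies
    integrability, because the difference of the integrals of the positive and negative parts is
    finite only if both are. *)
Lemma fin_num_integrable X : measurable_fun setT X ->
  \int[P]_x (X x)%:E \is a fin_num -> P.-integrable setT (EFin \o X).
Proof.
move=> mX; rewrite integralE fin_numB => /andP[fp fn].
have mE : measurable_fun setT (EFin \o X) by exact/measurable_EFinP.
apply/integrableP; split => //.
rewrite -/(abse \o (EFin \o X)) fune_abse ge0_integralD//.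
- by rewrite lte_add_pinfty// ltey_eq ?fp ?fn.
- exact: measurable_funepos.
- exact: measurable_funeneg.
Qed.

Lemma integrable_sqr_center X (m : R) : measurable_fun setT X ->
  P.-integrable setT (fun x => ((X x - m) ^+ 2)%:E) ->
  X \in Lfun P 2%:E.
Proof.
move=> mX iX.
apply: Lfun2_integrable => //.
apply: (@le_integrable _ _ _ P _ _ _
  (fun x => 2%:E * ((X x - m) ^+ 2)%:E + (2 * m ^+ 2)%:E)) => //.
- by apply/measurable_EFinP; exact: measurable_funX.
- move=> x _; rewrite /= lee_fin ger0_norm ?sqr_ge0// (le_trans _ (ler_norm _))//.
  by have := sqr_ge0 (X x - 2 * m)%R; lra.
- by apply: integrableD => //; [exact: integrableZl|exact: finite_measure_integrable_cst].
Qed.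

Lemma integrable_le_fin (f : T -> R) (B : R) : measurable_fun setT f ->
  (forall x, 0 <= f x)%R -> \int[P]_x (f x)%:E <= B%:E ->
  P.-integrable setT (EFin \o f).
Proof.
move=> mf f0 fB; apply/integrableP; split; first exact/measurable_EFinP.
under eq_integral do rewrite /= ger0_norm//.
by apply: le_lt_trans fB _; rewrite ltry.
Qed.

Lemma variance_center X (m B : R) : measurable_fun setT X ->
  'E_P[X] = m%:E -> 'V_P[X] <= B%:E ->
  P.-integrable setT (EFin \o X) /\ \int[P]_x ((X x - m) ^+ 2)%:E <= B%:E.
Proof.
move=> mX EX; rewrite /variance unlock EX /= => VX.
split; last by move: VX; rewrite unlock.
by apply: fin_num_integrable => //; move: EX; rewrite unlock => ->.
Qed.

Lemma integral_sqr_shift (Y : T -> R) (V s : R) : measurable_fun setT Y ->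
  P.-integrable setT (EFin \o Y) -> \int[P]_x (Y x)%:E = 0 ->
  \int[P]_x (Y x ^+ 2)%:E <= V%:E ->
  \int[P]_x ((Y x + s) ^+ 2)%:E <= V%:E + (s ^+ 2)%:E.
Proof.
move=> mY iY Y0 YV.
have iY2 : P.-integrable setT (EFin \o (fun x => Y x ^+ 2)%R).
  by apply: (integrable_le_fin _ _ YV) => [|x]; [exact: measurable_funX|exact: sqr_ge0].
rewrite (_ : (fun x => _) = (fun x => (Y x ^+ 2)%:E +
    ((2 * s)%:E * (Y x)%:E + (s ^+ 2)%:E))); last first.
  by apply/funext => x; rewrite -EFinM -!EFinD; congr EFin; ring.
have iZ : P.-integrable setT (fun x => (2 * s)%:E * (Y x)%:E) by exact: integrableZl.
have ic : P.-integrable setT (fun=> (s ^+ 2)%:E) by exact: finite_measure_integrable_cst.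
rewrite integralD//; last exact: integrableD.
rewrite integralD// integralZl// Y0 mule0 add0e integral_cst//.
rewrite [X in _ * X](_ : _ = 1); last exact: probability_setT.
by rewrite mule1 leeD2r.
Qed.

End centered.

(** Bundled, so that probability spaces over different types can form a family indexed by the sets
    u. *)
Record pspace (R : realType) := Pspace {
  ps_d : measure_display ;
  ps_T : measurableType ps_d ;
  ps_P : probability ps_T R }.

(* Independence only enters through the variance of sums of centered variables. *)
Lemma product_space (R : realType) (I : eqType) (sp : I -> pspace R) (s : seq I) :
  uniq s ->
  exists (Om : pspace R) (pi : forall i, ps_T Om -> ps_T (sp i)),
    (forall i, measurable_fun setT (pi i)) /\
    forall (Y : forall i, ps_T (sp i) -> R) (V : I -> R),
      (forall i, i \in s -> [/\ measurable_fun setT (Y i),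
         (ps_P (sp i)).-integrable setT (EFin \o Y i),
         \int[ps_P (sp i)]_x (Y i x)%:E = 0 &
         \int[ps_P (sp i)]_x (Y i x ^+ 2)%:E <= (V i)%:E]) ->
      measurable_fun setT (fun w => \sum_(i <- s) Y i (pi i w))%R /\
      \int[ps_P Om]_w ((\sum_(i <- s) Y i (pi i w)) ^+ 2)%:E <=
        (\sum_(i <- s) V i)%:E.
Proof.
elim: s => [_|i s ih /= /andP[is_ us]].
  (* For the empty list a one-point space suffices: maps to spaces not listed in s only have to be
     measurable. *)
  exists (Pspace (dirac tt : probability unit R)), (fun i _ => point).
  split=> [i|Y V _]; first exact: measurable_cst.
  under eq_fun do rewrite big_nil; split; first exact: measurable_cst.
  under eq_integral do rewrite big_nil expr0n/=.
  by rewrite integral0 big_nil.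
have [Om [pi [mpi piP]]] := ih us.
pose Om1 := Pspace (ps_P Om \x ps_P (sp i))%E.
exists Om1.
(* The second factor is transported to the space of j along j = i; every other index reads the first
   factor. *)
pose pi' j (z : ps_T Om1) : ps_T (sp j) :=
  match j =P i with
  | ReflectT e => ecast l (ps_T (sp l)) (esym e) z.2
  | ReflectF _ => pi j z.1
  end.
exists pi'; split.
  move=> j; rewrite /pi'; case: (j =P i) => [e|_].
    by subst j; exact: measurable_snd.
  exact: measurableT_comp (mpi j) measurable_fst.
move=> Y V YV.
have pi'i z : pi' i z = z.2.
  by rewrite /pi'; case: eqP => // e; rewrite (eq_irrelevance e erefl).
have pi's z : (\sum_(j <- s) Y j (pi' j z) = \sum_(j <- s) Y j (pi j z.1))%R.
  apply: eq_big_seq => j js; rewrite /pi'; case: eqP => // e.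
  by rewrite -e js in is_.
have [mS SV] := piP Y V (fun j js => YV j ltac:(by rewrite inE js orbT)).
have [mY iY Y0 Y2] := YV i (mem_head _ _).
have E z : (\sum_(j <- i :: s) Y j (pi' j z) =
    Y i z.2 + \sum_(j <- s) Y j (pi j z.1))%R by rewrite big_cons pi's pi'i.
have mE : measurable_fun setT
    (fun z : ps_T Om1 => Y i z.2 + \sum_(j <- s) Y j (pi j z.1))%R.
  apply: measurable_funD; first exact: measurableT_comp mY measurable_snd.
  exact: (measurableT_comp mS measurable_fst).
split; first by under eq_fun do rewrite E.
under eq_integral do rewrite E.
(* With the first factor fixed, the sum over s is a constant shift of the centered variable [Y i],
   and integrating over the second factor adds [V i]. *)
rewrite (@fubini_tonelli1 _ _ _ _ _ (ps_P Om) (ps_P (sp i))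
  (fun z => ((Y i z.2 + \sum_(j <- s) Y j (pi j z.1)) ^+ 2)%:E)); last 2 first.
- by apply/measurable_EFinP; exact: measurable_funX.
- by move=> z; rewrite lee_fin sqr_ge0.
apply: (@le_trans _ _ (\int[ps_P Om]_x ((V i)%:E +
    ((\sum_(j <- s) Y j (pi j x)) ^+ 2)%:E))).
  apply: ge0_le_integral => //.
  - by move=> x _; apply: integral_ge0 => y _; rewrite lee_fin sqr_ge0.
  - apply: measurable_fun_fubini_tonelli_F => [|z]; last by rewrite lee_fin sqr_ge0.
    by apply/measurable_EFinP; exact: measurable_funX.
  - by apply/measurable_EFinP; apply: measurable_funD => //; exact: measurable_funX.
  - move=> x _; rewrite /fubini_F /=.
    exact: (integral_sqr_shift (\sum_(j <- s) Y j (pi j x))%R mY iY Y0 Y2).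
have V0 : 0 <= (V i)%:E.
  by apply: le_trans Y2; apply: integral_ge0 => x _; rewrite lee_fin sqr_ge0.
rewrite ge0_integralD//; last 2 first.
- by move=> x _; rewrite lee_fin sqr_ge0.
- by apply/measurable_EFinP; exact: measurable_funX.
rewrite integral_cst// [X in _ * X](_ : _ = 1); last exact: probability_setT.
by rewrite mule1 big_cons EFinD leeD2l.
Qed.

Local Close Scope ereal_scope.

(** For v included in u this is (-1)^|u \ v|; adding the sizes avoids truncated subtraction. *)
Definition mobius_sign (R : realType) (u v : {fset nat}) : R :=
  (-1) ^+ (#|` u| + #|` v|).

(** Toggling j is a sign-reversing involution of the subsets of u that leaves F unchanged. *)
Lemma mobius_sign_sum0 (R : realType) (u : {fset nat}) (F : {fset nat} -> R) j :
  j \in u -> (forall v, F (v `\ j)%fset = F v) ->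
  \sum_(v <- fpowerset u) mobius_sign R u v * F v = 0.
Proof.
move=> ju Fj.
pose flip (v : {fset nat}) : {fset nat} := (if j \in v then v `\ j else j |` v)%fset.
have flipK v : flip (flip v) = v.
  have [jv|jv] := boolP (j \in v).
    by rewrite /flip jv !inE eqxx /= fsetD1K.
  by rewrite /flip (negbTE jv) !inE eqxx /= fsetU1K.
have perm : perm_eq (map flip (fpowerset u)) (fpowerset u).
  apply: uniq_perm => //; [by rewrite (map_inj_uniq (can_inj flipK)) fset_uniq|exact: fset_uniq|].
  move=> v; apply/mapP/idP => [[w wu ->]|vu].
    move: wu; rewrite !fpowersetE /flip => wu; case: ifPn => _.
      by apply: fsubset_trans wu; exact: fsubD1set.
    by rewrite fsubUset fsub1set ju.
  exists (flip v); last by rewrite flipK.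
  move: vu; rewrite !fpowersetE /flip => vu; case: ifPn => _.
    by apply: fsubset_trans vu; exact: fsubD1set.
  by rewrite fsubUset fsub1set ju.
have sgn v : mobius_sign R u (flip v) = - mobius_sign R u v.
  rewrite /mobius_sign /flip; case: ifPn => jv.
    by rewrite (cardfsD1 j v) jv addnCA add1n exprS mulN1r opprK.
  by rewrite cardfsU1 jv addnCA add1n exprS mulN1r.
have Ff v : F (flip v) = F v.
  rewrite /flip; case: ifPn => jv; first exact: Fj.
  by rewrite -Fj fsetU1K.
set S := LHS; have : S = - S.
  rewrite {1}/S -(perm_big _ perm) big_map -sumrN; apply: eq_bigr => v _.
  by rewrite sgn Ff mulNr.
by lra.
Qed.

Lemma prodr_fsetD (R : comRingType) (I : choiceType) (A B : {fset I}) (F : I -> R) :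
  (A `<=` B)%fset ->
  \prod_(j <- B) F j = (\prod_(j <- A) F j) * (\prod_(j <- (B `\` A)%fset) F j).
Proof.
move=> AB; rewrite (perm_big (A ++ (B `\` A)%fset)) ?big_cat//.
apply: uniq_perm => //.
  rewrite cat_uniq !fset_uniq andbT /=; apply/hasPn => j.
  by rewrite inE => /andP[].
move=> j; rewrite mem_cat !inE; have [jA|//] := boolP (j \in A).
by rewrite (fsubsetP AB).
Qed.

Lemma prodr_const_fset (R : comRingType) (I : choiceType) (A : {fset I}) (c : R) :
  \prod_(j <- A) c = c ^+ #|` A|.
Proof. by rewrite big_const_seq count_predT iter_mulr_1. Qed.

(** * Components of kernel combinations and their anchored parts *)

Section anchored_decomposition.
Context d (T : measurableType d) (R : realType).
Variables (k : T -> T -> R) (gamma : {fset nat} -> R) (a : T).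
Hypothesis Hk : rkhs k.
Variable Hu : forall u : {fset nat}, rkhs (kprod k u).
Hypothesis k_pos : forall x, 0 < k x x.
Hypothesis gamma_ge0 : forall u, 0 <= gamma u.
Hypothesis a_anchor : (\esum_(u in [set: {fset nat}])
  (gamma u * k a a ^+ #|` u|)%:E < +oo)%E.

Local Notation X := (Xset k gamma).
Local Notation K := (Kker k gamma).

Definition anc (v : {fset nat}) (x : power nat T) : power nat T :=
  fun j => if j \in v then x j else a.

Lemma anc_anchored v x : anchored a v (anc v x).
Proof. by move=> j jv; rewrite /anc (negbTE jv). Qed.

Lemma kkE u x y : kk k u x y = \prod_(j <- u) k (x j) (y j).
Proof. by rewrite /kk /kprod big_seq_fsetE. Qed.

Lemma kk_anc v w x y : (v `<=` w)%fset ->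
  kk k w (anc v x) y = kk k v x y * \prod_(j <- (w `\` v)%fset) k a (y j).
Proof.
move=> vw; rewrite !kkE (prodr_fsetD _ vw).
congr (_ * _); apply: eq_big_seq => j jv; rewrite /anc; first by rewrite jv.
by move: jv; rewrite inE => /andP[/negbTE ->].
Qed.

Lemma kk_anc2 v w x y : (v `<=` w)%fset ->
  kk k w (anc v x) (anc v y) = kk k v x y * k a a ^+ #|` (w `\` v)%fset|.
Proof.
move=> vw; rewrite kk_anc// !kkE; congr (_ * _).
  by apply: eq_big_seq => j jv; rewrite /anc jv.
rewrite -prodr_const_fset; apply: eq_big_seq => j; rewrite /anc inE.
by move=> /andP[/negbTE ->].
Qed.

(** Replacing the anchor by x on the finite set v multiplies each diagonal term by a factor bounded
    uniformly in u, namely the product over v of max(1, k(x_j,x_j) / k(a,a)), so convergence at the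
    anchor carries over. *)
Lemma anc_Xset v x : X (anc v x).
Proof.
pose r j := Num.max 1 (k (x j) (x j) / k a a).
have r1 j : 1 <= r j by rewrite le_max lexx.
pose C := \prod_(j <- v) r j.
have C0 : 0 <= C by apply: prodr_ge0 => j _; exact: le_trans (r1 j).
have le_kk u : kk k u (anc v x) (anc v x) <= C * k a a ^+ #|` u|.
  rewrite kkE; apply: (@le_trans _ _ (\prod_(j <- u)
      ((if j \in v then r j else 1) * k a a))).
    apply: ler_prod => j _; rewrite (ltW (k_pos _))/= /anc.
    case: ifPn => jv; last by rewrite mul1r.
    by rewrite -ler_pdivrMr ?k_pos// /r le_max lexx orbT.
  rewrite big_split/= prodr_const_fset ler_wpM2r//; first by rewrite exprn_ge0// ltW.
  set F := fun j => if j \in v then r j else 1.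
  have F1 j : 1 <= F j by rewrite /F; case: ifP.
  have F0 (A : {fset nat}) : 0 <= \prod_(j <- A) F j.
    by apply: prodr_ge0 => j _; exact: le_trans (F1 j).
  apply: (@le_trans _ _ (\prod_(j <- (u `|` v)%fset) F j)).
    rewrite (prodr_fsetD _ (fsubsetUl u v)) ler_peMr//.
    elim/big_ind : _ => // x1 x2 h1 h2; exact: mulr_ege1.
  rewrite (prodr_fsetD _ (fsubsetUr u v)) [X in _ * X]big1_fset ?mulr1; last first.
    by move=> j; rewrite !inE /F => /andP[/negbTE ->].
  rewrite /C le_eqVlt; apply/orP; left; apply/eqP; apply: eq_big_seq => j jv.
  by rewrite /F jv.
rewrite /Xset /=.
apply: (@le_lt_trans _ _ (\esum_(u in [set: {fset nat}])
    (C * (gamma u * k a a ^+ #|` u|))%:E)%E).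
  apply: le_esum => u _; rewrite lee_fin mulrCA ler_wpM2l//; exact: le_kk.
have : abs_summable (fun u => C * (gamma u * k a a ^+ #|` u|) + 0).
  apply: abs_summable_lin; last exact: (abs_sum0 R).2.
  by apply: abs_summable_ge0 => // u; rewrite mulr_ge0// exprn_ge0// ltW.
under eq_fun do rewrite addr0.
apply: abs_summable_lty => u.
by rewrite !mulr_ge0// exprn_ge0// ltW.
Qed.

(* The point (x_v, a). *)
Definition pt v x : X := exist _ (anc v x) (mem_set (anc_Xset v x)).

(** The w-part f_w of [combo K s]. It is defined on all sequences, since a single summand raises no
    question of convergence. *)
Definition component (s : seq (R * X)) (w : {fset nat}) (x : power nat T) : R :=
  gamma w * \sum_(p <- s) p.1 * kk k w x (val p.2).

(** The squared norm of f_w for the weighted kernel gamma_w k_w; for k_w itself it is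
    [gamma w * energy s w]. *)
Definition energy (s : seq (R * X)) (w : {fset nat}) : R :=
  gamma w * \sum_(p <- s) \sum_(q <- s) p.1 * q.1 * kk k w (val p.2) (val q.2).

Lemma combo_comp s (x : X) :
  abs_summable (fun w => component s w (val x)) /\
  combo K s x = abs_sum (fun w => component s w (val x)).
Proof.
have sF (p : R * X) : abs_summable (fun u => gamma u * kk k u (val x) (val p.2)).
  apply: abs_summable_kk => //; exact: set_mem (valP _).
have [h1 h2] := abs_sum_sum s (fun p => p.1) sF.
have E : (fun w => component s w (val x)) =
    (fun u => \sum_(p <- s) p.1 * (gamma u * kk k u (val x) (val p.2))).
  apply/funext => w; rewrite /component mulr_sumr; apply: eq_bigr => p _; ring.
by rewrite E; split => //; rewrite h2.
Qed.

Lemma energy_ge0 s w : 0 <= energy s w.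
Proof.
rewrite mulr_ge0//.
have := kernel_quad_ge0 (Hu w) [seq (p.1, restr w (val p.2)) | p <- s].
by rewrite big_map; under eq_bigr do rewrite big_map.
Qed.

(** This replaces the orthogonal decomposition of H(K): both sides are the same double sum of kernel
    values, and summation over w commutes with the finite sums. *)
Lemma combo_energy (HK : rkhs K) s :
  abs_summable (energy s) /\
  rkhs_ip HK (combo K s) (combo K s) = abs_sum (energy s).
Proof.
have sF (p q : R * X) : abs_summable (fun u => gamma u * kk k u (val p.2) (val q.2)).
  apply: abs_summable_kk => //; exact: set_mem (valP _).
have s1 (p : R * X) := abs_sum_sum s (fun q => q.1) (sF p).
have [h1 h2] := abs_sum_sum s (fun p => p.1) (fun p => (s1 p).1).
have E : energy s = (fun u => \sum_(p <- s) p.1 *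
    \sum_(q <- s) q.1 * (gamma u * kk k u (val p.2) (val q.2))).
  apply/funext => w; rewrite /energy mulr_sumr; apply: eq_bigr => p _.
  by rewrite !mulr_sumr; apply: eq_bigr => q _; ring.
rewrite E; split => //; rewrite h2 rkhs_ip_combo; apply: eq_bigr => p _.
rewrite (s1 p).2 mulr_sumr; apply: eq_bigr => q _.
by rewrite mulrA.
Qed.

Lemma component_sqr_le s w x :
  component s w x ^+ 2 <= (gamma w * kk k w x x) * energy s w.
Proof.
pose s' := [seq (p.1, restr w (val p.2)) | p <- s].
have := rkhs_eval_sq (restr w x) (rkhs_combo (Hu w) s').
rewrite rkhs_ip_combo /combo !big_map.
under [X in _ <= X * _ -> _]eq_bigr do rewrite big_map.
move=> h; rewrite /component /energy exprMn.
have := ler_wpM2l (sqr_ge0 (gamma w)) h.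
by move=> /le_trans; apply; rewrite le_eqVlt; apply/orP; left; apply/eqP; rewrite /kk; ring.
Qed.

Definition mob (f : X -> R) (u : {fset nat}) (x : power nat T) : R :=
  \sum_(v <- fpowerset u) mobius_sign R u v * f (pt v x).

Lemma component_anc_restrict s w v x :
  component s w (anc v x) = component s w (anc (v `&` w)%fset x).
Proof.
rewrite /component; congr (_ * _); apply: eq_bigr => p _; rewrite !kkE.
by congr (_ * _); apply: eq_big_seq => j jw; rewrite /anc inE jw andbT.
Qed.

(** Some j in u lies outside w, and f_w ignores coordinate j, so the alternating sum cancels. *)
Lemma mob_comp0 s w u x : ~~ (u `<=` w)%fset ->
  \sum_(v <- fpowerset u) mobius_sign R u v * component s w (anc v x) = 0.
Proof.
move=> /fsubsetPn[j ju jw]; apply: (mobius_sign_sum0 ju) => v.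
rewrite component_anc_restrict [RHS]component_anc_restrict; congr (component s w (anc _ x)).
apply/fsetP => i; rewrite !inE; have [->|//] := eqVneq i j.
by rewrite (negbTE jw) !andbF.
Qed.

(** The components of w not containing u cancel, so a finite W holding the remaining sets of nonzero
    weight turns the infinite sum into a finite one. *)
Lemma mob_combo s u x (W : {fset {fset nat}}) :
  (forall w, (u `<=` w)%fset -> gamma w != 0 -> w \in W) ->
  mob (combo K s) u x = \sum_(w <- W) \sum_(v <- fpowerset u)
    mobius_sign R u v * component s w (anc v x).
Proof.
move=> WP; rewrite /mob.
under eq_bigr do rewrite (combo_comp s _).2.
have [_ <-] := abs_sum_sum (fpowerset u) (fun v => mobius_sign R u v)
  (fun v => (combo_comp s (pt v x)).1).
have [//|_ <-//] := @abs_sum_fin R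
  (fun w => \sum_(v <- fpowerset u) mobius_sign R u v * component s w (anc v x)) W _.
move=> w wW; have [uw|uw] := boolP (u `<=` w)%fset; last exact: mob_comp0.
have g0 : gamma w = 0 by apply/eqP; apply: contraNT wW; exact: WP.
by rewrite big1// => v _; rewrite /component g0 mul0r mulr0.
Qed.

(* The component of w, restricted to arguments anchored outside of v, as an
   element of the span of the sections of the kernel of v. *)
Definition subcombo (s : seq (R * X)) (w v : {fset nat}) : seq (R * power v T) :=
  [seq (gamma w * p.1 * \prod_(j <- (w `\` v)%fset) k a (val p.2 j),
        restr v (val p.2)) | p <- s].

Lemma component_anc s w v x : (v `<=` w)%fset ->
  component s w (anc v x) = combo (kprod k v) (subcombo s w v) (restr v x).
Proof.
move=> vw; rewrite /component /combo big_map mulr_sumr; apply: eq_bigr => p _ /=.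
by rewrite kk_anc//; rewrite /kk; ring.
Qed.

(** Freezing the coordinates of w \ v at a maps h to g. Its adjoint sends the section at y to the
    section at (y, a), hence g to [h']; thus <h', h> = |g|^2 and |h'|^2 = k(a,a)^|w \ v| |g|^2, and
    Cauchy-Schwarz is divided by |g|^2. *)
Lemma subcombo_norm s w v : (v `<=` w)%fset ->
  rkhs_ip (Hu v) (combo (kprod k v) (subcombo s w v))
                 (combo (kprod k v) (subcombo s w v)) <=
  k a a ^+ #|` (w `\` v)%fset| * (gamma w * energy s w).
Proof.
move=> vw; set g := combo _ _.
pose h := combo (kprod k w) [seq (gamma w * p.1, restr w (val p.2)) | p <- s].
have Hh : Hu w h by exact: rkhs_combo.
have Hg : Hu v g by exact: rkhs_combo.
pose e (p : R * X) := gamma w * p.1 * \prod_(j <- (w `\` v)%fset) k a (val p.2 j).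
pose h' := combo (kprod k w) [seq (e p, restr w (anc v (val p.2))) | p <- s].
have Hh' : Hu w h' by exact: rkhs_combo.
have gh y : g (restr v y) = h (restr w (anc v y)).
  rewrite /g /h -component_anc// /component /combo big_map mulr_sumr.
  by apply: eq_bigr => p _; rewrite mulrA.
have nh : rkhs_ip (Hu w) h h = gamma w * energy s w.
  rewrite rkhs_ip_combo big_map /energy !mulr_sumr; apply: eq_bigr => p _.
  rewrite big_map !mulr_sumr; apply: eq_bigr => q _ /=.
  by rewrite /kk; ring.
have ng : rkhs_ip (Hu v) g g = rkhs_ip (Hu w) h' h.
  rewrite rkhs_ip_combol// rkhs_ip_combol// !big_map; apply: eq_bigr => p _ /=.
  by rewrite gh.
have nh' : rkhs_ip (Hu w) h' h' =
    k a a ^+ #|` (w `\` v)%fset| * rkhs_ip (Hu v) g g.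
  rewrite !rkhs_ip_combo !big_map mulr_sumr; apply: eq_bigr => p _.
  rewrite !big_map mulr_sumr; apply: eq_bigr => q _ /=.
  have := kk_anc2 (val p.2) (val q.2) vw; rewrite /kk => ->.
  by rewrite -/(e p) -/(e q); ring.
have := rkhs_cauchy_schwarz Hh' Hh; rewrite -ng nh' nh.
have := rkhs_ip_ge0 Hg; set n := rkhs_ip (Hu v) g g; set A := k a a ^+ _.
set B := gamma w * energy s w => n0 le2.
have [->|nN0] := eqVneq n 0.
  have A0 : 0 <= A by rewrite /A exprn_ge0// ltW.
  by apply: mulr_ge0 => //; rewrite /B; apply: mulr_ge0 => //; exact: energy_ge0.
have np : 0 < n by rewrite lt_neqAle eq_sym nN0.
by rewrite -(ler_pM2l np); move: le2; rewrite expr2; lra.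
Qed.

End anchored_decomposition.

(** * Means and centered second moments *)

Section moments.
Context d (O0 : measurableType d) (R : realType) (P : probability O0 R).

Definition moments (X : O0 -> R) (m V : R) : Prop :=
  [/\ measurable_fun setT X, P.-integrable setT (EFin \o X),
      (\int[P]_w (X w)%:E = m%:E)%E &
      (\int[P]_w ((X w - m) ^+ 2)%:E <= V%:E)%E].

Lemma moments_sign (b : R) X m V : b ^+ 2 = 1 -> moments X m V ->
  moments (fun w => b * X w) (b * m) V.
Proof.
move=> b1 [mX iX EX VX]; split.
- exact: measurable_funM.
- exact: (integrableZl measurableT b iX).
- by under eq_integral do rewrite EFinM; rewrite integralZl// EX.
- by under eq_integral do rewrite -mulrBr exprMn b1 mul1r.
Qed.

(** No independence is assumed, as the summands will share the nodes of one quadrature;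
    Cauchy-Schwarz costs the factor [size s]. *)
Lemma moments_sum (I : eqType) (s : seq I) (X : I -> O0 -> R) (m V : I -> R) :
  (forall i, i \in s -> moments (X i) (m i) (V i)) ->
  moments (fun w => \sum_(i <- s) X i w) (\sum_(i <- s) m i)
    ((size s)%:R * \sum_(i <- s) V i).
Proof.
move=> sX.
have mX : measurable_fun setT (fun w => \sum_(i <- s) X i w).
  rewrite (_ : (fun w => _) = (fun w => \sum_(i <- s) if i \in s then X i w else 0)).
    apply: measurable_sum => i; have [is_|_] := boolP (i \in s).
      by case: (sX i is_).
    exact: measurable_cst.
  by apply/funext => w; apply: eq_big_seq => i ->.
have E : forall w, (\sum_(i <- s) X i w)%:E =
    (\sum_(i <- s) (if i \in s then X i w else 0)%:E)%E.
  move=> w; rewrite -sumEFin; apply: eq_big_seq => i ->//.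
have iX i : P.-integrable setT (fun w => (if i \in s then X i w else 0)%:E).
  by have [is_|_] := boolP (i \in s); [case: (sX i is_)|exact: integrable0].
have iS : P.-integrable setT (EFin \o (fun w => \sum_(i <- s) X i w)).
  rewrite (_ : _ \o _ = (fun w => \sum_(i <- s) (if i \in s then X i w else 0)%:E)%E).
    by apply: integrable_sum => // i _; exact: iX.
  by apply/funext => w; rewrite -E.
split => //.
  under eq_integral do rewrite E.
  rewrite integral_sum// -sumEFin; apply: eq_big_seq => i si.
  by have [_ _ <- _] := sX i si; apply: eq_integral => w _; rewrite si.
pose Z i w := if i \in s then X i w - m i else 0.
have mZ i : measurable_fun setT (fun w => Z i w).
  rewrite /Z; have [is_|_] := boolP (i \in s); last exact: measurable_cst.
  by have [? _ _ _] := sX i is_; exact: measurable_funB.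
apply: (@le_trans _ _ (\int[P]_w ((size s)%:R%:E * \sum_(i <- s) (Z i w ^+ 2)%:E))%E).
  apply: ge0_le_integral => //.
  - by move=> w _; rewrite lee_fin sqr_ge0.
  - by apply/measurable_EFinP; apply: measurable_funX; exact: measurable_funB.
  - apply: measurable_funeM; apply: emeasurable_sum => i.
    by apply/measurable_EFinP; exact: measurable_funX.
  - move=> w _; rewrite sumEFin -EFinM lee_fin -sumrB.
    rewrite (eq_big_seq (fun i => Z i w)); first exact: sqr_sum_le_size.
    by move=> i si; rewrite /Z si.
rewrite ge0_integralZl//; last 2 first.
- apply: emeasurable_sum => i; apply/measurable_EFinP; exact: measurable_funX.
- by move=> w _; apply: sume_ge0 => i _; rewrite lee_fin sqr_ge0.
rewrite EFinM; apply: lee_wpmul2l; first by rewrite lee_fin.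
rewrite ge0_integral_sum//; last 2 first.
- by move=> i; apply/measurable_EFinP; exact: measurable_funX.
- by move=> i w _; rewrite lee_fin sqr_ge0.
rewrite -sumEFin big_seq [leRHS]big_seq; apply: lee_sum => i si.
have [_ _ _] := sX i si; apply: le_trans; rewrite le_eqVlt; apply/orP; left; apply/eqP.
by apply: eq_integral => w _; rewrite /Z si.
Qed.

End moments.

Lemma abs_sum_sqr_le (R : realType) (x p q : {fset nat} -> R) :
  (forall u, 0 <= p u) -> (forall u, 0 <= q u) ->
  (forall u, x u ^+ 2 <= p u * q u) ->
  abs_summable x -> abs_summable p -> abs_summable q ->
  abs_sum x ^+ 2 <= abs_sum p * abs_sum q.
Proof.
move=> p0 q0 xpq sx sp sq.
have cx : psum x n ^+ 2 @[n --> \oo] --> abs_sum x ^+ 2.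
  by rewrite expr2; under eq_fun do rewrite expr2; apply: cvgM; exact: psum_abs_sum.
have cpq : psum p n * psum q n @[n --> \oo] --> abs_sum p * abs_sum q.
  by apply: cvgM; exact: psum_abs_sum.
apply: ler_cvg_to cx cpq _; apply: nearW => n.
by rewrite /psum /series /=; apply: sum_sqr_le => i; [exact: p0|exact: q0|exact: xpq].
Qed.

Lemma abs_summable_dom (R : realType) (x g : {fset nat} -> R) :
  (forall u, `|x u| <= g u) -> abs_summable g -> abs_summable x.
Proof.
move=> xg sg; apply: (abs_summable_le xg); apply: abs_summable_lty => // u.
exact: le_trans (xg u).
Qed.

Lemma cvg_sum_seq (R : realType) (I : Type) (s : seq I) (F : nat -> I -> R)
  (l : I -> R) : (forall i, F n i @[n --> \oo] --> l i) ->
  \sum_(i <- s) F n i @[n --> \oo] --> \sum_(i <- s) l i.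
Proof.
move=> Fl; elim: s => [|i s ih].
  by rewrite big_nil; under eq_fun do rewrite big_nil; exact: cvg_cst.
by rewrite big_cons; under eq_fun do rewrite big_cons; exact: cvgD.
Qed.

Lemma fatou_le d (T : measurableType d) (R : realType) (P : probability T R)
  (D_ : nat -> T -> R) (D : T -> R) (c : R) :
  (forall n, measurable_fun setT (D_ n)) ->
  (forall x, D_ n x @[n --> \oo] --> D x) ->
  (forall n, (\int[P]_x ((D_ n x) ^+ 2)%:E <= c%:E)%E) ->
  measurable_fun setT D /\ (\int[P]_x ((D x) ^+ 2)%:E <= c%:E)%E.
Proof.
move=> mD cD Dc; split; first by apply: measurable_fun_cvg (fun x _ => cD x).
have m2 n : measurable_fun setT (fun x => ((D_ n x) ^+ 2)%:E).
  by apply/measurable_EFinP; exact: measurable_funX.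
have := fatou P measurableT m2 (fun n x _ => ltac:(by rewrite lee_fin sqr_ge0)).
rewrite (_ : (fun x => limn_einf _) = (fun x => ((D x) ^+ 2)%:E)); last first.
  apply/funext => x.
  have c2 : ((D_ n x) ^+ 2)%:E @[n --> \oo] --> ((D x) ^+ 2)%:E.
    apply: cvg_EFin; first exact: nearW.
    by rewrite expr2; under eq_fun do rewrite /= expr2; apply: cvgM; exact: cD.
  by rewrite is_cvg_limn_einfE; [exact/cvg_lim|apply/cvg_ex; eexists; exact: c2].
move=> /le_trans; apply; rewrite limn_einf_lim; apply: lime_le.
  exact: is_cvg_einfs.
apply: nearW => n; apply: le_trans (Dc n).
by apply: ereal_inf_lbound; exists n => /=.
Qed.

(** * Bias and variance of the estimator *)

Section algorithm.
Context d (T : measurableType d) (R : realType) (rho : probability T R).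
Variable k : T -> T -> R.
Hypothesis Hk : rkhs k.
Variable Hu : forall u : {fset nat}, rkhs (kprod k u).
Hypothesis k_meas : measurable_fun setT (fun z : T * T => k z.1 z.2).
Hypothesis M_fin : (\int[rho]_x (k x x)%:E < +oo)%E.
Hypothesis k_int0 : forall y, (\int[rho]_x (k x y)%:E = 0)%E.
Hypothesis k_pos : forall x, 0 < k x x.
Context (mu : probability (power nat T) R) (mu_product : is_product rho mu).
Variable gamma : {fset nat} -> R.
Hypothesis gamma_ge0 : forall u, 0 <= gamma u.
Hypothesis gamma_0 : gamma fset0 = 1.
Hypothesis gamma_sum : (\esum_(u in [set: {fset nat}])
  (gamma u * Mk rho k ^+ #|` u|)%:E < +oo)%E.
Variable a : T.
Hypothesis a_anchor : (\esum_(u in [set: {fset nat}])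
  (gamma u * k a a ^+ #|` u|)%:E < +oo)%E.
Variable HK : rkhs (Kker k gamma).
Hypothesis gamma_mono : forall u v : {fset nat}, (u `<=` v)%fset -> gamma v <= gamma u.
Variables beta r : nat.
Hypothesis gamma_order : forall u : {fset nat}, (beta < #|` u|)%N -> gamma u = 0.
Hypothesis gamma_inter : forall u : {fset nat}, 0 < gamma u ->
  ([set v : {fset nat} | 0 < gamma v /\ (u `&` v)%fset != fset0] #<= `I_(1 + r)%N)%card.

Local Notation X := (Xset k gamma).
Local Notation K := (Kker k gamma).
Local Notation pt := (pt k_pos gamma_ge0 a_anchor).
Local Notation mob := (mob k_pos gamma_ge0 a_anchor).

(** [fset_set] is empty on infinite sets, so this is meaningful only for nonempty u of positive
    weight, where the intersection property bounds it. *)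
Definition supersets (u : {fset nat}) : {fset {fset nat}} :=
  fset_set [set w : {fset nat} | 0 < gamma w /\ (u `<=` w)%fset].

Lemma supersets_le u : u != fset0 -> 0 < gamma u ->
  [set w : {fset nat} | 0 < gamma w /\ (u `<=` w)%fset] `<=`
  [set v : {fset nat} | 0 < gamma v /\ (u `&` v)%fset != fset0].
Proof. by move=> u0 gu w [gw /fsetIidPl uw]; split => //; rewrite uw. Qed.

Lemma finite_supersets u : u != fset0 -> 0 < gamma u ->
  finite_set [set w : {fset nat} | 0 < gamma w /\ (u `<=` w)%fset].
Proof.
move=> u0 gu; apply: sub_finite_set (supersets_le u0 gu) _.
exact: card_le_finite (gamma_inter gu) (finite_II _).
Qed.

Lemma mem_supersets u w : u != fset0 -> 0 < gamma u ->
  (w \in supersets u) = (0 < gamma w) && (u `<=` w)%fset.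
Proof.
move=> u0 gu; rewrite in_fset_set; last exact: finite_supersets.
by apply/idP/idP => [/set_mem[-> ->]//|/andP[h1 h2]]; apply/mem_set.
Qed.

Lemma card_supersets u : u != fset0 -> 0 < gamma u ->
  (#|` supersets u| <= 1 + r)%N.
Proof.
move=> u0 gu; apply: geq_card_fset_set.
exact: card_le_trans (subset_card_le (supersets_le u0 gu)) (gamma_inter gu).
Qed.

Lemma gamma_gt0_card u : 0 < gamma u -> (#|` u| <= beta)%N.
Proof. by rewrite ltNge; move=> gu; rewrite leqNgt; apply: contra gu => /gamma_order ->. Qed.

(* A randomized quadrature with points in the full product space; only the
   bounds on its first two moments are retained. *)
Record rquad := Rquad {
  rq_sp : pspace R ;
  rq_t : nat -> R ;
  rq_x : nat -> ps_T rq_sp -> power nat T }.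

Definition rq_val (q : rquad) (n : nat) (h : power nat T -> R)
    (w : ps_T (rq_sp q)) : R := \sum_(i <- iota 0 n) rq_t q i * h (rq_x i w).

(** The prescribed mean is the exact integral: k has mean zero, so a combination of sections of k_v
    integrates to 0 unless v is empty, where it is the sum of the coefficients. *)
Definition good_rquad (q : rquad) (u : {fset nat}) (n : nat) (B : R) : Prop :=
  forall v : {fset nat}, (v `<=` u)%fset -> forall s : seq (R * power v T),
  moments (ps_P (rq_sp q)) (rq_val (q := q) n (fun x => combo (kprod k v) s (restr v x)))
    ((\sum_(p <- s) p.1) *+ (v == fset0))
    (B * rkhs_ip (Hu v) (combo (kprod k v) s) (combo (kprod k v) s)).

(** Dominates k(a,a)^j for all j <= beta, whether k(a,a) is below or above 1. *)
Let kap : R := (1 + k a a) ^+ beta.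

Let kap_ge1 : 1 <= kap.
Proof. by apply: exprn_ege1; rewrite lerDl ltW. Qed.

Let kap_ge0 : 0 <= kap. Proof. exact: le_trans kap_ge1. Qed.

Let kap_le j : (j <= beta)%N -> k a a ^+ j <= kap.
Proof.
move=> jb; apply: (@le_trans _ _ ((1 + k a a) ^+ j)).
  apply: lerXn2r; rewrite ?nnegrE; [exact: ltW|by rewrite addr_ge0// ltW|].
  by rewrite lerDr.
by apply: ler_weXn2l => //; rewrite lerDl ltW.
Qed.

Local Notation energy := (energy (k := k) (gamma := gamma)).
Local Notation component := (component (k := k) (gamma := gamma)).

Definition anchor_comp (s : seq (R * X)) (w : {fset nat}) : R := component s w (fun=> a).

Lemma anc0 x : anc a fset0 x = (fun=> a).
Proof. by apply/funext => j; rewrite /anc inE. Qed.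

Lemma subcombo0_sum s w :
  \sum_(p <- subcombo a s w fset0) p.1 = anchor_comp s w.
Proof.
rewrite /anchor_comp /component big_map mulr_sumr; apply: eq_bigr => p _ /=.
by rewrite fsetD0 kkE mulrA.
Qed.

(** For each w there are 2^|u| terms over v, and Cauchy-Schwarz gives 2^|u| once more, hence 4^beta;
    the sum over the supersets of u costs 1 + r. Monotonicity replaces gamma_w by gamma_u. In the
    mean only v = fset0 survives. *)
Lemma mob_moments (q : rquad) u n B s : 0 <= B -> u != fset0 -> 0 < gamma u ->
  good_rquad q u n B ->
  moments (ps_P (rq_sp q)) (rq_val (q := q) n (mob (combo K s) u))
    (\sum_(w <- supersets u) (-1) ^+ #|` u| * anchor_comp s w)
    ((1 + r)%:R * 4 ^+ beta * kap * (B * gamma u) *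
       \sum_(w <- supersets u) energy s w).
Proof.
move=> B0 u0 gu gq.
have WP w : (u `<=` w)%fset -> gamma w != 0 -> w \in supersets u.
  by move=> uw gw; rewrite mem_supersets// uw andbT lt_neqAle eq_sym gw gamma_ge0.
pose Y w v := rq_val (q := q) n (fun x => combo (kprod k v) (subcombo a s w v) (restr v x)).
have valE : rq_val (q := q) n (mob (combo K s) u) =
    (fun om => \sum_(w <- supersets u) \sum_(v <- fpowerset u)
       mobius_sign R u v * Y w v om).
  apply/funext => om; rewrite /rq_val.
  under eq_bigr => i _.
    rewrite (mob_combo Hu k_pos gamma_ge0 a_anchor s _ WP).
    rewrite mulr_sumr; under eq_bigr do rewrite mulr_sumr.
    over.
  rewrite exchange_big; apply: eq_big_seq => w ws.
  rewrite exchange_big; apply: eq_big_seq => v vu.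
  rewrite /Y /rq_val mulr_sumr; apply: eq_bigr => i _.
  rewrite mulrCA component_anc//.
  move: ws; rewrite mem_supersets// => /andP[_]; apply: fsubset_trans.
  by rewrite -fpowersetE.
have Ymom w v : w \in supersets u -> v \in fpowerset u ->
    moments (ps_P (rq_sp q)) (fun om => mobius_sign R u v * Y w v om)
      (mobius_sign R u v * ((\sum_(p <- subcombo a s w v) p.1) *+ (v == fset0)))
      (B * (kap * (gamma u * energy s w))).
  rewrite mem_supersets// fpowersetE => /andP[gw uw] vu.
  have [m1 m2 m3 m4] := moments_sign (b := mobius_sign R u v)
    ltac:(by rewrite /mobius_sign -exprM mulnC exprM sqrrN !expr1n)
    (gq v vu (subcombo a s w v)).
  split => //; apply: le_trans m4 _; rewrite lee_fin ler_wpM2l//.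
  have vw := fsubset_trans vu uw.
  apply: le_trans (subcombo_norm a Hu k_pos gamma_ge0 s vw) _.
  apply: ler_pM; first by rewrite exprn_ge0// ltW.
  - by rewrite mulr_ge0// energy_ge0.
  - apply: kap_le; apply: leq_trans (gamma_gt0_card gw).
    by apply: fsubset_leq_card; exact: fsubsetDl.
  - by rewrite ler_wpM2r ?energy_ge0// gamma_mono.
have Zmom w : w \in supersets u -> moments (ps_P (rq_sp q))
    (fun om => \sum_(v <- fpowerset u) mobius_sign R u v * Y w v om)
    ((-1) ^+ #|` u| * anchor_comp s w)
    (4 ^+ beta * (B * (kap * (gamma u * energy s w)))).
  move=> ws; have [m1 m2 m3 m4] := moments_sum (fun v vu => Ymom w v ws vu).
  have mE : \sum_(v <- fpowerset u) mobius_sign R u v *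
      ((\sum_(p <- subcombo a s w v) p.1) *+ (v == fset0)) =
      (-1) ^+ #|` u| * anchor_comp s w.
    rewrite (big_fsetD1 fset0)/=; last by rewrite fpowersetE fsub0set.
    rewrite mulr1n subcombo0_sum /mobius_sign cardfs0 addn0.
    rewrite big1_fset ?addr0// => v; rewrite !inE => /andP[/negbTE -> _] _.
    by rewrite mulr0.
  rewrite mE in m3 m4; split => //; apply: le_trans m4 _.
  have c0 : 0 <= B * (kap * (gamma u * energy s w)).
    apply: mulr_ge0 => //; apply: mulr_ge0; first exact: kap_ge0.
    by apply: mulr_ge0 => //; exact: energy_ge0.
  rewrite lee_fin big_const_seq count_predT iter_addr_0 -[X in _ * X]mulr_natl mulrA.
  rewrite ler_wpM2r// -natrM -natrX ler_nat card_fpowerset -expnMn.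
  by rewrite leq_pexp2l// gamma_gt0_card.
rewrite valE; have [m1 m2 m3 m4] := moments_sum Zmom.
split => //; apply: le_trans m4 _; rewrite lee_fin.
rewrite -!mulr_sumr.
have -> : (1 + r)%:R * 4 ^+ beta * kap * (B * gamma u) *
       (\sum_(w <- supersets u) energy s w) = (1 + r)%:R * (4 ^+ beta * (B *
   (kap * (gamma u * \sum_(w <- supersets u) energy s w)))) by ring.
rewrite ler_wpM2r ?ler_nat ?card_supersets//.
apply: mulr_ge0; first exact: exprn_ge0.
apply: mulr_ge0 => //; apply: mulr_ge0; first exact: kap_ge0.
by apply: mulr_ge0 => //; apply: sumr_ge0 => w _; exact: energy_ge0.
Qed.

Definition tail (A : {fset {fset nat}}) : R :=
  abs_sum (fun w => if w \in A then 0 else gamma w * k a a ^+ #|` w|).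

Lemma gamma_hat_ge0 w : 0 <= gamma w * k a a ^+ #|` w|.
Proof. by rewrite mulr_ge0// exprn_ge0// ltW. Qed.

Lemma abs_summable_tail (A : {fset {fset nat}}) :
  abs_summable (fun w => if w \in A then 0 else gamma w * k a a ^+ #|` w|).
Proof.
apply: (@abs_summable_dom _ _ (fun w => gamma w * k a a ^+ #|` w|)).
  by move=> w; case: ifP => _; rewrite ?normr0 ?ger0_norm ?gamma_hat_ge0.
by apply: abs_summable_ge0 => // w; exact: gamma_hat_ge0.
Qed.

Lemma anchor_comp_sqr s w :
  anchor_comp s w ^+ 2 <= gamma w * k a a ^+ #|` w| * energy s w.
Proof.
have := component_sqr_le Hu s w (fun=> a).
by rewrite [kk _ _ _ _](_ : _ = k a a ^+ #|` w|)// kkE prodr_const_fset.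
Qed.

Lemma anchor_comp_gamma0 s w : gamma w = 0 -> anchor_comp s w = 0.
Proof. by rewrite /anchor_comp /component => ->; rewrite mul0r. Qed.

Lemma combo_anchor s x : abs_summable (anchor_comp s) /\
  combo K s (pt fset0 x) = abs_sum (anchor_comp s).
Proof.
have [h1 h2] := combo_comp Hu gamma_ge0 s (pt fset0 x).
have E : val (pt fset0 x) = (fun=> a) := anc0 x.
by rewrite E in h1 h2.
Qed.

(** Summed over u in A, this is the coefficient of f_w(a) in the mean of the estimator; the exact
    integral has coefficient 1 for the empty w and 0 otherwise. *)
Let cut (u w : {fset nat}) : R := if (u `<=` w)%fset then (-1) ^+ #|` u| else 0.

Let cut_sum (A : {fset {fset nat}}) w : \sum_(u <- A) cut u w =
  \sum_(u <- [fset u in A | (u `<=` w)%fset]%fset) (-1) ^+ #|` u|.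
Proof. by rewrite /cut -big_mkcond /= big_fset_condE. Qed.

(** If w is in A, all its subsets are, and their alternating sum vanishes unless w is empty.
    Otherwise at most 2^|w| signs are added. *)
Let cut_le (A : {fset {fset nat}}) w : fset0 \in A -> 0 < gamma w ->
  (forall u v : {fset nat}, (v `<=` u)%fset -> u \in A -> v \in A) ->
  (\sum_(u <- A) cut u w - (w == fset0)%:R) ^+ 2 <=
  (if w \in A then 0 else 4 ^+ beta).
Proof.
move=> A0 gw Adown; rewrite cut_sum; case: ifPn => wA.
  have -> : [fset u in A | (u `<=` w)%fset]%fset = fpowerset w.
    apply/fsetP => u; rewrite !inE /= fpowersetE andb_idl// => uw; exact: Adown uw wA.
  have [->|/fset0Pn[j jw]] := eqVneq w fset0.
    by rewrite fpowerset0 big_seq_fset1 cardfs0 expr0 subrr expr0n.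
  have := @mobius_sign_sum0 R w (fun=> 1) j jw (fun=> erefl).
  rewrite /mobius_sign; under eq_bigr do rewrite mulr1 exprD.
  rewrite -mulr_sumr => /eqP; rewrite mulf_eq0 signr_eq0 /= => /eqP ->.
  by rewrite subrr expr0n.
have w0 : w != fset0 by apply: contraNneq wA => ->.
rewrite (negbTE w0) subr0 -real_normK ?num_real//.
have -> : (4 = 2 ^+ 2 :> R) by rewrite -natrX.
rewrite -exprM mulnC exprM lerXn2r ?nnegrE ?exprn_ge0//.
apply: le_trans (ler_norm_sum _ _ _) _.
under eq_bigr do rewrite normrX normrN1 expr1n.
rewrite big_const_seq count_predT iter_addr_0 -natrX ler_nat.
apply: (@leq_trans #|` fpowerset w|).
  apply: fsubset_leq_card; apply/fsubsetP => u; rewrite !inE /= fpowersetE.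
  by move=> /andP[].
by rewrite card_fpowerset leq_pexp2l// gamma_gt0_card.
Qed.

(** Only w outside A contribute, by [cut_le]. Cauchy-Schwarz then separates the values f_w(a) into
    weighted kernel diagonals, which give the tail, and energies. *)
Lemma bias_sqr_le (A : {fset {fset nat}}) s x :
  fset0 \in A -> (forall u, u \in A -> 0 < gamma u) ->
  (forall u v : {fset nat}, (v `<=` u)%fset -> u \in A -> v \in A) ->
  (\sum_(p <- s) p.1 - (combo K s (pt fset0 x) +
     \sum_(u <- (A `\ fset0)%fset) \sum_(w <- supersets u)
        (-1) ^+ #|` u| * anchor_comp s w)) ^+ 2
  <= 4 ^+ beta * tail A * abs_sum (energy s).
Proof.
move=> A0 Apos Adown.
have [sc ->] := combo_anchor s x.
pose F u w := cut u w * anchor_comp s w.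
have FP u : u \in A -> abs_summable (F u) /\
    abs_sum (F u) = (if u == fset0 then abs_sum (anchor_comp s) else
      \sum_(w <- supersets u) (-1) ^+ #|` u| * anchor_comp s w).
  move=> uA; have [->|u0] := eqVneq u fset0.
    rewrite (_ : F fset0 = anchor_comp s)//; apply/funext => w.
    by rewrite /F /cut fsub0set cardfs0 mul1r.
  have gu := Apos _ uA.
  have [|h1 h2] := @abs_sum_fin R (F u) (supersets u).
    move=> w; rewrite mem_supersets// negb_and /F /cut.
    move=> /orP[gw|/negbTE ->]; last by rewrite mul0r.
    rewrite anchor_comp_gamma0 ?mulr0//; apply/eqP.
    by rewrite eq_le gamma_ge0 andbT leNgt.
  split=> //; rewrite h2; apply: eq_big_seq => w.
  by rewrite mem_supersets// /F /cut => /andP[_ ->].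
(* Cut off outside A, so that summability holds for every index. *)
pose F' u w := if u \in A then F u w else 0.
have sF' u : abs_summable (F' u).
  rewrite /F'; have [uA|_] := boolP (u \in A); first exact: (FP u uA).1.
  exact: (abs_sum0 R).2.
have [s1 e1] := abs_sum_sum (A : seq _) (fun=> 1) sF'.
pose dl w := (w == fset0)%:R * anchor_comp s w.
have [|s2 e2] := @abs_sum_fin R dl [fset fset0]%fset.
  by move=> w; rewrite inE /dl => /negbTE ->; rewrite mul0r.
have e3 : abs_sum dl = \sum_(p <- s) p.1.
  rewrite e2 big_seq_fset1 /dl eqxx mul1r /anchor_comp /component gamma_0 mul1r.
  by apply: eq_bigr => p _; rewrite kkE big_seq_fset0 mulr1.
have -> : \sum_(p <- s) p.1 - (abs_sum (anchor_comp s) +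
     \sum_(u <- (A `\ fset0)%fset) \sum_(w <- supersets u)
        (-1) ^+ #|` u| * anchor_comp s w) =
   abs_sum (fun w => -1 * (\sum_(u <- A) 1 * F' u w) + dl w).
  rewrite [RHS]abs_sum_lin// e3 e1 mulN1r [RHS]addrC; congr (_ - _).
  rewrite [RHS](big_fsetD1 fset0)//=; congr (_ + _).
    rewrite mul1r (_ : F' fset0 = F fset0); last by rewrite /F' A0.
    by rewrite (FP _ A0).2 eqxx.
  apply: eq_big_seq => u; rewrite !inE => /andP[u0 uA].
  rewrite mul1r (_ : F' u = F u); last by rewrite /F' uA.
  by rewrite (FP _ uA).2 (negbTE u0).
have sq : abs_summable (energy s) := (combo_energy Hu gamma_ge0 HK s).1.
have := abs_summable_lin (4 ^+ beta) (abs_summable_tail A) (abs_sum0 R).2.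
move=> sp; have -> : 4 ^+ beta * tail A = abs_sum (fun w => 4 ^+ beta *
    (if w \in A then 0 else gamma w * k a a ^+ #|` w|) + 0).
  rewrite abs_sum_lin ?(abs_sum0 R).1 ?addr0//; first exact: abs_summable_tail.
  exact: (abs_sum0 R).2.
apply: abs_sum_sqr_le => //.
- move=> w; rewrite addr0 mulr_ge0 ?exprn_ge0//.
  by case: ifP => // _; exact: gamma_hat_ge0.
- by move=> w; exact: energy_ge0.
- move=> w; rewrite addr0.
  have -> : -1 * (\sum_(u <- A) 1 * F' u w) + dl w =
      - (\sum_(u <- A) cut u w - (w == fset0)%:R) * anchor_comp s w.
    rewrite (eq_big_seq (fun u => cut u w * anchor_comp s w)).
      by rewrite -mulr_suml /dl; ring.
    by move=> u uA; rewrite /F' uA mul1r.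
  rewrite exprMn sqrrN.
  have [gw|gw] := ltP 0 (gamma w); last first.
    rewrite anchor_comp_gamma0 ?expr0n ?mulr0.
      rewrite mulr_ge0 ?energy_ge0// mulr_ge0// ?exprn_ge0//.
      by case: ifP => // _; exact: gamma_hat_ge0.
    by apply/eqP; rewrite eq_le gw gamma_ge0.
  apply: le_trans (ler_pM (sqr_ge0 _) (sqr_ge0 _) (cut_le A0 gw Adown)
     (anchor_comp_sqr s w)) _.
  by case: ifP => _; rewrite ?mul0r ?mulr0 ?mul0r// !mulrA.
- exact: abs_summable_lin.
Qed.

Definition error_const : R := (1 + r)%:R * 4 ^+ beta * kap.

Lemma error_const_ge0 : 0 <= error_const.
Proof. by apply: mulr_ge0; [exact: mulr_ge0|exact: kap_ge0]. Qed.

(** After exchanging the sums, [energy s w] is counted once for each subset of w in A, hence at most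
    2^beta times. *)
Lemma supersets_energy_le (A : {fset {fset nat}}) s :
  (forall u, u \in A -> u != fset0 /\ 0 < gamma u) ->
  \sum_(u <- A) \sum_(w <- supersets u) energy s w <=
  2 ^+ beta * abs_sum (energy s).
Proof.
move=> AP; have sq : abs_summable (energy s) := (combo_energy Hu gamma_ge0 HK s).1.
pose F u w := if (u \in A) && (u `<=` w)%fset then energy s w else 0.
have sF u : abs_summable (F u).
  apply: (@abs_summable_dom _ _ (energy s)) => // w; rewrite /F.
  case: ifP => _; first by rewrite ger0_norm// energy_ge0.
  by rewrite normr0 energy_ge0.
have [s1 e1] := abs_sum_sum (A : seq _) (fun=> 1) sF.
have -> : \sum_(u <- A) \sum_(w <- supersets u) energy s w =
    abs_sum (fun w => \sum_(u <- A) 1 * F u w).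
  rewrite e1; apply: eq_big_seq => u uA; rewrite mul1r.
  have [u0 gu] := AP _ uA.
  have [|_ ->] := @abs_sum_fin R (F u) (supersets u).
    move=> w; rewrite mem_supersets// negb_and /F => /orP[gw|/negbTE ->]; last by rewrite andbF.
    rewrite /energy (_ : gamma w = 0) ?mul0r ?if_same//; apply/eqP.
    by rewrite eq_le gamma_ge0 andbT leNgt.
  apply: eq_big_seq => w; rewrite mem_supersets// /F => /andP[_ ->].
  by rewrite uA.
have s0 := (abs_sum0 R).2.
have -> : 2 ^+ beta * abs_sum (energy s) = abs_sum (fun w => 2 ^+ beta * energy s w + 0).
  by rewrite abs_sum_lin// (abs_sum0 R).1 addr0.
apply: ler_abs_sum => //; first exact: abs_summable_lin.
move=> w; rewrite addr0.
have [gw|gw] := ltP 0 (gamma w); last first.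
  have g0 : gamma w = 0 by apply/eqP; rewrite eq_le gw gamma_ge0.
  rewrite big1; first by apply: mulr_ge0; [exact: exprn_ge0|exact: energy_ge0].
  by move=> u _; rewrite /F /energy g0 mul0r if_same mulr0.
apply: (@le_trans _ _ (\sum_(u <- A) (if (u `<=` w)%fset then energy s w else 0))).
  rewrite big_seq [leRHS]big_seq; apply: ler_sum => u uA; by rewrite mul1r /F uA.
rewrite -big_mkcond /= big_fset_condE big_const_seq count_predT iter_addr_0.
rewrite -[leLHS]mulr_natl ler_wpM2r ?energy_ge0// -natrX ler_nat.
apply: (@leq_trans #|` fpowerset w|).
  apply: fsubset_leq_card; apply/fsubsetP => u; rewrite !inE /= fpowersetE.
  by move=> /andP[].
by rewrite card_fpowerset leq_pexp2l// gamma_gt0_card.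
Qed.

Section estimator.
Variables (A : {fset {fset nat}}) (qs : {fset nat} -> rquad)
  (ns : {fset nat} -> nat) (Bs : {fset nat} -> R) (ep : R).
Hypothesis ep0 : 0 <= ep.
Hypothesis A0 : fset0 \in A.
Hypothesis Apos : forall u, u \in A -> 0 < gamma u.
Hypothesis Adown : forall u v : {fset nat}, (v `<=` u)%fset -> u \in A -> v \in A.
Hypothesis qsP : forall u, u \in A -> u != fset0 ->
  [/\ 0 <= Bs u, good_rquad (qs u) u (ns u) (Bs u) & Bs u * gamma u <= ep].
Variables (Om : pspace R) (pi : forall u, ps_T Om -> ps_T (rq_sp (qs u))).
Hypothesis pi_sum : forall (Y : forall i, ps_T (rq_sp (qs i)) -> R) (V : {fset nat} -> R),
  (forall i, i \in (A `\ fset0)%fset -> [/\ measurable_fun setT (Y i),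
     (ps_P (rq_sp (qs i))).-integrable setT (EFin \o Y i),
     (\int[ps_P (rq_sp (qs i))]_x (Y i x)%:E = 0)%E &
     (\int[ps_P (rq_sp (qs i))]_x (Y i x ^+ 2)%:E <= (V i)%:E)%E]) ->
  measurable_fun setT (fun w => \sum_(i <- (A `\ fset0)%fset) Y i (pi i w)) /\
  (\int[ps_P Om]_w ((\sum_(i <- (A `\ fset0)%fset) Y i (pi i w)) ^+ 2)%:E <=
    (\sum_(i <- (A `\ fset0)%fset) V i)%:E)%E.

Definition estimator (f : X -> R) (w : ps_T Om) : R :=
  f (pt fset0 (fun=> a)) + \sum_(u <- (A `\ fset0)%fset)
    rq_val (q := qs u) (ns u) (mob f u) (pi u w).

(** The factors 2 come from (x + y)^2 <= 2 x^2 + 2 y^2, which separates the bias from the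
    fluctuation. *)
Definition sqr_error_const : R :=
  2 * (4 ^+ beta * tail A) + 2 * (error_const * ep * 2 ^+ beta).

Lemma estimator_combo s :
  measurable_fun setT (estimator (combo K s)) /\
  (\int[ps_P Om]_w ((\sum_(p <- s) p.1 - estimator (combo K s) w) ^+ 2)%:E <=
   (sqr_error_const * abs_sum (energy s))%:E)%E.
Proof.
pose m u := \sum_(w <- supersets u) (-1) ^+ #|` u| * anchor_comp s w.
pose Y u w := rq_val (q := qs u) (ns u) (mob (combo K s) u) w - m u.
pose V u := error_const * (Bs u * gamma u) * \sum_(w <- supersets u) energy s w.
have AP u : u \in (A `\ fset0)%fset -> u != fset0 /\ 0 < gamma u.
  by rewrite !inE => /andP[u0 uA]; split => //; exact: Apos.
have [|mY VY] := pi_sum (Y := Y) (V := V).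
  move=> u uA; have [u0 gu] := AP _ uA; move: uA; rewrite !inE => /andP[_ uA].
  have [B0 gq _] := qsP uA u0.
  have [m1 m2 m3 m4] := mob_moments s B0 u0 gu gq.
  split.
  - exact: measurable_funB.
  - rewrite (_ : _ \o _ = (fun w =>
      (rq_val (q := qs u) (ns u) (mob (combo K s) u) w)%:E - (m u)%:E)%E)//.
    by apply: integrableB => //; exact: finite_measure_integrable_cst.
  - under eq_integral do rewrite /Y EFinB.
    rewrite integralB//; last exact: finite_measure_integrable_cst.
    rewrite m3 integral_cst// [X in ((m u)%:E * X)%E](_ : _ = 1%E); last exact: probability_setT.
    by rewrite mule1 subee.
  - exact: m4.
have [bE ->] : let b := \sum_(p <- s) p.1 - (combo K s (pt fset0 (fun=> a)) +
     \sum_(u <- (A `\ fset0)%fset) m u) in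
   b ^+ 2 <= 4 ^+ beta * tail A * abs_sum (energy s) /\
   estimator (combo K s) = (fun w => (\sum_(p <- s) p.1 - b) +
      \sum_(u <- (A `\ fset0)%fset) Y u (pi u w)).
  split; first exact: bias_sqr_le.
  apply/funext => w; rewrite /estimator /Y sumrB.
  by set t1 := \sum_(u <- _) rq_val _ _ _; ring.
move: bE; set b := _ - (_ + _) => bE.
split; first exact: measurable_funD.
set S := fun w => \sum_(u <- (A `\ fset0)%fset) Y u (pi u w).
apply: (@le_trans _ _ (\int[ps_P Om]_w ((2 * b ^+ 2)%:E + 2%:E * (S w ^+ 2)%:E))%E).
  apply: ge0_le_integral => //.
  - by move=> w _; rewrite lee_fin sqr_ge0.
  - apply/measurable_EFinP; apply: measurable_funX; apply: measurable_funB => //.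
    exact: measurable_funD.
  - apply/measurable_EFinP; apply: measurable_funD => //; apply: measurable_funM => //.
    exact: measurable_funX.
  - move=> w _; rewrite -EFinM -EFinD lee_fin /S.
    set t := \sum_(i <- (A `\ fset0)%fset) _.
    by have := sqr_ge0 (b + t); lra.
rewrite ge0_integralD//; last 3 first.
- by move=> w _; rewrite lee_fin mulr_ge0// sqr_ge0.
- by move=> w _; rewrite -EFinM lee_fin mulr_ge0// sqr_ge0.
- apply/measurable_EFinP; apply: measurable_funM => //; exact: measurable_funX.
rewrite integral_cst// [X in ((2 * b ^+ 2)%:E * X)%E](_ : _ = 1%E); last exact: probability_setT.
rewrite mule1 ge0_integralZl//; last 2 first.
- by apply/measurable_EFinP; exact: measurable_funX.
- by move=> w _; rewrite lee_fin sqr_ge0.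
have VS : \sum_(u <- (A `\ fset0)%fset) V u <=
    error_const * ep * (2 ^+ beta * abs_sum (energy s)).
  apply: (@le_trans _ _ (\sum_(u <- (A `\ fset0)%fset)
     error_const * ep * \sum_(w <- supersets u) energy s w)).
    rewrite big_seq [leRHS]big_seq; apply: ler_sum => u; rewrite !inE => /andP[u0 uA].
    have [_ _ le_ep] := qsP uA u0.
    rewrite /V ler_wpM2r//; first by apply: sumr_ge0 => w _; exact: energy_ge0.
    by rewrite ler_wpM2l// error_const_ge0.
  rewrite -mulr_sumr ler_wpM2l//; last exact: supersets_energy_le.
  by rewrite mulr_ge0// error_const_ge0.
apply: (@le_trans _ _ ((2 * b ^+ 2)%:E + 2%:E * (\sum_(u <- (A `\ fset0)%fset) V u)%:E)%E).
  by rewrite leeD2l// lee_wpmul2l.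
rewrite -EFinM -EFinD lee_fin /sqr_error_const; lra.
Qed.

Lemma Iop_combo s : Iop k gamma mu (combo K s) = \sum_(p <- s) p.1.
Proof.
elim: s => [|p s ih].
  rewrite big_nil (_ : combo K [::] = fun x => 0 * 0 + 0).
    have H0 := rkhs0 HK.
    have := Iop_lin Hk Hu k_meas M_fin mu_product gamma_ge0 gamma_sum (-1) H0 H0.
    rewrite (_ : (fun x => _) = fun=> 0); last by apply/funext => x; rewrite mulr0 addr0.
    by rewrite mulN1r addNr (_ : (fun=> 0 * 0 + 0) = fun=> 0)// mulr0 addr0.
  by apply/funext => x; rewrite /combo big_nil mulr0 addr0.
have -> : combo K (p :: s) = (fun x => p.1 * K x p.2 + combo K s x).
  by apply/funext => x; rewrite /combo big_cons.
rewrite (Iop_lin Hk Hu k_meas M_fin mu_product gamma_ge0 gamma_sum p.1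
  (rkhs_section HK _) (rkhs_combo HK _)) ih big_cons.
by rewrite (Iop_section Hk Hu k_meas M_fin k_int0 mu_product gamma_ge0 gamma_0 gamma_sum) mulr1.
Qed.

(** Along the approximants the error converges for every random outcome, since the estimator uses
    finitely many values of f and I is bounded. Their squared norms are at most 2 |f|^2 + 2, which
    is where the last factor comes from. *)
Lemma estimator_rkhs f : HK f ->
  measurable_fun setT (fun w => Iop k gamma mu f - estimator f w) /\
  (\int[ps_P Om]_w ((Iop k gamma mu f - estimator f w) ^+ 2)%:E <=
   (sqr_error_const * (2 * rkhs_ip HK f f + 2))%:E)%E.
Proof.
move=> Hf; have [s [sn sc]] := rkhs_approx Hf.
have C0 : 0 <= sqr_error_const.
  rewrite /sqr_error_const addr_ge0// mulr_ge0//.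
    rewrite mulr_ge0 ?exprn_ge0// -(abs_sum0 R).1.
    apply: ler_abs_sum; [exact: (abs_sum0 R).2|exact: abs_summable_tail|].
    by move=> w; case: ifP => // _; exact: gamma_hat_ge0.
  by rewrite mulr_ge0 ?exprn_ge0// mulr_ge0// error_const_ge0.
have Hc n : HK (combo K (s n)) by exact: rkhs_combo.
apply: (@fatou_le _ _ _ _ (fun n w => \sum_(p <- s n) p.1 - estimator (combo K (s n)) w)).
- by move=> n; apply: measurable_funB => //; have [] := estimator_combo (s n).
- move=> w; apply: cvgB.
    have [B B0 BP] := Iop_bound Hk Hu k_meas M_fin mu_product gamma_ge0 gamma_sum HK.
    apply/cvgrPdist_lt => e e0.
    have e2 : 0 < e ^+ 2 / (B + 1) by rewrite divr_gt0 ?exprn_gt0// ltr_wpDl.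
    have /= [N _ NP] := near_infty_natSinv_lt (PosNum e2).
    exists N => // n Nn /=; rewrite -Iop_combo.
    have := BP _ (rkhs_lin (-1) (Hc n) Hf).
    rewrite (Iop_lin Hk Hu k_meas M_fin mu_product gamma_ge0 gamma_sum (-1) (Hc n) Hf).
    rewrite mulN1r addrC => le1.
    rewrite -ltr_sqr ?nnegrE// ?ltW// real_normK ?num_real//.
    apply: le_lt_trans le1 _.
    rewrite (_ : (fun x => _) = (fun x => f x - combo K (s n) x)); last first.
      by apply/funext => x; rewrite mulN1r addrC.
    have := le_lt_trans (sn n) (NP n Nn); rewrite /= ltr_pdivlMr; last by rewrite ltr_wpDl.
    have := rkhs_ip_ge0 (rkhsB Hf (Hc n)).
    by set b := rkhs_ip _ _ _; lra.
  apply: cvgD; first exact: sc.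
  apply: cvg_sum_seq => u; rewrite /rq_val; apply: cvg_sum_seq => i.
  apply: cvgMr; rewrite /mob; apply: cvg_sum_seq => v; apply: cvgMr; exact: sc.
- move=> n; apply: le_trans (estimator_combo (s n)).2 _.
  rewrite lee_fin ler_wpM2l//.
  rewrite -(combo_energy Hu gamma_ge0 HK (s n)).2.
  have := rkhs_triangle_sq (Hc n) Hf (rkhs0 HK).
  rewrite (_ : (fun x => combo K (s n) x - 0) = combo K (s n)); last first.
    by apply/funext => x; rewrite subr0.
  rewrite (_ : (fun x => f x - 0) = f); last by apply/funext => x; rewrite subr0.
  move=> /le_trans; apply.
  have := sn n; rewrite !rkhs_ip_sub_sq// (rkhs_ipC (Hc n) Hf).
  have : n.+1%:R^-1 <= 1 :> R by rewrite invf_le1 ?ler1n.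
  by set b := n.+1%:R^-1; lra.
Qed.

End estimator.

End algorithm.

(** * Quadratures and algorithms *)

Section log_factor.
Context (R : realType).

Lemma ln_le_powR (x th : R) : 1 <= x -> 0 < th -> 1 + ln x <= (1 + th^-1) * x `^ th.
Proof.
move=> x1 th0; have x0 : 0 < x by exact: lt_le_trans x1.
have p1 : 1 <= x `^ th by rewrite -[leLHS](powRr0 x) ler_powR// ltW.
have : ln (x `^ th) <= x `^ th.
  have := @le_ln1Dx R (x `^ th - 1).
  have -> : 1 + (x `^ th - 1) = x `^ th by ring.
  move=> h.
  have : - 1 < x `^ th - 1 by rewrite ltrBrDl subrr powR_gt0.
  by move=> /h; lra.
rewrite ln_powR => h.
have : ln x <= th^-1 * x `^ th by rewrite mulrC ler_pdivlMr// mulrC.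
by rewrite mulrDl mul1r; lra.
Qed.

(** The + 1 keeps the exponent positive even for al1 = 0, because [log_factor_bound] divides by
    it. *)
Lemma Ffactor_le (al1 al2 : R) (b m n : nat) : 0 <= al1 -> 0 <= al2 <= 1 ->
  (m <= b)%N -> Ffactor al1 al2 m n <= (1 + ln n.+1%:R) `^ (al1 * b%:R + 1).
Proof.
move=> a10 /andP[a20 a21] mb; rewrite /Ffactor.
have l0 : 0 <= ln n.+1%:R :> R by rewrite ln_ge0// ler1n.
have l1 : 1 <= 1 + ln n.+1%:R :> R by rewrite lerDl.
have e0 : 0 <= al1 * b%:R + 1 by rewrite addr_ge0// mulr_ge0.
case: ifPn => [_|]; first by rewrite -[leLHS](powRr0 (1 + ln n.+1%:R)) ler_powR.
rewrite -ltnNge => m2.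
have m1 : 1 <= m.-1%:R :> R by rewrite ler1n -ltnS prednK// (ltn_trans _ m2).
have p1 : 1 <= m.-1%:R `^ al2 by rewrite -[leLHS](powRr0 m.-1%:R) ler_powR.
have pb : m.-1%:R `^ al2 <= b%:R.
  apply: (@le_trans _ _ m.-1%:R).
    by rewrite -[leRHS]powRr1 ?ler_powR// (le_trans _ m1).
  by rewrite ler_nat (leq_trans (leq_pred m)).
apply: (@le_trans _ _ ((1 + ln n.+1%:R) `^ (al1 * m.-1%:R `^ al2))).
  apply: ge0_ler_powR; rewrite ?nnegrE.
  - by rewrite mulr_ge0// (le_trans _ p1).
  - by rewrite addr_ge0// divr_ge0// (le_trans _ p1).
  - exact: le_trans l1.
  - by rewrite lerD2l ler_pdivrMr ?(lt_le_trans _ p1)// ler_peMr.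
rewrite ler_powR//; apply: ler_wpDr => //; exact: ler_wpM2l.
Qed.

(** With all sizes at most b, the factor is bounded by a fixed power e of 1 + ln(n+1). The choice th
    = (tau - q) / e makes it cost exactly the power tau - q of n+1. *)
Lemma log_factor_bound (c C al1 al2 tau q : R) (b : nat) :
  0 < c -> 0 < C -> 0 <= al1 -> 0 <= al2 <= 1 -> q < tau ->
  exists2 B0 : R, 0 <= B0 & forall l m n : nat, (l <= b)%N -> (m <= b)%N ->
    c * C ^+ l * n.+1%:R `^ (- tau) * Ffactor al1 al2 m n <= B0 * n.+1%:R `^ (- q).
Proof.
move=> c0 C0 a10 a2 qtau.
pose e := al1 * b%:R + 1.
have e0 : 0 < e by rewrite ltr_wpDl// mulr_ge0.
pose th := (tau - q) / e.
have th0 : 0 < th by rewrite divr_gt0// subr_gt0.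
pose D := (1 + th^-1) `^ e.
exists (c * (1 + C) ^+ b * D).
  by rewrite !mulr_ge0 ?powR_ge0 ?exprn_ge0 ?ltW// addr_gt0.
move=> l m n lb mb.
have n1 : 1 <= n.+1%:R :> R by rewrite ler1n.
have FD : Ffactor al1 al2 m n <= D * n.+1%:R `^ (tau - q).
  apply: le_trans (Ffactor_le _ a10 a2 mb) _; rewrite -/e.
  apply: (@le_trans _ _ (((1 + th^-1) * n.+1%:R `^ th) `^ e)).
    have l0 : 0 <= 1 + ln n.+1%:R :> R by rewrite addr_ge0// ln_ge0.
    apply: ge0_ler_powR; rewrite ?nnegrE.
    - exact: ltW.
    - exact: l0.
    - by rewrite mulr_ge0 ?powR_ge0// addr_ge0// invr_ge0 ltW.
    - exact: ln_le_powR.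
  rewrite powRM ?powR_ge0//; last by rewrite addr_ge0// invr_ge0 ltW.
  by rewrite -powRrM /th divfK ?gt_eqF.
have Cl : C ^+ l <= (1 + C) ^+ b.
  apply: (@le_trans _ _ ((1 + C) ^+ l)).
    by apply: lerXn2r; rewrite ?nnegrE ?addr_ge0 ?ltW// ltrDr.
  by apply: ler_weXn2l => //; rewrite lerDl ltW.
have -> : c * (1 + C) ^+ b * D * n.+1%:R `^ (- q) =
   c * (1 + C) ^+ b * n.+1%:R `^ (- tau) * (D * n.+1%:R `^ (tau - q)).
  have -> : n.+1%:R `^ (- q) = n.+1%:R `^ (- tau) * n.+1%:R `^ (tau - q).
    by rewrite -powRD ?pnatr_eq0 ?implybT//; congr (_ `^ _); ring.
  ring.
apply: ler_pM => //.
- by rewrite !mulr_ge0 ?powR_ge0 ?exprn_ge0// ltW.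
- by rewrite /Ffactor; case: ifP => // _; rewrite powR_ge0.
- by rewrite ler_wpM2r ?powR_ge0// ler_wpM2l// ltW.
Qed.

End log_factor.

(** * Quadratures lifted to the sequence space *)

Section quadrature_to_rquad.
Context d (T : measurableType d) (R : realType) (rho : probability T R).
Variable rhou : forall u : {fset nat}, probability (power u T) R.
Hypothesis rhou_product : forall u : {fset nat}, is_product rho (rhou u).
Variable k : T -> T -> R.
Hypothesis Hk : rkhs k.
Variable Hu : forall u : {fset nat}, rkhs (kprod k u).
Hypothesis k_meas : measurable_fun setT (fun z : T * T => k z.1 z.2).
Hypothesis M_fin : (\int[rho]_x (k x x)%:E < +oo)%E.
Hypothesis k_int0 : forall y, (\int[rho]_x (k x y)%:E = 0)%E.
Variable a : T.

(** Coordinates outside u are set to a; they are invisible to functions of x_v with v included in u.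
    Indices beyond n carry weight 0. *)
Definition quad_rquad (u : {fset nat}) (n : nat) (Q : quadrature rho u n) : rquad T R :=
  @Rquad _ T R (Pspace (qd_Pu Q))
    (fun i => if insub i is Some i' then qd_t Q i' else 0)
    (fun i om j => match (insub i : option 'I_n), (insub j : option u) with
       | Some i', Some j' => qd_pt Q i' j' (om j')
       | _, _ => a
       end).

Lemma fincl_inj (u v : {fset nat}) (vu : (v `<=` u)%fset) : injective (fincl vu).
Proof. by move=> i j /(congr1 val) /= ij; apply: val_inj. Qed.

Lemma good_quad_rquad (u : {fset nat}) n (Q : quadrature rho u n) (B : R) :
  (forall f : power u T -> R, f \in Lfun (rhou u) 2%:E ->
         'E_(qd_Pu Q)[qd_val Q f] = 'E_(rhou u)[f])%E ->
  (forall (v : {fset nat}) (vu : (v `<=` u)%fset) (s : seq (R * power v T)),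
    'V_(qd_Pu Q)[qd_val Q (fun x => combo (kprod k v) s (restr2 vu x))] <=
    (B * rkhs_ip (Hu v) (combo (kprod k v) s) (combo (kprod k v) s))%:E)%E ->
  good_rquad Hu (quad_rquad Q) u n B.
Proof.
move=> EQ VQ v vu s.
pose f (x : power u T) := combo (kprod k v) s (restr2 vu x).
have inj := @fincl_inj _ _ vu.
have fL2 : f \in Lfun (rhou u) 2%:E.
  exact: (Lfun2_kcombo Hk Hu k_meas M_fin (@rhou_product u) inj s).
have mf : measurable_fun setT f := measurable_kcombo k_meas (fincl vu) s.
have -> : rq_val (q := quad_rquad Q) n (fun x => combo (kprod k v) s (restr v x)) =
    qd_val Q f.
  apply/funext => om; rewrite /rq_val /qd_val.
  rewrite -[X in iota 0 X]subn0 big_mkord; apply: eq_bigr => i _ /=.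
  rewrite valK; congr (_ * _); rewrite /f; congr (combo _ _ _).
  apply/funext => j; rewrite /restr /restr2.
  have jE : insub (val j) = Some (fincl vu j) :> option u.
    by rewrite -[RHS]valK; congr insub.
  by rewrite jE.
have mq : measurable_fun setT (qd_val Q f).
  rewrite /qd_val; apply: measurable_sum => i; apply: measurable_funM => //.
  apply: (measurableT_comp mf); apply: measurable_power => j.
  by apply: measurableT_comp => //; exact: measurable_coord.
have EE : ('E_(qd_Pu Q)[qd_val Q f] = ((\sum_(p <- s) p.1) *+ (v == fset0))%:E)%E.
  rewrite EQ// unlock.
  exact: (integral_kcombo Hk Hu k_meas M_fin k_int0 (@rhou_product u) inj s).
have [iX VX] := variance_center mq EE (VQ v vu s).
by split => //; move: EE; rewrite unlock.
Qed.

Lemma good_rquad_exists (gamma : {fset nat} -> R) (tau q : R) (b : nat) :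
  (forall u v : {fset nat}, (u `<=` v)%fset -> 0 < gamma v -> 0 < gamma u) ->
  (forall u, 0 < gamma u -> (#|` u| <= b)%N) ->
  quadrature_assumption rho rhou gamma Hu tau -> q < tau ->
  exists2 B0 : R, 0 <= B0 & forall u n, u != fset0 -> 0 < gamma u -> (0 < n)%N ->
    exists Q : rquad T R, good_rquad Hu Q u n (B0 * n.+1%:R `^ (- q)).
Proof.
move=> gcl gb [tau0 [c [C [al1 [al2 [[c0 C0 a10 a2] HQ]]]]]] qtau.
have [B0 B00 B0P] := log_factor_bound b c0 C0 a10 a2 qtau.
exists B0 => // u n u0 gu n0.
have [Q [EQ VQ]] := HQ u u0 gu n n0.
exists (quad_rquad Q); apply: good_quad_rquad => // v vu s.
have gv := gcl _ _ vu gu.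
apply: le_trans (VQ v vu gv _ (rkhs_combo (Hu v) s)) _.
rewrite lee_fin /rkhs_norm sqr_sqrtr; last exact/rkhs_ip_ge0/rkhs_combo.
rewrite ler_wpM2r//; first exact/rkhs_ip_ge0/rkhs_combo.
by apply: B0P; exact: gb.
Qed.

End quadrature_to_rquad.

(** * Nonadaptive algorithms with exact cost *)

Section nonadaptive.
Context d (T : measurableType d) (R : realType).
Variables (dollar : nat -> \bar R) (a : T) (X : set (power nat T)).
Variable H : set (X -> R).

(* Sample points are indexed by slots s, listed in sl; the s-th point lies in
   the anchored set of vs s and has exactly the cost of vs s. *)
Lemma nonadaptive_alg (S : eqType) (sl : seq S) (Om : pspace R)
    (pts : S -> ps_T Om -> X) (vs : S -> {fset nat})
    (out : ps_T Om -> (S -> R) -> R) (dl : nat -> R) :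
  (forall n, dollar n = (dl n)%:E) ->
  (forall f, H f -> (fun w => out w (fun s => if s \in sl then f (pts s w) else 0))
     \in Lfun (ps_P Om) 2%:E) ->
  (forall s w, anchored a (vs s) (val (pts s w))) ->
  (forall s w, eval_cost dollar a (val (pts s w)) = dollar #|` vs s|) ->
  exists Q : rand_alg (fun x : X => eval_cost dollar a (val x)) H,
    [/\ Ares Q,
        (forall f, H f -> mean_cost Q f = (\sum_(s <- sl) dl #|` vs s|)%:E) &
        forall f c, H f -> ('E_(ra_P Q)[fun w => ((c - ra_val Q f w) ^+ 2)%R] =
          \int[ps_P Om]_w ((c - out w (fun s => if s \in sl then f (pts s w) else 0))
              ^+ 2)%:E)%E].
Proof.
move=> dlE L2 anch costs.
pose ptl (f : X -> R) w := [seq pts s w | s <- sl].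
(* The number of values seen so far alone selects the next point. *)
pose next w (vals : seq R) := onth [seq pts s w | s <- sl] (size vals).
(* For s outside sl the index equals the length of [vals], so the default 0 is read. *)
pose ou w (vals : seq R) := out w (fun s => nth 0 vals (index s sl)).
have ptE f w : H f -> forall i, (i <= size (ptl f w))%N ->
    next w [seq f x | x <- take i (ptl f w)] = onth (ptl f w) i.
  by move=> _ i isz; rewrite /next size_map size_takel.
have ouE f w : ou w [seq f x | x <- ptl f w] =
    out w (fun s => if s \in sl then f (pts s w) else 0).
  rewrite /ou; congr (out w _); apply/funext => s; rewrite /ptl -map_comp.
  case: ifPn => ssl; last by rewrite nth_default// size_map leqNgt index_mem.
  by rewrite (nth_map s) ?index_mem//= nth_index.
have costE f w : (\sum_(x <- ptl f w) eval_cost dollar a (val x) =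
    (\sum_(s <- sl) dl #|` vs s|)%:E)%E.
  by rewrite big_map -sumEFin; apply: eq_bigr => s _; rewrite costs dlE.
have vL2 f : H f -> (fun w => ou w [seq f x | x <- ptl f w]) \in Lfun (ps_P Om) 2%:E.
  move=> Hf; rewrite (_ : (fun w => _) =
    (fun w => out w (fun s => if s \in sl then f (pts s w) else 0))); first exact: L2.
  by apply/funext => w; rewrite ouE.
have mcost f : H f -> measurable_fun setT
    (fun w => \sum_(x <- ptl f w) eval_cost dollar a (val x))%E.
  move=> _; rewrite (_ : (fun w => _) = cst (\sum_(s <- sl) dl #|` vs s|)%:E).
    exact: measurable_cst.
  by apply/funext => w; rewrite costE.
pose Q := @RandAlg R X (fun x : X => eval_cost dollar a (val x)) H _ _ (ps_P Om)
  next ou ptl ptE vL2 mcost.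
have mQ f : H f -> mean_cost Q f = (\sum_(s <- sl) dl #|` vs s|)%:E.
  move=> Hf; rewrite /mean_cost.
  under eq_integral => w _ do rewrite /ra_cost costE.
  by rewrite integral_cst// [X in (_ * X)%E](_ : _ = 1%E) ?mule1//; exact: probability_setT.
exists Q; split => //.
  exists [seq vs s | s <- sl]; split; last first.
    move=> f Hf; rewrite mQ// big_map -sumEFin; apply: eq_bigr => s _.
    by rewrite dlE.
  move=> f Hf w; rewrite /= /ptl !size_map; split => //.
  elim: (sl) => //= s l ->; rewrite andbT; apply/asboolP; exact: anch.
move=> f c Hf; rewrite unlock; apply: eq_integral => w _.
by rewrite /ra_val /= ouE.
Qed.

End nonadaptive.

(** * The changing dimension algorithm *)

Section changing_dimension.
Context d (T : measurableType d) (R : realType) (rho : probability T R).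
Variable k : T -> T -> R.
Hypothesis Hk : rkhs k.
Variable Hu : forall u : {fset nat}, rkhs (kprod k u).
Hypothesis k_meas : measurable_fun setT (fun z : T * T => k z.1 z.2).
Hypothesis M_fin : (\int[rho]_x (k x x)%:E < +oo)%E.
Hypothesis k_int0 : forall y, (\int[rho]_x (k x y)%:E = 0)%E.
Hypothesis k_pos : forall x, 0 < k x x.
Context (mu : probability (power nat T) R) (mu_product : is_product rho mu).
Variable gamma : {fset nat} -> R.
Hypothesis gamma_ge0 : forall u, 0 <= gamma u.
Hypothesis gamma_0 : gamma fset0 = 1.
Hypothesis gamma_sum : (\esum_(u in [set: {fset nat}])
  (gamma u * Mk rho k ^+ #|` u|)%:E < +oo)%E.
Variable a : T.
Hypothesis a_anchor : (\esum_(u in [set: {fset nat}])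
  (gamma u * k a a ^+ #|` u|)%:E < +oo)%E.
Variable HK : rkhs (Kker k gamma).
Hypothesis gamma_mono : forall u v : {fset nat}, (u `<=` v)%fset -> gamma v <= gamma u.
Variables beta r : nat.
Hypothesis gamma_order : forall u : {fset nat}, (beta < #|` u|)%N -> gamma u = 0.
Hypothesis gamma_inter : forall u : {fset nat}, 0 < gamma u ->
  ([set v : {fset nat} | 0 < gamma v /\ (u `&` v)%fset != fset0] #<= `I_(1 + r)%N)%card.
Variables (dollar : nat -> \bar R) (dl : nat -> R).
Hypothesis dlE : forall n, dollar n = (dl n)%:E.
Hypothesis dl_mono : forall m n, (m <= n)%N -> dl m <= dl n.
Hypothesis dl_ge1 : forall n, 1 <= dl n.

Local Notation X := (Xset k gamma).
Local Notation K := (Kker k gamma).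
Local Notation pt := (pt k_pos gamma_ge0 a_anchor).
Local Notation mob := (mob k_pos gamma_ge0 a_anchor).

(** If a were the only point, the mean of k(., a) would be k(a,a) > 0. *)
Lemma nonanchor_ex : exists b : T, b != a.
Proof.
apply: contrapT => /forallNP h.
have all_a x : x = a by apply/eqP; apply/negP => /negP; exact: h.
have := k_int0 a; rewrite (_ : (fun x => _) = cst (k a a)%:E); last first.
  by apply/funext => x; rewrite (all_a x).
rewrite integral_cst// [X in (_ * X)%E](_ : _ = 1%E); last exact: probability_setT.
by rewrite mule1 => -[] h0; have := k_pos a; rewrite h0 ltxx.
Qed.

Definition free_coords (v : {fset nat}) (x : power nat T) : {fset nat} :=
  [fset j in v | x j != a]%fset.

(* rho may have an atom at the anchor, and then a random point of the anchored
   set of v can be cheaper than v. Since costs have to be exact, such a point is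
   replaced by the constant point b; the value at the original point is read off
   the slot of its free coordinates instead. *)
Definition dummy (b : T) (v : {fset nat}) (x : power nat T) : power nat T :=
  if free_coords v x == v then x else (fun=> b).

Lemma anc_free_coords v x : anc a (free_coords v x) x = anc a v x.
Proof.
apply/funext => j; rewrite /anc !inE /=.
by case: (j \in v) => //=; case: eqVneq.
Qed.

(** Coordinates of v that already equal a may be anchored without changing the point, and x itself
    is kept in the slot of its free coordinates. *)
Lemma pt_free_coords b v x :
  pt (free_coords v x) (dummy b (free_coords v x) x) = pt v x.
Proof.
apply: val_inj; rewrite /= /dummy.
have -> : free_coords (free_coords v x) x = free_coords v x.
  by apply/fsetP => j; rewrite !inE /=; case: (j \in v) => //=; case: (x j != a).
by rewrite eqxx anc_free_coords.
Qed.

(** No coordinate in v equals a, so every anchored set containing the point belongs to a superset of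
    v. *)
Lemma eval_cost_dummy b v x : b != a ->
  eval_cost dollar a (anc a v (dummy b v x)) = dollar #|` v|.
Proof.
move=> ba; have na j : j \in v -> dummy b v x j != a.
  rewrite /dummy; have [fe|//] := eqVneq (free_coords v x) v.
  by rewrite -{1}fe !inE => /andP[].
rewrite /eval_cost; apply/eqP; rewrite eq_le; apply/andP; split.
  by apply: ereal_inf_lbound; exists v => //; exact: anc_anchored.
apply: le_ereal_inf_tmp => _ [u uanch <-].
rewrite !dlE lee_fin; apply: dl_mono; apply: fsubset_leq_card.
apply/fsubsetP => j jv; apply/negPn/negP => ju; have := uanch j ju.
by rewrite /anc jv => /eqP; apply/negP; exact: na.
Qed.

Lemma changing_dimension_alg (A : {fset {fset nat}}) (qs : {fset nat} -> rquad T R)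
  (ns : {fset nat} -> nat) (Bs : {fset nat} -> R) (ep : R) :
  0 <= ep -> fset0 \in A ->
  (forall u, u \in A -> 0 < gamma u) ->
  (forall u v : {fset nat}, (v `<=` u)%fset -> u \in A -> v \in A) ->
  (forall u, u \in A -> u != fset0 ->
    [/\ 0 <= Bs u, good_rquad Hu (qs u) u (ns u) (Bs u) & Bs u * gamma u <= ep]) ->
  exists Q : rand_alg (fun x : X => eval_cost dollar a (val x)) (rkhs_set HK),
    [/\ Ares Q,
        (forall f, HK f -> (mean_cost Q f <=
           (dl beta * (1 + 2 ^+ beta * (\sum_(u <- (A `\ fset0)%fset) ns u)%:R))%:E)%E) &
        forall f, HK f ->
          ('E_(ra_P Q)[fun w => ((Iop k gamma mu f - ra_val Q f w) ^+ 2)%R] <=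
          (sqr_error_const k gamma a beta r A ep * (2 * rkhs_ip HK f f + 2))%:E)%E].
Proof.
move=> ep0 A0 Apos Adown qsP.
have [b ba] := nonanchor_ex.
have [Om [pi [mpi piP]]] := product_space (fun u => rq_sp (qs u)) (fset_uniq (A `\ fset0)%fset).
(* Slot (u, i, v) holds node i of the quadrature for u anchored outside v; the extra slot [s0]
   supplies the value at the anchor. *)
pose S := ({fset nat} * nat * {fset nat})%type.
pose s0 : S := (fset0, 0%N, fset0).
pose sl : seq S := s0 :: flatten [seq flatten [seq [seq (u, i, v) | v <- fpowerset u]
   | i <- iota 0 (ns u)] | u <- (A `\ fset0)%fset].
have mem_sl u i v : u \in (A `\ fset0)%fset -> i \in iota 0 (ns u) ->
    v \in fpowerset u -> (u, i, v) \in sl.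
  move=> uA iu vu; rewrite inE; apply/orP; right.
  apply/flatten_mapP; exists u => //; apply/flatten_mapP; exists i => //.
  by apply/mapP; exists v.
pose xq u i w := rq_x (r := qs u) i (pi u w).
pose pts (s : S) w := pt s.2 (dummy b s.2 (xq s.1.1 s.1.2 w)).
(* The free coordinates of v again form a subset of u, so the slot read here is always listed. *)
pose out w (val : S -> R) := val s0 + \sum_(u <- (A `\ fset0)%fset)
  \sum_(i <- iota 0 (ns u)) rq_t (qs u) i * \sum_(v <- fpowerset u)
     mobius_sign R u v * val (u, i, free_coords v (xq u i w)).
pose est := estimator k_pos gamma_ge0 a_anchor A ns pi.
have outE f w : out w (fun s => if s \in sl then f (pts s w) else 0) = est f w.
  rewrite /out /est /estimator mem_head; congr (_ + _).
    by congr f; apply: val_inj; rewrite /= !anc0.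
  apply: eq_big_seq => u uA; rewrite /rq_val; apply: eq_big_seq => i iu.
  congr (_ * _); apply: eq_big_seq => v; rewrite fpowersetE => vu.
  congr (_ * _); rewrite mem_sl//; first by rewrite /pts pt_free_coords.
  rewrite fpowersetE; apply: fsubset_trans vu.
  by apply/fsubsetP => j; rewrite !inE => /andP[].
have estP f : HK f ->
  measurable_fun setT (fun w => Iop k gamma mu f - est f w) /\
  (\int[ps_P Om]_w ((Iop k gamma mu f - est f w) ^+ 2)%:E <=
   (sqr_error_const k gamma a beta r A ep * (2 * rkhs_ip HK f f + 2))%:E)%E.
  by move=> Hf; eapply estimator_rkhs; eassumption.
have [||||Q [Q1 Q2 Q3]] := @nonadaptive_alg _ T R dollar a X (rkhs_set HK) S sl Om pts
  (fun s => s.2) out dl.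
- exact: dlE.
- move=> f Hf; rewrite (_ : (fun w => _) = est f); last by apply/funext => w; exact: outE.
  have [mI VI] := estP f Hf.
  have mest : measurable_fun setT (est f).
    rewrite (_ : est f = (fun w => Iop k gamma mu f - (Iop k gamma mu f - est f w))).
      exact: measurable_funB.
    by apply/funext => w; ring.
  apply: (@integrable_sqr_center _ _ _ _ _ (Iop k gamma mu f)) => //.
  apply: (integrable_le_fin (f := fun w => (est f w - Iop k gamma mu f) ^+ 2)).
  + by apply: measurable_funX; exact: measurable_funB.
  + by move=> w; exact: sqr_ge0.
  + apply: le_trans VI; rewrite le_eqVlt; apply/orP; left; apply/eqP.
    by apply: eq_integral => w _; congr EFin; rewrite /est; ring.
- by move=> s w; exact: anc_anchored.
- by move=> s w; rewrite /pts /=; exact: eval_cost_dummy.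
exists Q; split => //.
- move=> f Hf; rewrite Q2// lee_fin big_cons big_flatten big_map /=.
  rewrite mulrDr mulr1 lerD//; first exact: dl_mono.
  rewrite natr_sum mulrA mulr_sumr big_seq [leRHS]big_seq.
  apply: ler_sum => u uA; rewrite big_flatten big_map /=.
  have gu : 0 < gamma u by apply: Apos; move: uA; rewrite inE => /andP[].
  apply: (@le_trans _ _ (\sum_(i <- iota 0 (ns u)) (dl beta * 2 ^+ beta))); last first.
    by rewrite big_const_seq count_predT size_iota iter_addr_0 mulr_natr.
  apply: ler_sum => i _; rewrite big_map /=.
  have dl0 : 0 <= dl beta by apply: le_trans (dl_ge1 beta).
  apply: (@le_trans _ _ (\sum_(v <- fpowerset u) dl beta)).
    rewrite big_seq [leRHS]big_seq; apply: ler_sum => v; rewrite fpowersetE => vu.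
    apply: dl_mono; apply: leq_trans (fsubset_leq_card vu) _.
    exact: gamma_gt0_card gamma_order _ gu.
  rewrite big_const_seq count_predT iter_addr_0 -[leLHS]mulr_natr ler_wpM2l//.
  rewrite -natrX ler_nat card_fpowerset leq_pexp2l//.
  exact: gamma_gt0_card gamma_order _ gu.
- move=> f Hf; rewrite Q3//; have [_] := estP f Hf; apply: le_trans.
  rewrite le_eqVlt; apply/orP; left; apply/eqP.
  by apply: eq_integral => w _; rewrite outE.
Qed.

End changing_dimension.

(** * Upper bounds *)

Section level_sets.
Context (R : realType) (g : {fset nat} -> R).
Hypothesis g_ge0 : forall u, 0 <= g u.
Hypothesis g_summable : abs_summable g.

(** Markov's inequality for the counting measure. *)
Lemma level_set_finite (t : R) : 0 < t ->
  finite_set [set u | t <= g u] /\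
  (#|` fset_set [set u | t <= g u]|%:R * t <= abs_sum g).
Proof.
move=> t0.
have bound (F : {fset {fset nat}}) : [set` F] `<=` [set u | t <= g u] ->
    #|` F|%:R * t <= abs_sum g.
  move=> Ft; apply: le_trans (fsum_le_abs_sum F g_ge0 g_summable).
  apply: (@le_trans _ _ (\sum_(u <- F) t)).
    by rewrite big_const_seq count_predT iter_addr_0 mulr_natl.
  by rewrite big_seq [leRHS]big_seq; apply: ler_sum => u; exact: Ft.
have fin : finite_set [set u | t <= g u].
  apply: contrapT => inf.
  have [F Ft Fn] := infinite_set_fset (Num.truncn (abs_sum g / t)).+1 inf.
  have := bound F Ft; apply/negP; rewrite -ltNge -ltr_pdivrMr//.
  by apply: lt_le_trans (truncnS_gt _) _; rewrite ler_nat.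
by split => //; apply: bound; rewrite fset_setK.
Qed.

End level_sets.

(** * Truncation level and sample sizes *)

Section upper_bound.
Context d (T : measurableType d) (R : realType) (rho : probability T R).
Variable rhou : forall u : {fset nat}, probability (power u T) R.
Hypothesis rhou_product : forall u : {fset nat}, is_product rho (rhou u).
Variable k : T -> T -> R.
Hypothesis Hk : rkhs k.
Variable Hu : forall u : {fset nat}, rkhs (kprod k u).
Hypothesis k_meas : measurable_fun setT (fun z : T * T => k z.1 z.2).
Hypothesis M_fin : (\int[rho]_x (k x x)%:E < +oo)%E.
Hypothesis k_int0 : forall y, (\int[rho]_x (k x y)%:E = 0)%E.
Hypothesis k_pos : forall x, 0 < k x x.
Context (mu : probability (power nat T) R) (mu_product : is_product rho mu).
Variable gamma : {fset nat} -> R.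
Hypothesis gamma_ge0 : forall u, 0 <= gamma u.
Hypothesis gamma_0 : gamma fset0 = 1.
Hypothesis gamma_sum : (\esum_(u in [set: {fset nat}])
  (gamma u * Mk rho k ^+ #|` u|)%:E < +oo)%E.
Variable a : T.
Hypothesis a_anchor : (\esum_(u in [set: {fset nat}])
  (gamma u * k a a ^+ #|` u|)%:E < +oo)%E.
Variable HK : rkhs (Kker k gamma).
Hypothesis gamma_mono : forall u v : {fset nat}, (u `<=` v)%fset -> gamma v <= gamma u.
Variables beta r : nat.
Hypothesis gamma_order : forall u : {fset nat}, (beta < #|` u|)%N -> gamma u = 0.
Hypothesis gamma_inter : forall u : {fset nat}, 0 < gamma u ->
  ([set v : {fset nat} | 0 < gamma v /\ (u `&` v)%fset != fset0] #<= `I_(1 + r)%N)%card.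
Variables (dollar : nat -> \bar R) (dl : nat -> R).
Hypothesis dlE : forall n, dollar n = (dl n)%:E.
Hypothesis dl_mono : forall m n, (m <= n)%N -> dl m <= dl n.
Hypothesis dl_ge1 : forall n, 1 <= dl n.
Variables tau q : R.
Hypothesis quad : quadrature_assumption rho rhou gamma Hu tau.
Hypotheses (q0 : 0 < q) (q_tau : q < tau) (q_decay : ((1 + q)%:E < decay k gamma a)%E).

Local Notation X := (Xset k gamma).

Let kap : R := (1 + k a a) ^+ beta.

Lemma gamma_le1 u : gamma u <= 1.
Proof. by rewrite -gamma_0; apply: gamma_mono; exact: fsub0set. Qed.

(** Normalised so that A is the level set [m^-1 <= g u], and the cardinality of A as well as the
    total sample size become linear in m. *)
Let g u := gamma u `^ (1 + q)^-1.

Let g_ge0 u : 0 <= g u.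
Proof.
exact: powR_ge0.
Qed.

(** The decay is defined through gamma_u k(a,a)^|u|; as |u| <= beta for nonzero weights, passing to
    gamma_u costs a constant even if k(a,a) < 1. *)
Lemma gamma_le_gamma_hat u :
  gamma u <= (1 + (k a a)^-1) ^+ beta * (gamma u * k a a ^+ #|` u|).
Proof.
have [ub|ub] := leqP #|` u| beta; last by rewrite gamma_order// !mul0r mulr0.
rewrite mulrCA ler_peMr//.
have i1 : 1 <= 1 + (k a a)^-1 by rewrite lerDl invr_ge0 ltW.
apply: (@le_trans _ _ ((1 + (k a a)^-1) ^+ #|` u| * k a a ^+ #|` u|)).
  by rewrite -exprMn exprn_ege1// mulrDl mul1r mulVf ?gt_eqF// lerDr ltW.
apply: ler_wpM2r; first by rewrite exprn_ge0// ltW.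
exact: ler_weXn2l.
Qed.

Let g_summable : abs_summable g.
Proof.
(* Some p above 1 + q has a convergent series; since gamma_u <= 1, the larger exponent 1/(1+q) gives
   smaller terms. *)
have [_ [p ps <-] qp] := ereal_sup_gt q_decay.
rewrite lte_fin in qp.
have p0 : 0 < p by apply: lt_trans qp; rewrite addr_gt0.
set c := (1 + (k a a)^-1) ^+ beta.
have c0 : 0 <= c by rewrite exprn_ge0// addr_ge0// invr_ge0 ltW.
have hat0 u : 0 <= gamma u * k a a ^+ #|` u| by rewrite mulr_ge0// exprn_ge0// ltW.
have sp : abs_summable (fun u => (gamma u * k a a ^+ #|` u|) `^ p^-1).
  by apply: abs_summable_ge0 => // u; exact: powR_ge0.
apply: (abs_summable_dom (g := fun u => c `^ p^-1 * (gamma u * k a a ^+ #|` u|) `^ p^-1 + 0)).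
  move=> u; rewrite addr0 ger0_norm// /g -powRM//.
  have [g00|gN0] := eqVneq (gamma u) 0.
    by rewrite g00 powR0 ?powR_ge0// invr_eq0 gt_eqF// addr_gt0.
  have gp : 0 < gamma u by rewrite lt_neqAle eq_sym gN0 gamma_ge0.
  apply: (@le_trans _ _ (gamma u `^ p^-1)).
    apply: ger_powR; first by rewrite gp gamma_le1.
    by rewrite lef_pV2 ?posrE ?addr_gt0// ltW.
  apply: ge0_ler_powR; rewrite ?nnegrE; [by rewrite invr_ge0 ltW|exact: gamma_ge0|
    exact: mulr_ge0|exact: gamma_le_gamma_hat].
by apply: abs_summable_lin => //; exact: (abs_sum0 R).2.
Qed.

Let S : R := abs_sum g.

Let S_ge0 : 0 <= S.
Proof.
by apply: le_trans (fsum_le_abs_sum fset0 g_ge0 g_summable); rewrite big_seq_fset0.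
Qed.

Section truncation.
Variable m : R.
Hypothesis m1 : 1 <= m.

Let m0 : 0 < m.
Proof.
exact: lt_le_trans m1.
Qed.

Let A := fset_set [set u | m^-1 <= g u].

Let fA := level_set_finite g_ge0 g_summable (t := m^-1) ltac:(by rewrite invr_gt0).

Let mem_A u : (u \in A) = (m^-1 <= g u).
Proof.
rewrite in_fset_set; last exact: fA.1.
by apply/idP/idP => [/set_mem//|?]; exact/mem_set.
Qed.

Let A_card : #|` A|%:R <= m * S.
Proof. by have := fA.2; rewrite ler_pdivrMr// mulrC. Qed.

Let A0 : fset0 \in A.
Proof. by rewrite mem_A /g gamma_0 powR1 invf_le1. Qed.

Let A_pos u : u \in A -> 0 < gamma u.
Proof.
rewrite mem_A => h; rewrite lt_neqAle gamma_ge0 andbT; apply/eqP => g00.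
move: h; rewrite /g -g00 powR0 ?invr_eq0 ?gt_eqF ?addr_gt0//.
by rewrite leNgt invr_gt0 m0.
Qed.

Let A_down (u v : {fset nat}) : (v `<=` u)%fset -> u \in A -> v \in A.
Proof.
rewrite !mem_A => vu /le_trans; apply; apply: ge0_ler_powR; rewrite ?nnegrE//.
  by rewrite invr_ge0 addr_ge0// ltW.
exact: gamma_mono.
Qed.

(** Chosen such that n_u^-q gamma_u is at most m^-q for each u in A. The successor makes n_u at
    least 1 and larger than gamma_u^(1/q) m. *)
Definition sample_size (u : {fset nat}) : nat := (Num.truncn (gamma u `^ q^-1 * m)).+1.

(** Since gamma_u <= 1 and 1/q > 1/(1+q), the main part of n_u is at most g_u m; the successors are
    paid for by |A| <= m S. *)
Let sum_sample_size : (\sum_(u <- (A `\ fset0)%fset) sample_size u)%:R <= 2 * S * m.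
Proof.
rewrite natr_sum; apply: (@le_trans _ _ (\sum_(u <- A) (g u * m + 1))).
  apply: (@le_trans _ _ (\sum_(u <- (A `\ fset0)%fset) (g u * m + 1))).
    apply: ler_sum => u _; rewrite /sample_size -addn1 natrD lerD2r.
    apply: (@le_trans _ _ (gamma u `^ q^-1 * m)).
      have h0 : 0 <= gamma u `^ q^-1 * m by rewrite mulr_ge0 ?powR_ge0// ltW.
      by have /andP[] := truncn_itv h0.
    rewrite ler_wpM2r ?(ltW m0)// /g.
    have [->|gN0] := eqVneq (gamma u) 0.
      by rewrite !powR0 // invr_eq0 gt_eqF// addr_gt0.
    apply: ger_powR; first by rewrite lt_neqAle eq_sym gN0 gamma_ge0 gamma_le1.
    by rewrite lef_pV2 ?posrE ?addr_gt0// lerDr.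
  rewrite [leRHS](big_fsetD1 fset0)//= lerDr addr_ge0// mulr_ge0// ltW//.
rewrite big_split/= -mulr_suml big_const_seq count_predT iter_addr_0.
have h1 := fsum_le_abs_sum A g_ge0 g_summable.
have h2 : (\sum_(u <- A) g u) * m <= S * m by rewrite ler_wpM2r// ltW.
by have := A_card; rewrite -mulr_natl mulr1; lra.
Qed.

Let tail_le : tail k gamma a A <= kap * S * m `^ (- q).
Proof.
have sk : abs_summable (fun u => kap * m `^ (- q) * g u + 0).
  by apply: abs_summable_lin => //; exact: (abs_sum0 R).2.
have -> : kap * S * m `^ (- q) = abs_sum (fun u => kap * m `^ (- q) * g u + 0).
  rewrite abs_sum_lin//; last exact: (abs_sum0 R).2.
  by rewrite (abs_sum0 R).1 addr0 /S; ring.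
apply: ler_abs_sum => //; first exact: abs_summable_tail.
have kap0 : 0 <= kap by rewrite exprn_ge0// addr_ge0// ltW.
move=> u; rewrite addr0; case: ifPn => uA.
  by rewrite mulr_ge0// mulr_ge0// powR_ge0.
have [ub|ub] := leqP #|` u| beta; last first.
  by rewrite gamma_order// mul0r mulr_ge0// mulr_ge0// powR_ge0.
have [->|gN0] := eqVneq (gamma u) 0; first by rewrite mul0r mulr_ge0// mulr_ge0// powR_ge0.
have gp : 0 < gamma u by rewrite lt_neqAle eq_sym gN0 gamma_ge0.
have kl : k a a ^+ #|` u| <= kap.
  apply: (@le_trans _ _ ((1 + k a a) ^+ #|` u|)).
    by apply: lerXn2r; rewrite ?nnegrE ?addr_ge0 ?ltW// ltrDr.
  by apply: ler_weXn2l => //; rewrite lerDl ltW.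
(* One factor of g is kept for summation, while the power q is below m^-q outside A. *)
have gE : gamma u = g u `^ q * g u.
  rewrite /g -powRrM -powRD ?gN0 ?implybT//.
  rewrite -[in LHS](powRr1 (ltW gp)); congr (_ `^ _).
  by field; rewrite gt_eqF// addr_gt0.
have gm : g u `^ q <= m `^ (- q).
  have -> : m `^ (- q) = m^-1 `^ q by rewrite -(powR_inv1 (ltW m0)) -powRrM mulN1r.
  apply: ge0_ler_powR; rewrite ?nnegrE.
  - exact: ltW.
  - exact: g_ge0.
  - by rewrite invr_ge0 ltW.
  - by rewrite ltW// ltNge -mem_A.
rewrite mulrC; apply: (@le_trans _ _ (kap * gamma u)); first by rewrite ler_wpM2r.
rewrite [in leLHS]gE -mulrA ler_wpM2l// ler_wpM2r//.
Qed.

Lemma truncated_alg (B0 : R) : 0 <= B0 ->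
  (forall u n, u != fset0 -> 0 < gamma u -> (0 < n)%N ->
    exists Q : rquad T R, good_rquad Hu Q u n (B0 * n.+1%:R `^ (- q))) ->
  exists Q : rand_alg (fun x : X => eval_cost dollar a (val x)) (rkhs_set HK),
    [/\ Ares Q,
        (forall f, HK f -> (mean_cost Q f <=
           (dl beta * (1 + 2 ^+ beta * (2 * S)) * m)%:E)%E) &
        forall f, HK f ->
          ('E_(ra_P Q)[fun w => ((Iop k gamma mu f - ra_val Q f w) ^+ 2)%R] <=
          ((2 * (4 ^+ beta * (kap * S)) + 2 * (error_const k a beta r * B0 * 2 ^+ beta))
             * m `^ (- q) * (2 * rkhs_ip HK f f + 2))%:E)%E].
Proof.
move=> B00 HB.
have [qs qsP] : {qs : {fset nat} -> rquad T R & forall u, u != fset0 -> 0 < gamma u ->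
    good_rquad Hu (qs u) u (sample_size u) (B0 * (sample_size u).+1%:R `^ (- q))}.
  apply: (@choice _ _ (fun u Q => u != fset0 -> 0 < gamma u ->
    good_rquad Hu Q u (sample_size u) (B0 * (sample_size u).+1%:R `^ (- q)))) => u.
  have [u0|u0] := eqVneq u fset0.
    (* An arbitrary rule that makes [qs] total; nothing is required of it. *)
    by exists (@Rquad _ T R (Pspace (dirac tt : probability unit R)) (fun=> 0) (fun _ _ _ => a)).
  have [gu|gu] := ltP 0 (gamma u); last first.
    by exists (@Rquad _ T R (Pspace (dirac tt : probability unit R)) (fun=> 0) (fun _ _ _ => a)).
  by have [Q QP] := HB u (sample_size u) u0 gu isT; exists Q.
have ep0 : 0 <= B0 * m `^ (- q) by rewrite mulr_ge0// powR_ge0.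
have BsP u : u \in A -> u != fset0 ->
    [/\ 0 <= B0 * (sample_size u).+1%:R `^ (- q),
        good_rquad Hu (qs u) u (sample_size u) (B0 * (sample_size u).+1%:R `^ (- q)) &
        B0 * (sample_size u).+1%:R `^ (- q) * gamma u <= B0 * m `^ (- q)].
  move=> uA u0; have gu := A_pos uA; split; first by rewrite mulr_ge0// powR_ge0.
    exact: qsP.
  rewrite -mulrA ler_wpM2l//.
  have gm0 : 0 < gamma u `^ q^-1 * m by rewrite mulr_gt0// powR_gt0.
  have le1 : (sample_size u).+1%:R `^ (- q) <= (gamma u `^ q^-1 * m) `^ (- q).
    rewrite !powRN lef_pV2 ?posrE ?powR_gt0//.
    apply: ge0_ler_powR; rewrite ?nnegrE ?ltW// /sample_size.
    by apply: lt_le_trans (truncnS_gt _) _; rewrite ler_nat.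
  apply: (@le_trans _ _ ((gamma u `^ q^-1 * m) `^ (- q) * gamma u)).
    by rewrite ler_wpM2r.
  rewrite powRM ?powR_ge0 ?(ltW m0)// -powRrM mulrN mulVf ?gt_eqF// powR_inv1//.
  by rewrite mulrC mulrA mulfV ?gt_eqF// mul1r.
have [Q [Q1 Q2 Q3]] : exists Q : rand_alg (fun x : X => eval_cost dollar a (val x)) (rkhs_set HK),
    [/\ Ares Q,
        (forall f, HK f -> (mean_cost Q f <=
           (dl beta * (1 + 2 ^+ beta * (\sum_(u <- (A `\ fset0)%fset) sample_size u)%:R))%:E)%E) &
        forall f, HK f ->
          ('E_(ra_P Q)[fun w => ((Iop k gamma mu f - ra_val Q f w) ^+ 2)%R] <=
          (sqr_error_const k gamma a beta r A (B0 * m `^ (- q)) * (2 * rkhs_ip HK f f + 2))%:E)%E].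
  eapply changing_dimension_alg; try eassumption; exact: BsP.
exists Q; split => //.
  move=> f Hf; apply: le_trans (Q2 f Hf) _; rewrite lee_fin -mulrA ler_wpM2l//.
    exact: le_trans (dl_ge1 _).
  rewrite mulrDl mul1r lerD// -mulrA ler_wpM2l ?exprn_ge0//.
move=> f Hf; apply: le_trans (Q3 f Hf) _; rewrite lee_fin ler_wpM2r//.
  by rewrite addr_ge0// mulr_ge0// rkhs_ip_ge0.
rewrite /sqr_error_const [in leRHS]mulrDl; apply: lerD.
  rewrite -!mulrA ler_wpM2l// ler_wpM2l ?exprn_ge0//.
  by apply: le_trans tail_le _; rewrite mulrA.
by rewrite le_eqVlt; apply/orP; left; apply/eqP; ring.
Qed.

End truncation.

Lemma upper_family : exists C1 C2 : R, [/\ 0 < C1, 0 < C2 & forall m, 1 <= m ->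
  exists Q : rand_alg (fun x : X => eval_cost dollar a (val x)) (rkhs_set HK),
    [/\ Ares Q,
        (forall f, HK f -> (mean_cost Q f <= (C1 * m)%:E)%E) &
        forall f, unit_ball HK f ->
          ('E_(ra_P Q)[fun w => ((Iop k gamma mu f - ra_val Q f w) ^+ 2)%R] <=
          (C2 * m `^ (- q))%:E)%E]].
Proof.
have gcl (u v : {fset nat}) : (u `<=` v)%fset -> 0 < gamma v -> 0 < gamma u.
  by move=> uv gv; apply: lt_le_trans gv _; exact: gamma_mono.
have gb u : 0 < gamma u -> (#|` u| <= beta)%N by exact: gamma_gt0_card.
have [B0 B00 HB] := good_rquad_exists rhou_product Hk k_meas M_fin k_int0 a gcl gb quad q_tau.
have kap0 : 0 <= kap by rewrite exprn_ge0// addr_ge0// ltW.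
pose C1 := dl beta * (1 + 2 ^+ beta * (2 * S)).
pose C2 := (2 * (4 ^+ beta * (kap * S)) + 2 * (error_const k a beta r * B0 * 2 ^+ beta)).
have C20 : 0 <= C2.
  rewrite /C2 addr_ge0// mulr_ge0// mulr_ge0 ?exprn_ge0// mulr_ge0//.
  exact: error_const_ge0.
(* On the unit ball 2 |f|^2 + 2 <= 4; the + 1 gives strict positivity. *)
exists C1, (C2 * 4 + 1); split.
- rewrite /C1 mulr_gt0//; first exact: lt_le_trans (dl_ge1 _).
  by rewrite ltr_wpDr// mulr_ge0 ?exprn_ge0// mulr_ge0.
- by rewrite ltr_wpDl// mulr_ge0.
move=> m m1; have [Q [Q1 Q2 Q3]] := truncated_alg m1 B00 HB.
exists Q; split => // f [Hf f1]; apply: le_trans (Q3 f Hf) _.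
rewrite lee_fin -/C2.
have n1 : rkhs_ip HK f f <= 1.
  by rewrite -[leLHS]sqr_sqrtr ?rkhs_ip_ge0// expr_le1 ?sqrtr_ge0.
have mq := powR_ge0 m (- q).
rewrite mulrAC ler_wpM2r//.
apply: (@le_trans _ _ (C2 * 4)); last by rewrite lerDl.
by rewrite ler_wpM2l//; lra.
Qed.

End upper_bound.

(** * Exponents with possibly infinite decay *)

Section extended_exponent.
Variables (R : realType) (tau : R) (dec : \bar R).
Hypotheses (tau0 : 0 < tau) (dec1 : (1 < dec)%E).

Lemma rate_gt0 : 0 < fine (mine tau%:E (dec - 1)%E).
Proof.
move: dec1; case: dec => [x||]//.
  rewrite lte_fin => x1; rewrite -EFinB -EFin_min/= lt_min tau0 subr_gt0//.
by rewrite /= minEle leey.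
Qed.

Lemma lt_rate q : q < fine (mine tau%:E (dec - 1)%E) ->
  q < tau /\ ((1 + q)%:E < dec)%E.
Proof.
move: dec1; case: dec => [x||]//.
  rewrite lte_fin => x1; rewrite -EFinB -EFin_min/= lt_min => /andP[-> h].
  by split => //; rewrite lte_fin; lra.
move=> _; have -> : (mine tau%:E (+oo - 1) = tau%:E)%E by rewrite minEle leey.
by move=> h; split => //; exact: ltry.
Qed.

Lemma rate_below delta : 0 < delta -> exists q,
  [/\ 0 < q, q < tau, ((1 + q)%:E < dec)%E &
      - q <= - fine (mine tau%:E (dec - 1)%E) + delta].
Proof.
move=> delta0; have := rate_gt0; have := @lt_rate; set rate := fine _ => lt_q rate0.
(* The second entry keeps q positive when delta exceeds the rate. *)
exists (Num.max (rate - delta) (rate / 2)).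
have q_rate : Num.max (rate - delta) (rate / 2) < rate.
  by rewrite gt_max; apply/andP; split; lra.
have [-> ->] := lt_q _ q_rate; split => //.
  by rewrite lt_max [X in _ || X]divr_gt0 ?orbT.
by rewrite lerNl opprD opprK le_max lexx.
Qed.

(** The real form of 2 / (dec - 1), which is 0 for infinite decay. For p below it, p / (2 + p) < 1 /
    dec, and t is the midpoint: summability with exponent t would then exceed the decay. *)
Lemma inve_decayE : exists2 s : R, 0 <= s & (2%:E / (dec - 1) = s%:E)%E /\
  (forall p, s < p -> ((1 + 2 / p)%:E < dec)%E) /\
  (forall p, 0 <= p -> p < s -> exists t : R,
     [/\ 0 < t, t < 1, p < t * (2 + p) & (dec < (t^-1)%:E)%E]).
Proof.
move: dec1; case: dec => [x||]//.
  rewrite lte_fin => x1; exists (2 / (x - 1)).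
    by rewrite divr_ge0// subr_ge0 ltW.
  rewrite -EFinB inver subr_eq0 gt_eqF//; split => //.
  have x10 : 0 < x - 1 by rewrite subr_gt0.
  have x0 : 0 < x by apply: lt_trans x1.
  split=> [p sp|p p0]; last first.
    rewrite ltr_pdivlMr// => px.
    have p2 : 0 < p + 2 by rewrite ltr_wpDl.
    have w0 : 0 <= p / (p + 2) by rewrite divr_ge0// ltW.
    have wE : p / (p + 2) * (p + 2) = p by rewrite mulfVK// gt_eqF.
    have i1 : x^-1 < 1 by rewrite invf_lt1.
    have wi : p / (p + 2) < x^-1.
      by rewrite ltr_pdivrMr// mulrC ltr_pdivlMr//; lra.
    pose t := (p / (p + 2) + x^-1) / 2.
    have wt : p / (p + 2) < t by rewrite /t; lra.
    have ti : t < x^-1 by rewrite /t; lra.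
    have t0 : 0 < t by apply: le_lt_trans wt.
    exists t; split => //; first exact: lt_trans i1.
      by rewrite [X in _ * X]addrC -ltr_pdivrMr.
    by rewrite lte_fin -[ltLHS]invrK ltf_pV2 ?posrE// invr_gt0.
  have p0 : 0 < p by apply: le_lt_trans sp; rewrite divr_ge0// ltW.
  rewrite lte_fin -ltrBrDl ltr_pdivrMr// mulrC -ltr_pdivrMr//.
move=> _; exists 0 => //; split; first by rewrite /= invey mule0.
split=> [p _|p p0]; first by rewrite ltry.
by rewrite ltNge p0.
Qed.

End extended_exponent.

(** * From a family of algorithms to error and complexity rates *)

Section rates.
Context d (T : measurableType d) (R : realType).
Variables (dollar : nat -> \bar R) (dl : nat -> R) (a : T) (X : set (power nat T)).
Hypothesis dlE : forall n, dollar n = (dl n)%:E.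
Variables (L : X -> X -> R) (HK : rkhs L) (I : (X -> R) -> R).

Local Notation alg := (rand_alg (fun x : X => eval_cost dollar a (val x)) (rkhs_set HK)).
Local Notation F := (unit_ball HK).

Lemma unit_ball0 : F (fun=> 0).
Proof.
split; first exact: rkhs0.
by rewrite /rkhs_norm rkhs_ip0l ?sqrtr0//; exact: rkhs0.
Qed.

Lemma unit_ball_ip f : F f -> rkhs_ip HK f f <= 1.
Proof.
case=> Hf f1; rewrite -[leLHS]sqr_sqrtr ?rkhs_ip_ge0//.
by rewrite expr_le1 ?sqrtr_ge0.
Qed.

Lemma sqr_error_ge0 (Q : alg) f :
  (0 <= 'E_(ra_P Q)[fun w => ((I f - ra_val Q f w) ^+ 2)%R])%E.
Proof.
by rewrite unlock; apply: integral_ge0 => w _; rewrite lee_fin sqr_ge0.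
Qed.

Lemma wc_error_ge0 (Q : alg) : (0 <= wc_error I Q F)%E.
Proof.
exact: poweR_ge0.
Qed.

Lemma wc_error_le (Q : alg) (x : R) : 0 <= x ->
  (forall f, F f -> ('E_(ra_P Q)[fun w => ((I f - ra_val Q f w) ^+ 2)%R] <= (x ^+ 2)%:E)%E) ->
  (wc_error I Q F <= x%:E)%E.
Proof.
move=> x0 h; rewrite /wc_error.
rewrite -[leRHS](_ : (x ^+ 2)%:E `^ 2^-1 = _)%E; last first.
  by rewrite poweR_EFin powR12_sqrt ?sqr_ge0// sqrtr_sqr ger0_norm.
apply: gt0_ler_poweR; rewrite ?in_itv/= ?andbT ?leey//; rewrite ?lee_fin ?sqr_ge0//.
- rewrite andbT; apply: le_trans (sqr_error_ge0 Q (fun=> 0)) _.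
  by apply: ereal_sup_ubound; exists (fun=> 0) => //; exact: unit_ball0.
- by apply: ge_ereal_sup => _ [f Ff <-]; exact: h.
Qed.

Lemma sqr_error_le (Q : alg) (x : R) f : (wc_error I Q F <= x%:E)%E -> F f ->
  ('E_(ra_P Q)[fun w => ((I f - ra_val Q f w) ^+ 2)%R] <= (x ^+ 2)%:E)%E.
Proof.
move=> h Ff.
have x0 : 0 <= x by rewrite -lee_fin; apply: le_trans h; exact: wc_error_ge0.
set s := ereal_sup [set ('E_(ra_P Q)[fun w => ((I f - ra_val Q f w) ^+ 2)%R])%E | f in F].
have fs : ('E_(ra_P Q)[fun w => ((I f - ra_val Q f w) ^+ 2)%R] <= s)%E.
  by apply: ereal_sup_ubound; exists f.
apply: le_trans fs _.
have s0 : (0 <= s)%E.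
  apply: le_trans (sqr_error_ge0 Q (fun=> 0)) _.
  by apply: ereal_sup_ubound; exists (fun=> 0) => //; exact: unit_ball0.
move: h; rewrite /wc_error -/s; case: s s0 => [s||] //.
  rewrite lee_fin => s0; rewrite poweR_EFin !lee_fin powR12_sqrt// => h.
  by rewrite -[s]sqr_sqrtr// lerXn2r ?nnegrE// sqrtr_ge0.
by move=> _; rewrite /poweR/= gt_eqF// leye_eq.
Qed.

Lemma wc_cost_le (Q : alg) c : (forall f, HK f -> (mean_cost Q f <= c)%E) ->
  (wc_cost Q F <= c)%E.
Proof.
by move=> h; apply: ge_ereal_sup => _ [f [Hf _] <-]; exact: h.
Qed.

Lemma min_error_ge0 N : (0 <= min_error dollar a (rkhs_set HK) I N F)%E.
Proof.
by apply: le_ereal_inf_tmp => _ [Q [_ _ ->]]; exact: wc_error_ge0.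
Qed.

Lemma eps_comp_alg (eps x : R) : (eps_comp dollar a (rkhs_set HK) I eps F < x%:E)%E ->
  exists Q : rand_alg (fun x => eval_cost dollar a (val x)) (rkhs_set HK),
    [/\ Ares Q, (wc_error I Q F <= eps%:E)%E & (wc_cost Q F < x%:E)%E].
Proof.
by move=> /ereal_inf_lt[_ [Q [Q1 Q2 ->]] Qx]; exists Q.
Qed.

Variables (C1 C2 q : R).
Hypotheses (C10 : 0 < C1) (C20 : 0 < C2) (q0 : 0 < q).
Hypothesis family : forall m, 1 <= m -> exists Q : alg,
  [/\ Ares Q, (forall f, HK f -> (mean_cost Q f <= (C1 * m)%:E)%E) &
      forall f, F f -> ('E_(ra_P Q)[fun w => ((I f - ra_val Q f w) ^+ 2)%R] <=
        (C2 * m `^ (- q))%:E)%E].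

Lemma min_error_rate (s : R) : - q <= s ->
  ebigO (fun N => min_error dollar a (rkhs_set HK) I N F ^+ 2)%E (fun N => N%:R `^ s).
Proof.
move=> qs; exists (C2 * C1 `^ q); near=> N.
have NC : C1 <= N%:R by near: N; exact: nbhs_infty_ger.
have N1 : 1 <= N%:R :> R by near: N; exact: nbhs_infty_ger.
have N0 : 0 < N%:R :> R by exact: lt_le_trans N1.
(* The parameter m = N / C1 spends the whole budget N. *)
have m1 : 1 <= N%:R / C1 by rewrite ler_pdivlMr// mul1r.
have [Q [Q1 Q2 Q3]] := family m1.
set y := C2 * (N%:R / C1) `^ (- q).
have y0 : 0 <= y by rewrite mulr_ge0// ?powR_ge0// ltW.
have eN : (min_error dollar a (rkhs_set HK) I N F <= (Num.sqrt y)%:E)%E.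
  apply: (@le_trans _ _ (wc_error I Q F)).
    apply: ereal_inf_lbound; exists Q; split => //; apply: wc_cost_le => f Hf.
    by apply: le_trans (Q2 f Hf) _; rewrite mulrCA mulfV ?gt_eqF// mulr1.
  apply: wc_error_le; first exact: sqrtr_ge0.
  by move=> f Ff; rewrite sqr_sqrtr//; exact: Q3.
apply: (@le_trans _ _ (y%:E)).
  rewrite -(sqr_sqrtr y0) expe2 expr2 EFinM.
  by apply: lee_pmul; rewrite ?min_error_ge0.
rewrite lee_fin /y powRM ?invr_ge0 ?(ltW C10)// ?(ltW N0)//.
have -> : C1^-1 `^ (- q) = C1 `^ q.
  by rewrite -[C1^-1]powR_inv1 ?(ltW C10)// -powRrM mulN1r opprK.
rewrite mulrA mulrAC ler_wpM2l//; first by rewrite mulr_ge0 ?powR_ge0// ltW.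
by rewrite ler_powR.
Unshelve. all: by end_near.
Qed.

(** Used for large eps: the complexity bound concerns all eps > 0, whereas the family starts at m =
    1. *)
Lemma zero_alg : exists Q : alg, [/\ Ares Q, (forall f, HK f -> mean_cost Q f = 0%E) &
  forall f, HK f -> ('E_(ra_P Q)[fun w => ((I f - ra_val Q f w) ^+ 2)%R] = ((I f) ^+ 2)%:E)%E].
Proof.
have [||||Q [Q1 Q2 Q3]] := @nonadaptive_alg _ T R dollar a X (rkhs_set HK) void [::]
  (Pspace (dirac tt : probability unit R)) (fun s _ => of_void X s) (of_void _)
  (fun _ _ => 0) dl => //.
  by move=> f Hf; exact: Lfun_cst.
exists Q; split => //.
  by move=> f Hf; rewrite Q2// big_nil.
move=> f Hf; rewrite Q3//.
under eq_integral do rewrite subr0.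
rewrite integral_cst//= [X in (_ * X)%E](_ : _ = 1%E) ?mule1//.
exact: probability_setT.
Qed.

Lemma eps_comp_rate (B : R) : (forall f, HK f -> I f ^+ 2 <= B * rkhs_ip HK f f) ->
  exists2 C : R, 0 <= C & forall eps : R, 0 < eps ->
    (eps_comp dollar a (rkhs_set HK) I eps F <= (C * eps `^ (- (2 / q)))%:E)%E.
Proof.
move=> IB; pose C3 := Num.max C2 B.
have C30 : 0 < C3 by rewrite lt_max C20.
exists (C1 * C3 `^ q^-1); first by rewrite mulr_ge0 ?powR_ge0// ltW.
(* [C3] dominates both the squared norm of I, for the zero algorithm, and the constant C2, and makes
   m = (C3 / eps^2)^(1/q) at least 1 in the other case. *)
move=> eps eps0; have [eb|es] := leP C3 (eps ^+ 2).
  have [Q [Q1 Q2 Q3]] := zero_alg.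
  apply: (@le_trans _ _ (wc_cost Q F)).
    apply: ereal_inf_lbound; exists Q; split => //; apply: wc_error_le; first exact: ltW.
    move=> f Ff; have Hf := Ff.1; rewrite Q3// lee_fin.
    apply: le_trans (IB f Hf) _; apply: le_trans eb.
    apply: (@le_trans _ _ (C3 * rkhs_ip HK f f)).
      by rewrite ler_wpM2r ?rkhs_ip_ge0// le_max lexx orbT.
    by rewrite ler_piMr ?unit_ball_ip// ltW.
  apply: wc_cost_le => f Hf; rewrite Q2// lee_fin mulr_ge0 ?powR_ge0//.
  by rewrite mulr_ge0 ?powR_ge0// ltW.
pose m := (C3 / eps ^+ 2) `^ q^-1.
have e20 : 0 < eps ^+ 2 by rewrite exprn_gt0.
have ce0 : 0 < C3 / eps ^+ 2 by rewrite divr_gt0.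
have m1 : 1 <= m.
  rewrite -[leLHS](congr1 (@^~ q^-1) (powR1 R)) /m.
  apply: ge0_ler_powR; rewrite ?nnegrE ?invr_ge0 ?(ltW q0)//.
    exact: ltW.
  by rewrite ler_pdivlMr// mul1r ltW.
have [Q [Q1 Q2 Q3]] := family m1.
have -> : C1 * C3 `^ q^-1 * eps `^ (- (2 / q)) = C1 * m.
  rewrite /m powRM ?invr_ge0 ?(ltW C30) ?(ltW e20)// -mulrA; congr (_ * (_ * _)).
  rewrite -[(eps ^+ 2)^-1]powR_inv1 ?(ltW e20)// -powR_mulrn ?(ltW eps0)// -!powRrM.
  by congr (_ `^ _); field; rewrite gt_eqF.
apply: (@le_trans _ _ (wc_cost Q F)); last by apply: wc_cost_le => f Hf; exact: Q2.
apply: ereal_inf_lbound; exists Q; split => //; apply: wc_error_le; first exact: ltW.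
move=> f Ff; apply: le_trans (Q3 f Ff) _; rewrite lee_fin /m -powRrM mulrN mulVf ?gt_eqF//.
rewrite powR_inv1 ?(ltW ce0)// invf_div mulrCA ler_piMr ?(ltW e20)//.
by rewrite ler_pdivrMr// mul1r le_max lexx.
Qed.

End rates.

(** * Lower bounds *)

Section sparse_tails.
Context (R : realType) (U : choiceType) (x : U -> R) (A p s : R).
Hypotheses (x_ge0 : forall u, 0 <= x u) (A0 : 0 <= A).
Hypotheses (s0 : 0 < s) (s1 : s < 1) (ps : p < s * (2 + p)).

(** A substitute for Hölder's inequality: summed over a finite set, it bounds the sum of y^s by the
    cardinality and the sum of y, with t left to be balanced. *)
Lemma powR_le_affine (t y : R) : 0 < t -> 0 <= y ->
  y `^ s <= t `^ s + t `^ (s - 1) * y.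
Proof.
move=> t0 y0; have [yt|ty] := leP y t.
  rewrite ler_wpDr ?mulr_ge0 ?powR_ge0//.
  by apply: ge0_ler_powR; rewrite ?nnegrE// ltW.
have yp : 0 < y by apply: lt_trans ty.
rewrite ler_wpDl ?powR_ge0//.
have -> : y `^ s = y `^ (s - 1) * y.
  by rewrite -[X in _ * X](powRr1 y0) -powRD ?subrK// gt_eqF// implybT.
rewrite ler_wpM2r// -opprB !powRN lef_pV2 ?posrE ?powR_gt0//.
by apply: ge0_ler_powR; rewrite ?nnegrE ?subr_ge0// ltW.
Qed.

(* Splitting the family dyadically along the sets B for eps = 2^-(j+1). *)
Lemma sparse_tail_summable :
  (forall eps : R, 0 < eps -> eps <= 2^-1 -> exists2 B : {fset U},
     #|` B|%:R <= A * eps `^ (- p) &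
     forall G : {fset U}, (forall u, u \in G -> u \notin B) ->
       \sum_(u <- G) x u <= 2 * eps ^+ 2) ->
  exists M : R, forall G : {fset U}, \sum_(u <- G) x u `^ s <= M.
Proof.
move=> HB; pose e j : R := 2^-1 ^+ j.+1.
have e0 j : 0 < e j by rewrite exprn_gt0.
have e1 j : e j <= 2^-1.
  by rewrite /e exprS ler_piMr ?invr_ge0// exprn_ile1 ?invr_ge0// invf_le1// ler1n.
have [B BP] : {B : nat -> {fset U} & forall j, #|` B j|%:R <= A * e j `^ (- p) /\
    forall G : {fset U}, (forall u, u \in G -> u \notin B j) ->
       \sum_(u <- G) x u <= 2 * e j ^+ 2}.
  apply: (@choice _ _ (fun j (B : {fset U}) => #|` B|%:R <= A * e j `^ (- p) /\
    forall G : {fset U}, (forall u, u \in G -> u \notin B) ->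
       \sum_(u <- G) x u <= 2 * e j ^+ 2)) => j.
  by have [B] := HB _ (e0 j) (e1 j); exists B.
pose th := s * (2 + p) - p; have th0 : 0 < th by rewrite subr_gt0.
pose z : R := 2^-1 `^ th; pose D := A * 2 `^ p + 2.
have D0 : 0 <= D by rewrite addr_ge0// mulr_ge0// powR_ge0.
have z0 : 0 < z by rewrite powR_gt0.
have z1 : z < 1.
  rewrite /z -[ltRHS](congr1 (@^~ th) (powR1 R)); apply: gt0_ltr_powR; rewrite ?nnegrE ?invr_ge0//.
  by rewrite invf_lt1// ltr1n.
have ez j : e j `^ th = z ^+ j.+1.
  have h0 : 0 <= 2^-1 :> R by rewrite invr_ge0.
  rewrite /e /z; move: 2^-1 h0 => h h0.
  by rewrite -(powR_mulrn _ h0) -(powR_mulrn _ (powR_ge0 h th)) -!powRrM mulrC.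
have xs0 u : 0 <= x u `^ s by exact: powR_ge0.
have level (j : nat) (G : {fset U}) : (forall u, u \in G -> u \notin B j) ->
    (G `<=` B j.+1)%fset -> \sum_(u <- G) x u `^ s <= D * z ^+ j.+1.
  (* About e_j^-p terms share a sum of order e_j^2; taking t as their typical size makes both parts
     of [powR_le_affine] of order e_j^th, and [ps] says th > 0. *)
  move=> Gj Gj1; set t := e j `^ (2 + p).
  have t0 : 0 < t by rewrite powR_gt0.
  have eD y y' : e j `^ y * e j `^ y' = e j `^ (y + y').
    by rewrite powRD// (gt_eqF (e0 j)) implybT.
  apply: (@le_trans _ _ (\sum_(u <- G) (t `^ s + t `^ (s - 1) * x u))).
    by apply: ler_sum => u _; exact: powR_le_affine.
  rewrite big_split/= big_const_seq count_predT iter_addr_0 -mulr_sumr.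
  rewrite -ez /D mulrDl; apply: lerD.
    rewrite -[leLHS]mulr_natl.
    apply: (@le_trans _ _ (A * e j.+1 `^ (- p) * t `^ s)).
      rewrite ler_wpM2r ?powR_ge0//; apply: le_trans (BP j.+1).1.
      by rewrite ler_nat; exact: fsubset_leq_card.
    have -> : e j.+1 = 2^-1 * e j by rewrite /e exprS.
    rewrite powRM ?invr_ge0// ?(ltW (e0 j))//.
    have -> : 2^-1 `^ (- p) = 2 `^ p :> R.
      by rewrite -[2^-1]powR_inv1// -powRrM mulN1r opprK.
    rewrite /t -!mulrA -powRrM eD (_ : - p + (2 + p) * s = th); last by rewrite /th; ring.
    by rewrite mulrCA mulrA.
  apply: (@le_trans _ _ (t `^ (s - 1) * (2 * e j ^+ 2))).
    by rewrite ler_wpM2l ?powR_ge0//; exact: (BP j).2.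
  rewrite mulrCA ler_wpM2l// /t -powR_mulrn ?(ltW (e0 j))// -powRrM eD.
  by rewrite (_ : (2 + p) * (s - 1) + 2 = th)//; rewrite /th; ring.
pose K0 := \sum_(u <- B 0%N) x u `^ s.
have sub_sum (G G' : {fset U}) : (G `<=` G')%fset ->
    \sum_(u <- G) x u `^ s <= \sum_(u <- G') x u `^ s.
  move=> GG; rewrite [leRHS](big_fsetID _ (fun u => u \in G))/=.
  rewrite (_ : [fset u in G' | u \in G]%fset = G) ?lerDl ?sumr_ge0//.
  by apply/fsetP => u; rewrite !inE andb_idl//; exact: (fsubsetP GG).
(* The sets [B j] need not be nested: elements of [B J.+1] outside [B J] form one level, and the
   others are covered by induction. *)
have partial J : forall G : {fset U}, (G `<=` B J)%fset ->
    \sum_(u <- G) x u `^ s <= K0 + D * ((1 - z ^+ J) / (1 - z)).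
  elim: J => [|J ih] G GB.
    by rewrite expr0 subrr mul0r mulr0 addr0; exact: sub_sum.
  rewrite (big_fsetID _ (fun u => u \in B J))/=.
  apply: (@le_trans _ _ ((K0 + D * ((1 - z ^+ J) / (1 - z))) + D * z ^+ J.+1)).
    apply: lerD.
      by apply: ih; apply/fsubsetP => u; rewrite !inE => /andP[].
    apply: level => [u|]; first by rewrite !inE => /andP[].
    by apply: fsubset_trans GB; apply/fsubsetP => u; rewrite !inE => /andP[].
  rewrite -addrA lerD2l -mulrDr ler_wpM2l//.
  have z10 : 0 < 1 - z by rewrite subr_gt0.
  rewrite ler_pdivlMr// mulrDl mulfVK ?gt_eqF//.
  have : z ^+ J.+1 * z >= 0 by rewrite mulr_ge0// ?exprn_ge0// ltW.
  have : z ^+ J.+1 <= z ^+ J by rewrite exprS ler_piMl ?exprn_ge0// ltW.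
  by have := exprSr z J; nra.
exists (K0 + D / (1 - z)) => G.
(* If u is not in [B j], then x u <= 2 e_j^2, which tends to 0. So the positive terms of a finite G
   all lie in one [B J]. *)
have [J JP] : exists J, forall j u, (J <= j)%N -> u \in G -> 0 < x u -> u \in B j.
  have : forall u, exists J, forall j, (J <= j)%N -> 0 < x u -> u \in B j.
    move=> u; have [xu|xu] := ltP 0 (x u); last by exists 0%N.
    exists (Num.truncn (x u)^-1).+1 => j jJ _; apply/negPn/negP => uB.
    have := (BP j).2 [fset u]%fset; rewrite big_seq_fset1 => /(_ _)/wrap[].
      by move=> v; rewrite inE => /eqP ->.
    apply/negP; rewrite -ltNge.
    have x1 : (x u)^-1 < j%:R by apply: lt_le_trans (truncnS_gt _) _; rewrite ler_nat.
    have j0 : 0 < j%:R :> R by apply: lt_trans x1; rewrite invr_gt0.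
    apply: (@lt_trans _ _ j%:R^-1); last by rewrite -[ltRHS]invrK ltf_pV2 ?posrE ?invr_gt0.
    apply: (@le_lt_trans _ _ (e j)).
      by rewrite expr2 mulrA ler_piMl// ?(ltW (e0 j))// -ler_pdivlMl// mulr1.
    rewrite /e exprVn ltf_pV2 ?posrE ?exprn_gt0// -natrX ltr_nat.
    by apply: ltn_trans (ltn_expl j (isT : 1 < 2)%N) _; rewrite ltn_exp2l.
  move=> /(@choice _ _ _)[Jf JfP]; exists (\max_(u <- G) Jf u) => j u jJ uG.
  by apply: JfP; apply: leq_trans jJ; exact: leq_bigmax_seq.
rewrite (big_fsetID _ (fun u => u \in B J))/=.
rewrite [X in _ + X]big1_fset ?addr0; last first.
  move=> u; rewrite !inE => /andP[uG uB] _; have [xu|xu] := ltP 0 (x u).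
    by rewrite (JP J u) in uB.
  by rewrite (_ : x u = 0) ?powR0 ?gt_eqF//; apply/eqP; rewrite eq_le xu x_ge0.
apply: le_trans (partial J _ _) _.
  by apply/fsubsetP => u; rewrite !inE => /andP[].
rewrite lerD2l; apply: ler_wpM2l => //.
by rewrite ler_pdivrMr ?subr_gt0// mulVf ?gt_eqF ?subr_gt0// gerBl exprn_ge0// ltW.
Qed.

End sparse_tails.

Section fooling.
Context d (T : measurableType d) (R : realType).
Variables (dollar : nat -> \bar R) (a : T) (X : set (power nat T)).
Variables (L : X -> X -> R) (HK : rkhs L) (I : (X -> R) -> R).

Local Notation alg := (rand_alg (fun x : X => eval_cost dollar a (val x)) (rkhs_set HK)).

(* Q observes the same values, namely zeros, for f and for - f. *)
Lemma fooling (Q : alg) (vs : seq {fset nat}) (f : X -> R) (x : R) :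
  (forall f, HK f -> forall w, size (ra_pts Q f w) = size vs /\
     all2 (fun y v => `[< anchored a v (val y) >]) (ra_pts Q f w) vs) ->
  HK f -> HK (fun z => - f z) -> I (fun z => - f z) = - I f ->
  (forall z v, v \in vs -> anchored a v (val z) -> f z = 0) ->
  ('E_(ra_P Q)[fun w => ((I f - ra_val Q f w) ^+ 2)%R] <= x%:E)%E ->
  ('E_(ra_P Q)[fun w => ((I (fun z => - f z) - ra_val Q (fun z => - f z) w) ^+ 2)%R]
     <= x%:E)%E ->
  I f ^+ 2 <= x.
Proof.
move=> Qvs Hf HNf IN fvs.
pose A w := @ra_out _ _ _ _ Q w (nseq (size vs) 0).
have valE g : HK g -> (forall z v, v \in vs -> anchored a v (val z) -> g z = 0) ->
    ra_val Q g = A.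
  move=> Hg gvs; apply/funext => w; rewrite /ra_val /A; congr (@ra_out _ _ _ _ Q w _).
  have [_ +] := Qvs g Hg w; elim: (ra_pts Q g w) (vs) gvs => [|z l ih] [|v s]//= gvs.
  move=> /andP[/asboolP zv ls]; rewrite (gvs z v) ?mem_head// (ih s)//.
  by move=> z' v' v's; apply: gvs; rewrite inE v's orbT.
have mA : measurable_fun setT A.
  rewrite -(valE _ Hf fvs); have := ra_val_L2 Q Hf; rewrite inE => /andP[+ _].
  by rewrite inE.
rewrite (valE _ Hf fvs) (valE _ HNf) => [|z v vv zv]; last by rewrite (fvs z v)// oppr0.
rewrite IN unlock => h1 h2; set c := I f in h1 h2 *.
have m1 : measurable_fun setT (fun w => ((c - A w) ^+ 2)%:E).
  by apply/measurable_EFinP; apply: measurable_funX; exact: measurable_funB.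
have m2 : measurable_fun setT (fun w => ((- c - A w) ^+ 2)%:E).
  by apply/measurable_EFinP; apply: measurable_funX; exact: measurable_funB.
have p1 w : (0 <= ((c - A w) ^+ 2)%:E)%E by rewrite lee_fin sqr_ge0.
have p2 w : (0 <= ((- c - A w) ^+ 2)%:E)%E by rewrite lee_fin sqr_ge0.
have h3 := leeD h1 h2; rewrite -ge0_integralD// in h3.
have : ((2 * c ^+ 2)%:E <= (x + x)%:E)%E.
  rewrite EFinD; apply: le_trans h3.
  have -> : (2 * c ^+ 2)%:E = (\int[ra_P Q]_w (2 * c ^+ 2)%:E)%E.
    rewrite integral_cst//= [X in (_ * X)%E](_ : _ = 1%E) ?mule1//.
    exact: probability_setT.
  apply: ge0_le_integral => //.
  - by move=> w _; rewrite lee_fin mulr_ge0// sqr_ge0.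
  - exact: emeasurable_funD.
  - by move=> w _; rewrite -EFinD lee_fin; have := sqr_ge0 (A w); nra.
by rewrite lee_fin; lra.
Qed.

End fooling.

(** * Lower bound for a single algorithm *)

Section lower_bound.
Context d (T : measurableType d) (R : realType) (rho : probability T R).
Variable k : T -> T -> R.
Hypothesis Hk : rkhs k.
Variable Hu : forall u : {fset nat}, rkhs (kprod k u).
Hypothesis k_meas : measurable_fun setT (fun z : T * T => k z.1 z.2).
Hypothesis M_fin : (\int[rho]_x (k x x)%:E < +oo)%E.
Hypothesis k_int0 : forall y, (\int[rho]_x (k x y)%:E = 0)%E.
Hypothesis k_pos : forall x, 0 < k x x.
Context (mu : probability (power nat T) R) (mu_product : is_product rho mu).
Variable gamma : {fset nat} -> R.
Hypothesis gamma_ge0 : forall u, 0 <= gamma u.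
Hypothesis gamma_0 : gamma fset0 = 1.
Hypothesis gamma_sum : (\esum_(u in [set: {fset nat}])
  (gamma u * Mk rho k ^+ #|` u|)%:E < +oo)%E.
Variable a : T.
Variable HK : rkhs (Kker k gamma).
Variable dollar : nat -> \bar R.

Local Notation X := (Xset k gamma).
Local Notation K := (Kker k gamma).
Local Notation I := (Iop k gamma mu).
Local Notation alg := (rand_alg (fun x : X => eval_cost dollar a (val x)) (rkhs_set HK)).

(** That H(K) contains the constant 1 is a consequence: the Riesz representer takes the value I(K(.,
    y)) = 1 at each y, and its squared norm is I(1) = mu(X). *)
Lemma Iop_representer : exists2 h, HK h & (forall f, HK f -> I f = rkhs_ip HK h f) /\
  (h = fun=> 1) /\ rkhs_ip HK h h = 1.
Proof.
have [B B0 IB] := Iop_bound Hk Hu k_meas M_fin mu_product gamma_ge0 gamma_sum HK.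
have [||||h Hh hP] := @rkhs_riesz _ _ _ HK (rkhs_set HK) I B B0 (fun _ => id) (rkhs0 HK).
- by move=> c f g; exact: rkhs_lin.
- by [].
- move=> c f g Hf Hg.
  exact: (Iop_lin Hk Hu k_meas M_fin mu_product gamma_ge0 gamma_sum c Hf Hg).
- exact: IB.
have h1 : h = fun=> 1.
  apply/funext => y; rewrite -(rkhs_reproducing y Hh) hP; last exact: rkhs_section.
  exact: (Iop_section Hk Hu k_meas M_fin k_int0 mu_product gamma_ge0 gamma_0 gamma_sum).
exists h => //; split; first by move=> f Hf; rewrite hP.
split=> //; rewrite hP// h1 /Iop.
have mX := measurable_Xset Hu k_meas gamma_ge0.
rewrite (_ : (\int[mu]_(x in X) _)%R = (\int[mu]_(x in X) (cst 1) x)%R); last first.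
  apply: eq_Rintegral => x /set_mem Xx; have [z <-] := XsetE Xx.
  by rewrite valL_val.
rewrite Rintegral_cst//.
have muX : mu X = 1%E by exact: (mu_Xset Hk Hu k_meas M_fin mu_product gamma_ge0 gamma_sum).
by rewrite mul1r -[RHS]/(fine 1%E) -muX.
Qed.

(* With t the sum of the coefficients of s, the squared distance is at least
   1 - 2 t + (1 + S) t^2. *)
Lemma dist_anchored_ge (V : pred {fset nat}) (G : {fset {fset nat}}) h s :
  HK h -> h = (fun=> 1) -> rkhs_ip HK h h = 1 ->
  all (fun p : R * X => `[< exists2 v, V v & anchored a v (val p.2) >]) s ->
  fset0 \notin G -> (forall u v, u \in G -> V v -> (u `&` v)%fset = fset0) ->
  forall S, S = \sum_(u <- G) gamma u * k a a ^+ #|` u| ->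
  S / (1 + S) <= rkhs_ip HK (fun x => h x - combo K s x) (fun x => h x - combo K s x).
Proof.
move=> Hh h1 hh sV G0 GV S SE.
have S0 : 0 <= S.
  rewrite SE; apply: sumr_ge0 => u _; rewrite mulr_ge0//.
  have := kk_diag_ge0 Hu (gamma := fun=> 1) (fun=> ler01) u (fun=> a).
  by rewrite mul1r kkE prodr_const_fset.
have Hc := rkhs_combo HK s.
rewrite rkhs_ip_sub_sq// hh (rkhs_ipC Hh Hc) rkhs_ip_combol// h1.
have [se ->] := combo_energy Hu gamma_ge0 HK s.
set t := \sum_(p <- s) _ * 1.
have tE : t = \sum_(p <- s) p.1 by apply: eq_bigr => p _; rewrite mulr1.
have sq : \sum_(p <- s) \sum_(q <- s) p.1 * q.1 = t ^+ 2.
  by rewrite tE expr2 mulr_suml; apply: eq_bigr => p _; rewrite mulr_sumr.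
have enE u : (forall p, p \in s -> forall j, j \in u -> val p.2 j = a) ->
    energy s u = gamma u * k a a ^+ #|` u| * t ^+ 2.
  move=> pa; rewrite /energy -mulrA; congr (_ * _); rewrite -sq mulr_sumr.
  apply: eq_big_seq => p ps; rewrite mulr_sumr; apply: eq_big_seq => q qs.
  rewrite kkE mulrC -prodr_const_fset; congr (_ * _).
  by apply: eq_big_seq => j ju; rewrite (pa p ps)// (pa q qs).
have le1 : (1 + S) * t ^+ 2 <= abs_sum (energy s).
  apply: le_trans (fsum_le_abs_sum (fset0 |` G)%fset _ se); last first.
    by move=> u; exact: energy_ge0.
  rewrite big_fsetU1//= enE ?gamma_0 ?cardfs0 ?expr0 ?mulr1 ?mulrDl ?lerD2l; last first.
    by move=> p _ j; rewrite inE.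
  rewrite SE mulr_suml big_seq [leRHS]big_seq; apply: ler_sum => u uG.
  rewrite enE// => p ps j ju.
  have /asboolP[v Vv pv] := allP sV p ps; apply: pv.
  by apply/negP => jv; have := GV u v uG Vv => /fsetP/(_ j); rewrite !inE ju jv.
have S1 : 0 < 1 + S by rewrite ltr_pwDl.
rewrite ler_pdivrMr//.
(* The quadratic is minimal at t = 1 / (1 + S), with value S / (1 + S). *)
have : 0 <= (t * (1 + S) - 1) ^+ 2 by exact: sqr_ge0.
have := ler_wpM2l (ltW S1) le1.
by rewrite expr2 expr2; nra.
Qed.

Lemma algorithm_lower_bound (Q : alg) (vs : seq {fset nat}) (G : {fset {fset nat}}) (x : R) :
  (forall f, HK f -> forall w, size (ra_pts Q f w) = size vs /\
     all2 (fun y v => `[< anchored a v (val y) >]) (ra_pts Q f w) vs) ->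
  (wc_error I Q (unit_ball HK) <= x%:E)%E ->
  fset0 \notin G -> (forall u v, u \in G -> v \in vs -> (u `&` v)%fset = fset0) ->
  forall S, S = \sum_(u <- G) gamma u * k a a ^+ #|` u| ->
  S / (1 + S) <= x ^+ 2.
Proof.
move=> Qvs Qx G0 GV S SE.
have [h Hh [hI [h1 hh]]] := Iop_representer.
pose Z : set X := [set z | exists2 v, v \in vs & anchored a v (val z)].
have [g [Hg gZ] [gh gg]] := rkhs_projection Z Hh.
pose f z := h z - g z.
have Hf : HK f by exact: rkhsB.
have fZ z v : v \in vs -> anchored a v (val z) -> f z = 0.
  by move=> vv zv; rewrite /f gh ?subrr//; exists v.
set n := rkhs_ip HK f f.
have n0 : 0 <= n by exact: rkhs_ip_ge0.
have fI : I f = n.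
  rewrite hI// /n /f rkhs_ip_sub_sq// gg (rkhs_ipC Hh Hf) rkhs_ipBl//.
  by rewrite (rkhs_ipC Hg Hh); ring.
have Sn : S / (1 + S) <= n.
  (* f is orthogonal to g and to the sections at the admissible points, so the squared distance from
     h to a combination is |f|^2 plus that from g to it, and the latter is below e. *)
  apply/ler_addgt0Pr => e e0; have [s sZ se] := gZ e e0.
  have Hc := rkhs_combo HK s.
  have := @dist_anchored_ge (fun v => v \in vs) G h s Hh h1 hh sZ G0 GV S SE.
  move/le_trans; apply.
  have Hgc := rkhsB Hg Hc.
  have -> : (fun z => h z - combo K s z) = (fun z => 1 * f z + (g z - combo K s z)).
    by apply/funext => z; rewrite /f; ring.
  rewrite rkhs_ip_lin_sq// expr1n !mul1r mulr1 -/n -addrA lerD2l.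
  suff -> : rkhs_ip HK f (fun z => g z - combo K s z) = 0 by rewrite mulr0 add0r ltW.
  rewrite (rkhs_ipC Hf Hgc) rkhs_ipBl// rkhs_ip_combol//.
  rewrite big_seq big1 ?subr0; last first.
    by move=> p ps; have /asboolP[v vv pv] := allP sZ p ps; rewrite (fZ _ v) ?mulr0.
  by rewrite (rkhs_ipC Hg Hf) /f rkhs_ipBl// -gg subrr.
apply: le_trans Sn _.
have [n00|nN0] := eqVneq n 0; first by rewrite n00 sqr_ge0.
have np : 0 < n by rewrite lt_neqAle eq_sym nN0.
(* Normalisation: c f and - c f lie in the unit ball, and their integrals are the two square roots
   of n. *)
pose c := (Num.sqrt n)^-1.
have c2 : c ^+ 2 = n^-1 by rewrite /c exprVn sqr_sqrtr.
pose f1 z := c * f z.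
have Hf1 : HK f1 by exact: rkhsZ.
have If1 : I f1 = c * n.
  by rewrite hI// /f1 (rkhs_ipC Hh (rkhsZ c Hf)) rkhs_ipZl// (rkhs_ipC Hf Hh) -hI// fI.
have f1B : unit_ball HK f1.
  split=> //; rewrite /rkhs_norm -sqrtr1 ler_sqrt//.
  by rewrite /f1 rkhs_ipZl// (rkhs_ipC Hf (rkhsZ c Hf)) rkhs_ipZl// mulrA -expr2 c2 mulVf.
have NE : (fun z => - f1 z) = (fun z => -1 * f1 z) by apply/funext => z; rewrite mulN1r.
have HNf1 : HK (fun z => - f1 z) by rewrite NE; exact: rkhsZ.
have INf1 : I (fun z => - f1 z) = - I f1.
  rewrite NE !hI//; last by rewrite -NE.
  by rewrite (rkhs_ipC Hh (rkhsZ (-1) Hf1)) rkhs_ipZl// (rkhs_ipC Hf1 Hh) mulN1r.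
have Nf1B : unit_ball HK (fun z => - f1 z).
  have Hm := rkhsZ (-1) Hf1; split=> //.
  rewrite /rkhs_norm NE (rkhs_ipZl (-1) Hf1 Hm) (rkhs_ipC Hf1 Hm) (rkhs_ipZl (-1) Hf1 Hf1).
  by rewrite !mulN1r opprK; exact: f1B.2.
have -> : n = I f1 ^+ 2 by rewrite If1 exprMn c2 expr2 mulrA mulVf// mul1r.
apply: (fooling Qvs Hf1 HNf1 INf1).
- by move=> z v vv zv; rewrite /f1 (fZ z v)// mulr0.
- exact: sqr_error_le.
- exact: sqr_error_le.
Qed.

End lower_bound.

(** * Sets of positive weight meeting the active variables *)

Section intersecting.
Context (R : realType) (gamma : {fset nat} -> R) (r : nat).
Hypothesis gamma_mono : forall u v : {fset nat}, (u `<=` v)%fset -> gamma v <= gamma u.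
Hypothesis gamma_inter : forall u : {fset nat}, 0 < gamma u ->
  ([set v : {fset nat} | 0 < gamma v /\ (u `&` v)%fset != fset0] #<= `I_(1 + r)%N)%card.

(** If {j} has positive weight, the intersection property applies to it; otherwise monotone weights
    leave no set of positive weight containing j. *)
Lemma containing_fset (j : nat) : exists2 B : {fset {fset nat}}, (#|` B| <= 1 + r)%N &
  forall u : {fset nat}, 0 < gamma u -> j \in u -> u \in B.
Proof.
have [gj|gj] := ltP 0 (gamma [fset j]%fset); last first.
  exists fset0 => // u gu ju; suff : 0 < gamma [fset j]%fset by rewrite ltNge gj.
  by apply: lt_le_trans gu _; apply: gamma_mono; rewrite fsub1set.
have le := gamma_inter gj.
exists (fset_set [set v : {fset nat} | 0 < gamma v /\ ([fset j] `&` v)%fset != fset0]).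
  exact: geq_card_fset_set.
move=> u gu ju; rewrite in_fset_set; last exact: card_le_finite le (finite_II _).
apply/mem_set; split => //; apply/fset0Pn; exists j.
by rewrite !inE eqxx.
Qed.

Lemma intersecting_fset (vs : seq {fset nat}) : exists2 B : {fset {fset nat}},
  (#|` B| <= 1 + (1 + r) * \sum_(v <- vs) #|` v|)%N &
  forall u, 0 < gamma u -> u \notin B ->
    u != fset0 /\ forall v, v \in vs -> (u `&` v)%fset = fset0.
Proof.
have [B HB1 HB2] : exists2 B : {fset {fset nat}},
    (#|` B| <= (1 + r) * size (flatten [seq enum_fset v | v <- vs]))%N &
    forall u : {fset nat}, 0 < gamma u ->
      forall j, j \in flatten [seq enum_fset v | v <- vs] -> j \in u -> u \in B.
  elim: (flatten _) => [|j l [B B1 B2]]; first by exists fset0.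
  have [B' B'1 B'2] := containing_fset j.
  exists (B' `|` B)%fset.
    by rewrite mulnS; apply: leq_trans (leq_add B'1 B1); rewrite cardfsU leq_subr.
  move=> u gu i; rewrite !inE => /orP[/eqP ->|il] iu; first by rewrite B'2.
  by rewrite (B2 u gu i)// orbT.
(* The empty set meets nothing but must be excluded as well, which accounts for the 1 in the
   bound. *)
exists (fset0 |` B)%fset.
  rewrite cardfsU1; apply: leq_add; first by case: (_ \notin _).
  by rewrite size_flatten /shape -map_comp sumnE big_map in HB1.
move=> u gu; rewrite !inE negb_or => /andP[u0 uB]; split => // v vv.
apply/eqP; rewrite -[_ == _]negbK; apply/negP => /fset0Pn[j].
rewrite !inE => /andP[ju jv]; move/negP: uB; apply.
by apply: HB2 ju => //; apply/flattenP; exists (enum_fset v) => //; exact: map_f.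
Qed.

End intersecting.

(** * From complexity to decay *)

Section decay_bound.
Context d (T : measurableType d) (R : realType) (rho : probability T R).
Variable k : T -> T -> R.
Hypothesis Hk : rkhs k.
Variable Hu : forall u : {fset nat}, rkhs (kprod k u).
Hypothesis k_meas : measurable_fun setT (fun z : T * T => k z.1 z.2).
Hypothesis M_fin : (\int[rho]_x (k x x)%:E < +oo)%E.
Hypothesis k_int0 : forall y, (\int[rho]_x (k x y)%:E = 0)%E.
Hypothesis k_pos : forall x, 0 < k x x.
Context (mu : probability (power nat T) R) (mu_product : is_product rho mu).
Variable gamma : {fset nat} -> R.
Hypothesis gamma_ge0 : forall u, 0 <= gamma u.
Hypothesis gamma_0 : gamma fset0 = 1.
Hypothesis gamma_sum : (\esum_(u in [set: {fset nat}])
  (gamma u * Mk rho k ^+ #|` u|)%:E < +oo)%E.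
Variable a : T.
Variable HK : rkhs (Kker k gamma).
Hypothesis gamma_mono : forall u v : {fset nat}, (u `<=` v)%fset -> gamma v <= gamma u.
Variable r : nat.
Hypothesis gamma_inter : forall u : {fset nat}, 0 < gamma u ->
  ([set v : {fset nat} | 0 < gamma v /\ (u `&` v)%fset != fset0] #<= `I_(1 + r)%N)%card.
Variables (dollar : nat -> \bar R) (dl : nat -> R).
Hypothesis dlE : forall n, dollar n = (dl n)%:E.
Hypothesis dl_ge1 : forall n, 1 <= dl n.
Hypothesis dl_omega : ebigOmega dollar (fun n => n%:R).

Local Notation I := (Iop k gamma mu).
Local Notation F := (unit_ball HK).

(** The asymptotic bound only starts at some N; below it, n <= N <= N dl(n) because costs are at
    least 1. *)
Lemma dollar_linear : exists2 c : R, 0 < c & forall n, n%:R <= c * dl n.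
Proof.
have [C [N _ CN]] := dl_omega; exists (`|C| + N%:R + 1).
  by rewrite ltr_wpDl// addr_ge0.
move=> n; have n1 := dl_ge1 n; have C0 := normr_ge0 C.
have N0 : 0 <= N%:R :> R by [].
have [Nn|nN] := leqP N n.
  have := CN n Nn; rewrite /= dlE -EFinM lee_fin => h; apply: le_trans h _.
  by have := ler_norm C; nra.
have : n%:R <= N%:R :> R by rewrite ler_nat ltnW.
nra.
Qed.

Lemma decay_lower_bound (p C s : R) : 0 <= p -> 0 <= C -> 0 < s -> s < 1 ->
  p < s * (2 + p) ->
  (forall eps, 0 < eps ->
    (eps_comp dollar a (rkhs_set HK) I eps F <= (C * eps `^ (- p))%:E)%E) ->
  ((s^-1)%:E <= decay k gamma a)%E.
Proof.
move=> p0 C0 s0 s1 ps HC; have [c c0 cP] := dollar_linear.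
have hat0 u : 0 <= gamma u * k a a ^+ #|` u| by rewrite mulr_ge0// exprn_ge0// ltW.
have A0 : 0 <= 1 + (1 + r)%:R * (c * (C + 1)).
  by rewrite addr_ge0// mulr_ge0// mulr_ge0// ?(ltW c0)// addr_ge0.
have [|M HM] := sparse_tail_summable hat0 A0 s0 s1 ps; last first.
  apply: ereal_sup_ubound; exists s^-1 => //=; rewrite invrK.
  apply: le_lt_trans (esum_le_fsum (f := fun u => (gamma u * k a a ^+ #|` u|) `^ s) HM) _.
  exact: ltry.
move=> eps e0 e2.
(* Lets the additive constants, one for the empty set and one for the slack in the infimum, be
   absorbed into eps^-p. *)
have ep1 : 1 <= eps `^ (- p).
  rewrite powRN invf_ge1 ?powR_gt0// -[leRHS](congr1 (@^~ p) (powR1 R)).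
  apply: ge0_ler_powR; rewrite ?nnegrE ?(ltW e0)//.
  by apply: le_trans e2 _; rewrite invf_le1// ler1n.
have [Q [[vs [Q1 Q2]] Q3 Q4]] : exists Q : rand_alg
    (fun x => eval_cost dollar a (val x)) (rkhs_set HK),
    [/\ Ares Q, (wc_error I Q F <= eps%:E)%E & (wc_cost Q F < (C * eps `^ (- p) + 1)%:E)%E].
  apply: eps_comp_alg; apply: le_lt_trans (HC eps e0) _.
  by rewrite lte_fin ltrDl.
have [B B1 B2] := intersecting_fset gamma_mono gamma_inter vs.
exists B.
  have cost_le : \sum_(v <- vs) dl #|` v| <= C * eps `^ (- p) + 1.
    rewrite -lee_fin; apply: ltW; apply: le_lt_trans Q4.
    apply: (@le_trans _ _ (mean_cost Q (fun=> 0))); last first.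
      by apply: ereal_sup_ubound; exists (fun=> 0) => //; exact: unit_ball0.
    rewrite Q2; last exact: rkhs0.
    by rewrite -sumEFin; under [leRHS]eq_bigr do rewrite dlE.
  have card_le : (\sum_(v <- vs) #|` v|)%:R <= c * (C * eps `^ (- p) + 1).
    apply: le_trans (ler_wpM2l (ltW c0) cost_le).
    by rewrite natr_sum mulr_sumr; apply: ler_sum.
  move: B1; rewrite -(ler_nat R) natrD natrM => /le_trans; apply.
  rewrite mulrDl mul1r; apply: lerD => //; rewrite -mulrA ler_wpM2l//.
  apply: le_trans card_le _; rewrite -mulrA ler_wpM2l ?(ltW c0)//.
  by rewrite mulrDl mul1r lerD2l.
move=> G GB.
(* Sets of weight zero add nothing to the sum, and [B] only controls sets of positive weight. *)
pose G' := [fset u in G | 0 < gamma u]%fset.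
have -> : \sum_(u <- G) gamma u * k a a ^+ #|` u| = \sum_(u <- G') gamma u * k a a ^+ #|` u|.
  symmetry; apply: big_fset_incl.
    by apply/fsubsetP => u; rewrite !inE => /andP[].
  move=> u uG; rewrite !inE uG/= => gu; rewrite (_ : gamma u = 0) ?mul0r//.
  by apply/eqP; rewrite eq_le gamma_ge0 leNgt gu.
set S := \sum_(u <- G') _.
have G'P u : u \in G' -> u != fset0 /\ forall v, v \in vs -> (u `&` v)%fset = fset0.
  by rewrite !inE => /andP[uG gu]; apply: B2 => //; exact: GB.
have S0 : 0 <= S by apply: sumr_ge0.
have G'0 : fset0 \notin G'.
  by apply/negP => /G'P[]; rewrite eqxx.
have G'V u v : u \in G' -> v \in vs -> (u `&` v)%fset = fset0.
  by move=> /G'P[_]; exact.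
have := algorithm_lower_bound Hk Hu k_meas M_fin k_int0 mu_product gamma_ge0 gamma_0
  gamma_sum Q1 Q3 G'0 G'V (erefl S).
have S1 : 0 < 1 + S by rewrite ltr_pwDl.
rewrite ler_pdivrMr//.
(* From S <= eps^2 (1 + S) and eps^2 <= 1/4 follows S <= 2 eps^2. *)
have : eps ^+ 2 <= 2^-1 * 2^-1 by rewrite expr2; apply: ler_pM => //; exact: ltW.
by nra.
Qed.

End decay_bound.

(** * From the error lower bound to complexity *)

Section error_bound.
Context d (T : measurableType d) (R : realType).
Variables (dollar : nat -> \bar R) (a : T) (X : set (power nat T)).
Variables (L : X -> X -> R) (HK : rkhs L) (I : (X -> R) -> R).
Local Notation F := (unit_ball HK).

(** Otherwise take p' strictly between p and 2/tau. A budget N then achieves an error of order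
    N^(-1/p'), which decays faster than N^(-tau/2). *)
Lemma tau_lower_bound (p C tau : R) : 0 <= p -> 0 <= C -> 0 < tau ->
  (forall eps, 0 < eps ->
    (eps_comp dollar a (rkhs_set HK) I eps F <= (C * eps `^ (- p))%:E)%E) ->
  ebigOmega (fun N => min_error dollar a (rkhs_set HK) I N F)
    (fun N => N%:R `^ (- (tau / 2))) ->
  2 / tau <= p.
Proof.
move=> p0 C0 tau0 HC [C' HC']; rewrite leNgt; apply/negP => p_tau.
pose p' := (p + 2 / tau) / 2.
have pp' : p < p' by rewrite /p'; lra.
have p't : p' < 2 / tau by rewrite /p'; lra.
have p'0 : 0 < p' by apply: le_lt_trans pp'.
have C10 : 0 < C + 1 by rewrite ltr_wpDl.
pose D := `|C'| * (C + 1) `^ p'^-1.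
pose th := p'^-1 - tau / 2.
have th0 : 0 < th.
  by rewrite /th subr_gt0 -[tau / 2]invf_div ltf_pV2 ?posrE// divr_gt0.
have bound : \forall N \near \oo, N%:R `^ th <= D.
  near=> N.
  have NC : C + 1 <= N%:R by near: N; exact: nbhs_infty_ger.
  have N0 : 0 < N%:R :> R by exact: lt_le_trans NC.
  have hN : ((N%:R `^ (- (tau / 2)))%:E <=
      C'%:E * min_error dollar a (rkhs_set HK) I N F)%E by near: N.
  (* Chosen so that C eps^-p <= C eps^-p' = C N / (C + 1) < N; the strict inequality yields an
     actual algorithm from the infimum. *)
  pose y := (C + 1) / N%:R.
  have y0 : 0 < y by rewrite divr_gt0.
  have y1 : y <= 1 by rewrite ler_pdivrMr// mul1r.
  pose eps := y `^ p'^-1.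
  have e0 : 0 < eps by rewrite powR_gt0.
  have e1 : eps <= 1.
    rewrite -[leRHS](congr1 (@^~ p'^-1) (powR1 R)).
    by apply: ge0_ler_powR; rewrite ?nnegrE ?invr_ge0// ltW.
  have eN : eps `^ (- p') = N%:R / (C + 1).
    by rewrite /eps -powRrM mulrN mulVf ?gt_eqF// powR_inv1 ?(ltW y0)// invf_div.
  have minN : (min_error dollar a (rkhs_set HK) I N F <= eps%:E)%E.
    have : (eps_comp dollar a (rkhs_set HK) I eps F < N%:R%:E)%E.
      apply: le_lt_trans (HC eps e0) _; rewrite lte_fin.
      apply: (@le_lt_trans _ _ (C * eps `^ (- p'))).
        rewrite ler_wpM2l// !powRN lef_pV2 ?posrE ?powR_gt0//.
        by apply: ger_powR; rewrite ?e0//= ltW.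
      rewrite eN mulrA ltr_pdivrMr//; lra.
    move=> /eps_comp_alg[Q [Q1 Q2 Q3]].
    apply: le_trans Q2; apply: ereal_inf_lbound; exists Q; split => //.
    exact: ltW.
  have : (C'%:E * min_error dollar a (rkhs_set HK) I N F <= (`|C'| * eps)%:E)%E.
    rewrite EFinM; apply: (@le_trans _ _ (`|C'|%:E * min_error dollar a (rkhs_set HK) I N F)%E).
      by apply: lee_wpmul2r; [exact: min_error_ge0|rewrite lee_fin ler_norm].
    by apply: lee_wpmul2l; rewrite ?lee_fin.
  move=> /(le_trans hN); rewrite lee_fin => h.
  rewrite /th powRD ?(gt_eqF N0) ?implybT//.
  apply: (@le_trans _ _ (N%:R `^ p'^-1 * (`|C'| * eps))); first by rewrite ler_wpM2l ?powR_ge0.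
  rewrite /eps /y powRM ?invr_ge0 ?(ltW C10)// /D.
  rewrite le_eqVlt; apply/orP; left; apply/eqP.
  rewrite mulrCA; congr (_ * _); rewrite mulrCA -powRM ?invr_ge0//.
  by rewrite mulfV ?gt_eqF// powR1 mulr1.
have [N0 _ HN] := bound.
have D0 : 0 <= D by rewrite mulr_ge0// powR_ge0.
pose N := (N0 + Num.truncn ((D + 1) `^ th^-1)).+1.
have := HN N; rewrite /= => /(_ _)/wrap[].
  by rewrite /N -addSn (leq_trans (leqnSn _))// leq_addr.
apply/negP; rewrite -ltNge; apply: (@lt_le_trans _ _ (D + 1)); first by rewrite ltrDl.
have -> : D + 1 = ((D + 1) `^ th^-1) `^ th.
  by rewrite -powRrM mulVf ?gt_eqF// powRr1// addr_ge0.
apply: ge0_ler_powR; rewrite ?nnegrE ?powR_ge0 ?(ltW th0)//.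
apply: ltW; apply: lt_le_trans (truncnS_gt _) _.
by rewrite ler_nat /N ltnS leq_addl.
Unshelve. all: by end_near.
Qed.

End error_bound.

Local Open Scope ereal_scope.

Theorem theorem4p2 (R : realType) (D : set R) (a : D)
  (rho : probability (trace a) R)
  (rhou : forall u : {fset nat}, probability (power u (trace a)) R)
  (rhou_product : forall u : {fset nat}, is_product rho (rhou u))
  (mu : probability (power nat (trace a)) R)
  (mu_product : is_product rho mu)
  (k : trace a -> trace a -> R)
  (k_kernel : reproducing_kernel k)
  (k_neq0 : exists x y, k x y != 0%R)
  (k_meas : measurable_fun setT (fun z : trace a * trace a => k z.1 z.2))
  (Hk : rkhs k)
  (Hk_noconst : forall c : R, Hk (fun=> c) -> c = 0%R)
  (M_fin : \int[rho]_x (k x x)%:E < +oo)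
  (k_int0 : forall y, \int[rho]_x (k x y)%:E = 0)
  (k_pos : forall x, (0 < k x x)%R)
  (gamma : {fset nat} -> R)
  (gamma_ge0 : forall u, (0 <= gamma u)%R)
  (gamma_0 : gamma fset0 = 1%R)
  (gamma_sum : \esum_(u in [set: {fset nat}])
     (gamma u * fine (\int[rho]_x (k x x)%:E) ^+ #|` u|)%:E < +oo)
  (gamma_closed : forall u v : {fset nat}, (u `<=` v)%fset ->
     (0 < gamma v)%R -> (0 < gamma u)%R)
  (Hu : forall u : {fset nat}, rkhs (kprod k u))
  (HK : rkhs (Kker (T := trace a) k gamma))
  (a_anchor : \esum_(u in [set: {fset nat}])
     (gamma u * k a a ^+ #|` u|)%:E < +oo)
  (dollar : nat -> \bar R)
  (dollar_ge1 : forall n, 1 <= dollar n)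
  (dollar_mono : forall m n, (m <= n)%N -> dollar m <= dollar n)
  (tau : R) :
  let dec := decay k gamma a in
  let I := Iop k gamma mu in
  let e N := min_error (T := trace a) dollar a (rkhs_set HK) I N (unit_ball HK) in
  let p_res := pres (T := trace a) dollar a (rkhs_set HK) I (unit_ball HK) in
  (exists2 sigma : R, (0 < sigma)%R &
     ebigO dollar (fun nu => expR (sigma * nu%:R))) ->
  finite_intersection gamma ->
  1 < dec ->
  quadrature_assumption rho rhou gamma Hu tau ->
  (forall u v : {fset nat}, (u `<=` v)%fset -> (gamma v <= gamma u)%R) ->
  [/\ (forall delta : R, (0 < delta)%R ->
         ebigO (fun N => e N ^+ 2)
           (fun N => N%:R `^ (- fine (mine tau%:E (dec - 1)%E) + delta))%R),
      p_res <= maxe (2 / tau)%R%:E (2%:E / (dec - 1)) &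
      forall alpha : R, alpha = tau ->
        ebigOmega e (fun N => N%:R `^ (- (alpha / 2)))%R ->
        ebigOmega dollar (fun nu => nu%:R)%R ->
        p_res = maxe (2 / alpha)%R%:E (2%:E / (dec - 1))].
Proof.
move=> dec I e p_res [sigma sigma0 dol_exp] [[beta beta0 gamma_order] [r r0 gamma_inter]]
  dec1 quad gamma_mono.
have [tau0 _] := quad.
pose dl n := fine (dollar n).
have dlE n : dollar n = (dl n)%:E.
  (* The growth bound gives finiteness at some index beyond n, and monotonicity passes it down to
     n. *)
  rewrite fineK// ge0_fin_numE; last exact: le_trans (dollar_ge1 n).
  have [C [N _ CN]] := dol_exp.
  have := CN (maxn N n) (leq_maxl _ _).
  move=> /(le_trans (dollar_mono _ _ (leq_maxr N n)))/le_lt_trans; apply.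
  exact: ltry.
have dl_mono m n : (m <= n)%N -> (dl m <= dl n)%R.
  by move=> mn; rewrite -lee_fin -!dlE; exact: dollar_mono.
have dl_ge1 n : (1 <= dl n)%R by rewrite -lee_fin -dlE.
have family q : (0 < q)%R -> (q < tau)%R -> ((1 + q)%:E < dec)%E ->
  exists C1 C2 : R, [/\ (0 < C1)%R, (0 < C2)%R & forall m, (1 <= m)%R ->
  exists Q : rand_alg (fun x : Xset k gamma => eval_cost (T := trace a) dollar a (val x))
      (rkhs_set HK),
    [/\ Ares Q,
        (forall f, HK f -> (mean_cost Q f <= (C1 * m)%:E)%E) &
        forall f, unit_ball HK f ->
          ('E_(ra_P Q)[fun w => ((Iop k gamma mu f - ra_val Q f w) ^+ 2)%R] <=
          (C2 * m `^ (- q))%:E)%E]].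
  by move=> q0 q_tau q_dec; eapply upper_family; eassumption.
have [B B0 IB] := Iop_bound Hk Hu k_meas M_fin mu_product gamma_ge0 gamma_sum HK.
have [s s0 [sE [sP s_dec]]] := inve_decayE dec1.
have upper : p_res <= maxe (2 / tau)%R%:E (2%:E / (dec - 1)).
  rewrite sE -EFin_max; apply/lee_addgt0Pr => x x0; rewrite -EFinD.
  (* With p slightly above both candidates, q = 2 / p lies below tau and 1 + q below the decay. *)
  set p := (_ + x)%R.
  have ps : (s < p)%R by rewrite ltr_pwDr// le_max lexx orbT.
  have pt : (2 / tau < p)%R by rewrite ltr_pwDr// le_max lexx.
  have p0 : (0 < p)%R by exact: le_lt_trans ps.
  have [|||C1 [C2 [C10 C20 fam]]] := family (2 / p)%R.
  - by rewrite divr_gt0.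
  - by rewrite ltr_pdivrMr// mulrC -ltr_pdivrMr.
  - exact: sP.
  have [|C C0 HC] := eps_comp_rate dlE C10 C20 _ fam IB; first by rewrite divr_gt0.
  apply: ereal_inf_lbound; exists p => //; split; first exact: ltW.
  exists C => // eps eps0; have := HC eps eps0.
  by rewrite invf_div mulrCA mulfV ?mulr1.
split => // [delta delta0|alpha -> e_omega dol_omega].
  have [q [q0 q_tau q_dec qd]] := rate_below tau0 dec1 delta0.
  have [C1 [C2 [C10 C20 fam]]] := family q q0 q_tau q_dec.
  exact: min_error_rate C10 C20 fam _ qd.
apply/eqP; rewrite eq_le upper/=; apply: le_ereal_inf_tmp => _ [p [p0 [C C0 HC]] <-].
rewrite ge_max; apply/andP; split.
  by rewrite lee_fin; exact: tau_lower_bound HC e_omega.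
rewrite sE lee_fin leNgt; apply/negP => p_s.
(* A complexity exponent p below 2 / (dec - 1) would give 1 / t <= dec for a t with dec < 1 / t. *)
have [t [t0 t1 pt dect]] := s_dec p p0 p_s.
have := decay_lower_bound Hk Hu k_meas M_fin k_int0 k_pos mu_product gamma_ge0 gamma_0
  gamma_sum gamma_mono gamma_inter dlE dl_ge1 dol_omega p0 C0 t0 t1 pt HC.
by rewrite leNgt dect.
Qed.
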